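(* Let $\mathcal{A}=(A_n)$ be a symmetric van Hove averaging sequence in $\mathbb{R}^d$, let $\mu$ be a translation-bounded Radon measure on $\mathbb{R}^d$ that has null FB spectrum with respect to $\mathcal{A}$, and let $\varLambda$ be a regular model set in $\mathbb{R}^d$. Then the Eberlein convolution $\mu\circledast\delta_{\varLambda}$ exists along $\mathcal{A}$ and $\mu\circledast\delta_{\varLambda}=0$.
   Context: A Radon measure $\mu$ on $\mathbb{R}^d$ is translation-bounded if $\sup_t|\mu|(t+K)<\infty$ for some compact $K$ with nonempty interior. An averaging sequence is a sequence $(A_n)$ of compact sets with $A_n\subset A_{n+1}^{\circ}$ and $\bigcup_nA_n=\mathbb{R}^d$; symmetric means $A_n=-A_n$; van Hove means $\lim_n\mathrm{vol}(\partial^KA_n)/\mathrm{vol}(A_n)=0$ for every compact $K$, where $\partial^K C=((C+K)\setminus C^{\circ})\cup((\overline{\mathbb{R}^d\setminus C}-K)\cap C)$. $\mu$ has null FB spectrum w.r.t. $\mathcal{A}$ if for all $k\in\mathbb{R}^d$, $\lim_n\frac{1}{\mathrm{vol}(A_n)}\int_{A_n}e^{-2\pi i kt}\,\mathrm{d}\mu(t)=0$ (limit existing). For translation-bounded $\mu,\nu$, the Eberlein convolution along $\mathcal{A}$ is the vague limit $\mu\circledast\nu=\lim_n\frac{\mu|_{A_n}*\nu|_{A_n}}{\mathrm{vol}(A_n)}$, said to exist when the limit exists; $\mu|_{A}$ is the restriction. $\delta_S=\sum_{x\in S}\delta_x$ is the Dirac comb of $S$. A cut and project scheme $(\mathbb{R}^d,H,\mathcal{L})$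 consists of a compactly generated locally compact Abelian group $H$ and a lattice (co-compact discrete subgroup) $\mathcal{L}\subset\mathbb{R}^d\times H$ such that the canonical projection $\pi$ to $\mathbb{R}^d$ is injective on $\mathcal{L}$ and the projection of $\mathcal{L}$ to $H$ is dense; with $L=\pi(\mathcal{L})$ the star map $x\mapsto x^\star$ sends $\pi(y)$ to the $H$-component of $y\in\mathcal{L}$. A regular model set is $\varLambda=\{x\in L: x^\star\in W\}$ with $W\subseteq H$ compact, $W=\overline{W^{\circ}}\neq\varnothing$, and $\partial W$ of Haar measure zero. *)

(* Defs.v *)
From HB Require Import structures.
From mathcomp Require Import all_boot all_order all_algebra.
From mathcomp Require Import all_classical all_reals all_analysis.
From mathcomp Require Import complex.
Import Order.TTheory GRing.Theory Num.Theory.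
Import numFieldTopology.Exports numFieldNormedType.Exports.

Set Implicit Arguments.
Unset Strict Implicit.
Unset Printing Implicit Defensive.

Local Open Scope classical_set_scope.
Local Open Scope ring_scope.

HB.instance Definition _ (R : rcfType) := PseudoPointedMetric.copy R[i] (R[i])^o.

Definition borel (T : ptopologicalType) := g_sigma_algebraType (@open T).

(* R^d is 'rV[R]_d (row vectors, product/max-norm topology).                *)

Section Rd.
Variables (R : realType) (d : nat).
Local Notation E := 'rV[R]_d.

Definition obox (a b : E) : set E := [set x | forall i, a 0 i < x 0 i < b 0 i].
Definition boxvol (a b : E) : R := \prod_(i < d) (b 0 i - a 0 i).
Definition lebesgue_d (S : set E) : \bar R :=
  ereal_inf [set v | exists (I : set nat) (a b : nat -> E),
    [/\ (forall k i, a k 0 i <= b k 0 i),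
        S `<=` \bigcup_(k in I) obox (a k) (b k) &
        v = (\esum_(k in I) (boxvol (a k) (b k))%:E)%E]].
Definition vol (S : set E) : R := fine (lebesgue_d S).

Definition averaging_seq (A : nat -> set E) :=
  [/\ forall n, compact (A n),
      forall n, A n `<=` interior (A n.+1) &
      \bigcup_n A n = setT].
Definition symmetric_seq (A : nat -> set E) :=
  forall n, [set - x | x in A n] = A n.
Definition Kboundary (K C : set E) : set E :=
  ([set z | exists x y, [/\ C x, K y & z = x + y]] `\` interior C) `|`
  ([set z | exists x y, [/\ closure (~` C) x, K y & z = x - y]] `&` C).
Definition van_Hove (A : nat -> set E) :=
  forall K : set E, compact K ->
    (fun n => vol (Kboundary K (A n)) / vol (A n)) @ \oo --> (0 : R).

(* Complex Radon measures on R^d, written (Jordan decomposition) as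
   mu = mu_0 - mu_1 + i (mu_2 - mu_3) with mu_j positive Borel measures
   that are finite on compact sets. *)
Record cradon := CRadon {
  cr_part : 'I_4 -> {measure set (borel E) -> \bar R};
  cr_locfin : forall j (K : set E), compact K -> (cr_part j K < +oo)%E }.

(* mu(B), for bounded Borel B *)
Definition cmeas (mu : cradon) (B : set E) : R[i] :=
  Complex (fine (cr_part mu 0 B) - fine (cr_part mu 1 B))
          (fine (cr_part mu 2 B) - fine (cr_part mu 3 B)).

(* \int_A g dmu for complex valued g (A compact, g continuous) *)
Definition rpart_int (nu : {measure set (borel E) -> \bar R}) (A : set E)
  (g : E -> R[i]) : R[i] :=
  Complex (Rintegral nu A (fun x : borel E => complex.Re (g x)))
          (Rintegral nu A (fun x : borel E => complex.Im (g x))).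
Definition cint (mu : cradon) (A : set E) (g : E -> R[i]) : R[i] :=
  rpart_int (cr_part mu 0) A g - rpart_int (cr_part mu 1) A g
  + 'i * (rpart_int (cr_part mu 2) A g - rpart_int (cr_part mu 3) A g).

Definition ctotvar (mu : cradon) (B : set E) : \bar R :=
  ereal_sup [set v | exists (m : nat) (P : 'I_m -> set (borel E)),
    [/\ forall j, measurable (P j),
        forall j k, j != k -> P j `&` P k = set0,
        \bigcup_(j in [set: 'I_m]) P j = B &
        v = (\sum_(j < m) ComplexField.Normc.normc (cmeas mu (P j)))%:E]].

Definition translation_bounded (mu : cradon) :=
  exists K : set E, [/\ compact K, interior K !=set0 &
    exists M : R, forall t : E, (ctotvar mu [set (t + x)%R | x in K] <= M%:E)%E].

Definition dotp (k t : E) : R := \sum_(i < d) k 0 i * t 0 i.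
Definition charexp (k : E) (t : E) : R[i] :=
  Complex (cos (- (2 * pi * dotp k t))) (sin (- (2 * pi * dotp k t))).
Definition null_FB (mu : cradon) (A : nat -> set E) :=
  forall k : E,
    (fun n => real_complex R ((vol (A n))^-1) * cint mu (A n) (charexp k)) @ \oo --> (0 : R[i]).

Definition Cc (f : E -> R[i]) :=
  continuous f /\ exists K : set E, compact K /\ forall x, ~ K x -> f x = 0.

(* (mu|_A * (delta_S)|_A)(f) = sum_{y in S n A} \int_A f(x+y) dmu(x) *)
Definition restr_conv_comb (mu : cradon) (S A : set E) (f : E -> R[i]) : R[i] :=
  (\sum_(y \in S `&` A) cint mu A (fun x => f (x + y)))%R.

(* The Eberlein convolution mu [*] delta_S along A exists and equals 0:
   the vague limit of (mu|_{A_n} * delta_S|_{A_n}) / vol(A_n) is 0. *)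
Definition eberlein_comb_zero (mu : cradon) (S : set E) (A : nat -> set E) :=
  forall f, Cc f ->
    (fun n => real_complex R ((vol (A n))^-1) * restr_conv_comb mu S (A n) f) @ \oo --> (0 : R[i]).

End Rd.

Definition LCA (H : topologicalZmodType) :=
  hausdorff_space H /\ locally_compact [set: H].

Definition compactly_generated (H : topologicalZmodType) :=
  exists K : set H, compact K /\
    forall h : H, exists s : seq H,
      (forall x, x \in s -> K x \/ K (- x)) /\ h = \sum_(x <- s) x.

(* A pointed copy of H (base point 0), to form its Borel sigma-algebra. *)
Definition zpt (H : topologicalZmodType) : Type := H.
HB.instance Definition _ (H : topologicalZmodType) := Topological.copy (zpt H) H.
HB.instance Definition _ (H : topologicalZmodType) := isPointed.Build (zpt H) (0 : H).

Definition haar_measure (R : realType) (H : topologicalZmodType)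
  (th : {measure set (borel (zpt H)) -> \bar R}) :=
  [/\ forall K : set H, compact K -> (th K < +oo)%E,
      forall B : set (borel (zpt H)), measurable B ->
        th B = ereal_inf [set v | exists U : set H, [/\ open U, B `<=` U & v = th U]],
      forall U : set H, open U ->
        th U = ereal_sup [set v | exists K : set H, [/\ compact K, K `<=` U & v = th K]],
      th setT != 0%E &
      forall (x : H) (B : set (borel (zpt H))), measurable B ->
        th [set z : H | exists2 y : H, B y & z = x + y] = th B].

Definition cut_project_scheme (R : realType) (d : nat) (H : topologicalZmodType)
  (L : set ('rV[R]_d * H)) :=
  [/\ L 0 /\ (forall y z, L y -> L z -> L (y - z)),
      (forall y, L y -> exists U, [/\ open U, U y & U `&` L = [set y]]),
      (* co-compact: (R^d x H)/L is compact, i.e. every cover of R^d x H by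
         L-invariant open sets has a finite subcover *)
      (forall (I : Type) (U : I -> set ('rV[R]_d * H)),
         (forall i, open (U i)) ->
         (forall i z l, U i z -> L l -> U i (z + l)) ->
         \bigcup_(i in [set: I]) U i = setT ->
         exists2 J : set I, finite_set J & \bigcup_(i in J) U i = setT),
      (forall y z, L y -> L z -> y.1 = z.1 -> y = z) &
      closure [set y.2 | y in L] = setT].

Definition regular_window (R : realType) (H : topologicalZmodType)
  (th : {measure set (borel (zpt H)) -> \bar R}) (W : set H) :=
  [/\ compact W, closure (interior W) = W, W !=set0 &
      th (closure W `\` interior W) = 0%E].

Definition model_set (R : realType) (d : nat) (H : topologicalZmodType)
  (L : set ('rV[R]_d * H)) (W : set H) : set 'rV[R]_d :=
  [set y.1 | y in [set y | L y /\ W y.2]].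

(* Main.v *)
(** Since the window has null boundary, its indicator is within a bump [u] of
    small Haar mass of a compactly supported continuous [h : H -> [0, 1]].
    Counting lattice points cube by cube, with the van Hove property controlling
    the cubes near the boundary of [A n], bounds the averaged contribution of [u],
    so it is enough to show that the periodized function
    [F x = sum_(l in L) f (x + l.1) h (l.2)] has vanishing averages against [mu].
    Co-compactness of the lattice makes [F] Bohr almost periodic and uniformly
    continuous.  If its averages did not tend to 0, then along some ultrafilter
    [t |-> lim_n (vol A_n)^-1 int_(A_n) F (x + t) dmu(x)] would be a nonzero almost
    periodic function, hence would have a nonzero Fourier coefficient at some
    character [chi].  This [chi] is continuous, so it is an exponential, and
    exchanging the mean over [t] with the limit gives a nonzero Fourier-Bohr
    coefficient of [mu], contrary to the hypothesis.  Almost periodic functions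
    are treated through their convolution algebra on the discrete group, where
    the character is obtained from a minimal spectral idempotent. *)

Require Import Defs.
From HB Require Import structures.
From mathcomp Require Import all_boot all_order all_algebra.
From mathcomp Require Import all_classical all_reals all_analysis.
From mathcomp Require Import complex.
From mathcomp Require Import measurable_realfun ring lra.
Import Order.TTheory GRing.Theory Num.Theory.
Import numFieldTopology.Exports numFieldNormedType.Exports.
Local Open Scope classical_set_scope.
Local Open Scope ring_scope.

Set Implicit Arguments.
Unset Strict Implicit.
Unset Printing Implicit Defensive.

(** If [x] lies in [A n] and [f (x + y)] is nonzero, then [y] is close to [- x], which symmetry puts
    back into [A n]. Translation-boundedness enters through two uniform bounds: integrals of
    translates of [f] are bounded independently of [n] and of the translate, and averages over [A n]
    are bounded by a constant times the sup norm. The ultrafilter yields the limits for all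
    (uncountably many) [t] at once. A mean is a uniform limit of averages over finitely many
    translates, so exchanging it with an ultralimit is an exchange with a finite sum plus an error
    controlled by the sup norm. The spectral idempotent comes from a power method: normalised even
    convolution powers are Cauchy in mean square, and one more convolution turns this into uniform
    convergence. The constants of the density estimate depend only on a fixed compact neighbourhood
    of the window; hence the bump [u] may be chosen after them. *)

Section complex_modulus.
Variable R : realType.
Local Notation C := R[i].
Local Notation nm := (@ComplexField.Normc.normc R).
Local Notation rc := (real_complex R).
Implicit Types z w : C.

Lemma nm_ge0 z : 0 <= nm z.
Proof. by case: z => a b; exact: sqrtr_ge0. Qed.

Lemma nm0 : nm 0 = 0. Proof. exact: ComplexField.Normc.normc0. Qed.

Lemma nm1 : nm 1 = 1. Proof. exact: ComplexField.Normc.normc1. Qed.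

Lemma nm_eq0 z : nm z = 0 -> z = 0.
Proof. exact: ComplexField.Normc.eq0_normc. Qed.

Lemma nmM z w : nm (z * w) = nm z * nm w.
Proof. exact: ComplexField.Normc.normcM. Qed.

Lemma nmV z : nm z^-1 = (nm z)^-1.
Proof. exact: ComplexField.Normc.normcV. Qed.

Lemma nmD z w : nm (z + w) <= nm z + nm w.
Proof. exact: le_normcD. Qed.

Lemma nmN z : nm (- z) = nm z.
Proof. exact: normcN. Qed.

Lemma nmB z w : nm (z - w) <= nm z + nm w.
Proof. by rewrite -[nm w]nmN; exact: nmD. Qed.

Lemma nm_distC z w : nm (z - w) = nm (w - z).
Proof. by rewrite -nmN opprB. Qed.

Lemma nm_tri y z w : nm (z - w) <= nm (z - y) + nm (y - w).
Proof. by apply: le_trans (nmD _ _); rewrite addrA subrK. Qed.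

Lemma sqr_nm z : nm z ^+ 2 = complex.Re z ^+ 2 + complex.Im z ^+ 2.
Proof. by case: z => a b /=; rewrite sqr_sqrtr // addr_ge0 ?sqr_ge0. Qed.

Lemma nmJ z : nm (conjc z) = nm z.
Proof. by case: z => a b /=; rewrite sqrrN. Qed.

Lemma nm_real (x : R) : nm (rc x) = `|x|.
Proof. by rewrite /= expr0n /= addr0 sqrtr_sqr. Qed.

Lemma nm_nat n : nm n%:R = n%:R.
Proof. by rewrite -(rmorph_nat (real_complex R)) nm_real normr_nat. Qed.

Lemma nm_i : nm (Complex 0 1) = 1.
Proof. by rewrite /= expr0n /= add0r expr1n sqrtr1. Qed.

Lemma mulJ z : z * conjc z = rc (nm z ^+ 2).
Proof.
rewrite sqr_nm; case: z => a b /=; apply/eqP; rewrite eq_complex /=.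
by apply/andP; split; apply/eqP; ring.
Qed.

Lemma le_Re_nm z : `|complex.Re z| <= nm z.
Proof.
rewrite -(@ler_pXn2r _ 2) ?nnegrE ?nm_ge0 //.
by rewrite sqr_nm real_normK ?num_real // lerDl sqr_ge0.
Qed.

Lemma le_Im_nm z : `|complex.Im z| <= nm z.
Proof.
rewrite -(@ler_pXn2r _ 2) ?nnegrE ?nm_ge0 //.
by rewrite sqr_nm real_normK ?num_real // lerDr sqr_ge0.
Qed.

Lemma nm_le_ReIm z : nm z <= `|complex.Re z| + `|complex.Im z|.
Proof.
rewrite {1}[z]complexE (le_trans (nmD _ _)) // nm_real nmM nm_real nm_i.
by rewrite mul1r.
Qed.

Lemma Re_le_nm z : complex.Re z <= nm z.
Proof. exact: le_trans (ler_norm _) (le_Re_nm z). Qed.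

Lemma ReD z w : complex.Re (z + w) = complex.Re z + complex.Re w.
Proof. by case: z w => [a b] [c d]. Qed.

Lemma ReN z : complex.Re (- z) = - complex.Re z.
Proof. by case: z. Qed.

Lemma ImD z w : complex.Im (z + w) = complex.Im z + complex.Im w.
Proof. by case: z w => [a b] [c d]. Qed.

Lemma ImN z : complex.Im (- z) = - complex.Im z.
Proof. by case: z. Qed.

Lemma ReZ (a : R) z : complex.Re (rc a * z) = a * complex.Re z.
Proof. by case: z => b c /=; rewrite mul0r subr0. Qed.

Lemma Re_iM z : complex.Re (Complex 0 1 * z) = - complex.Im z.
Proof. by case: z => b c /=; rewrite mul0r mul1r add0r. Qed.

Lemma Re_sum I (s : seq I) (F : I -> C) :
  complex.Re (\sum_(i <- s) F i) = \sum_(i <- s) complex.Re (F i).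
Proof. by elim/big_rec2 : _ => // i y1 y2 _ <-; rewrite ReD. Qed.

Lemma nm_sum I (s : seq I) (F : I -> C) :
  nm (\sum_(i <- s) F i) <= \sum_(i <- s) nm (F i).
Proof.
elim/big_rec2 : _ => [|i y1 y2 _ h]; first by rewrite nm0.
by apply: le_trans (nmD _ _) _; rewrite lerD2l.
Qed.

Lemma conjM z w : conjc (z * w) = conjc z * conjc w.
Proof. exact: rmorphM. Qed.

Lemma conjD z w : conjc (z + w) = conjc z + conjc w.
Proof. exact: rmorphD. Qed.

Lemma conjN z : conjc (- z) = - conjc z.
Proof. exact: rmorphN. Qed.

Lemma conj_rc (x : R) : conjc (rc x) = rc x.
Proof. by rewrite /= oppr0. Qed.

Lemma conjB z w : conjc (z - w) = conjc z - conjc w.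
Proof. exact: rmorphB. Qed.

Lemma conj_sum I (s : seq I) (F : I -> C) :
  conjc (\sum_(i <- s) F i) = \sum_(i <- s) conjc (F i).
Proof. exact: rmorph_sum. Qed.

Lemma le_eps_eq0 (x : R) (c : R) : 0 <= x ->
  (forall e, 0 < e -> x <= c * e) -> x = 0.
Proof.
move=> x0 h; apply/eqP; rewrite eq_le x0 andbT.
apply/ler_addgt0Pl => e e0; rewrite addr0.
have c0 : 0 < `|c| + 1 by rewrite ltr_wpDl.
apply: le_trans (h (e / (`|c| + 1)) _) _; first exact: divr_gt0.
rewrite mulrCA ger_pMr // ler_pdivrMr // mul1r.
by rewrite (le_trans (ler_norm _)) // lerDl.
Qed.

Lemma nm_le_eps_eq z w (c : R) :
  (forall e, 0 < e -> nm (z - w) <= c * e) -> z = w.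
Proof.
by move=> h; apply/eqP; rewrite -subr_eq0; apply/eqP/nm_eq0/(le_eps_eq0 _ h)/nm_ge0.
Qed.

End complex_modulus.

(** * Almost periodic functions on an abelian group *)

Section almost_periodic_means.
Variables (R : realType) (G : zmodType).
Local Notation C := R[i].
Local Notation nm := (@ComplexField.Normc.normc R).
Local Notation rc := (real_complex R).
Implicit Types (f g h : G -> C) (s t : seq G).

(* Bochner's characterisation: the translates of f are totally bounded for the
   sup norm, total boundedness being expressed by finite colourings. *)
Definition ap f := forall e : R, 0 < e -> exists (I : finType) (k : G -> I),
  forall t t' : G, k t = k t' -> forall x, nm (f (x + t) - f (x + t')) <= e.

Definition avg s f (x : G) : C := (size s)%:R^-1 * \sum_(u <- s) f (x + u).

(** Von Neumann's mean value: a constant in the uniform closure of the convex hull of the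
    translates. It refers to no topology, measure or averaging sequence on [G]. *)
Definition ismean f (c : C) := forall e : R, 0 < e ->
  exists s, s != [::] /\ forall x, nm (avg s f x - c) <= e.

Lemma size_neq0 s : s != [::] -> (size s)%:R != 0 :> C.
Proof. by case: s => // a s _; rewrite pnatr_eq0. Qed.

Lemma avg_dist s f g x x' e : s != [::] ->
  (forall u, nm (f (x + u) - g (x' + u)) <= e) ->
  nm (avg s f x - avg s g x') <= e.
Proof.
move=> s0 h; rewrite /avg -mulrBr -sumrB nmM nmV nm_nat.
have sz : 0 < (size s)%:R :> R by rewrite ltr0n; case: (s) s0.
rewrite mulrC ler_pdivrMr //; apply: le_trans (nm_sum _ _) _.
have -> : e * (size s)%:R = \sum_(u <- s) e.
  by rewrite big_const_seq count_predT iter_addr addr0 mulr_natr.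
by apply: ler_sum.
Qed.

Lemma avg_cst s (c : C) x : s != [::] -> avg s (fun=> c) x = c.
Proof.
move=> s0; rewrite /avg big_const_seq count_predT iter_addr addr0 -[c *+ _]mulr_natl.
by rewrite mulrA mulVf ?mul1r // size_neq0.
Qed.

Lemma avg_near s f (c : C) x e : s != [::] ->
  (forall u, nm (f u - c) <= e) -> nm (avg s f x - c) <= e.
Proof.
move=> s0 h; rewrite -{1}(avg_cst c x s0).
by apply: avg_dist => // u; exact: h.
Qed.

Lemma avgA s t f x :
  avg s (avg t f) x = avg [seq u + v | u <- s, v <- t] f x.
Proof.
rewrite /avg size_allpairs natrM invfM big_allpairs_dep /= -mulrA; congr (_ * _).
rewrite mulr_sumr; apply: eq_bigr => u _; congr (_ * _).
by apply: eq_bigr => v _; rewrite addrA.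
Qed.

Lemma allpairs_neq0 s t : s != [::] -> t != [::] ->
  [seq u + v | u <- s, v <- t] != [::].
Proof. by case: s t => [|a s] // [|b t]. Qed.

Lemma avgC s t f x : avg s (avg t f) x = avg t (avg s f) x.
Proof.
rewrite /avg -!mulr_sumr mulrCA; congr (_ * (_ * _)).
rewrite exchange_big; apply: eq_bigr => v _; apply: eq_bigr => u _.
by rewrite addrAC.
Qed.

Lemma avgD s f g x : avg s (fun y => f y + g y) x = avg s f x + avg s g x.
Proof. by rewrite /avg big_split mulrDr. Qed.

Lemma avgZ s (a : C) f x : avg s (fun y => a * f y) x = a * avg s f x.
Proof. by rewrite /avg -mulr_sumr mulrCA. Qed.

Lemma avgJ s f x : avg s (fun y => conjc (f y)) x = conjc (avg s f x).
Proof. by rewrite /avg conjM conj_sum conjc_inv conjc_nat. Qed.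

(** Composing the two averages gives one list good for both functions: averages commute, and
    averaging never increases the distance to a constant. *)
Lemma ismean2 f g c d (e : R) : ismean f c -> ismean g d -> 0 < e ->
  exists s, [/\ s != [::], forall x, nm (avg s f x - c) <= e &
                forall x, nm (avg s g x - d) <= e].
Proof.
move=> hf hg e0; have [s [s0 hs]] := hf e e0; have [t [t0 ht]] := hg e e0.
exists [seq u + v | u <- s, v <- t]; split; first exact: allpairs_neq0.
  by move=> x; rewrite -avgA avgC; apply: avg_near.
by move=> x; rewrite -avgA; apply: avg_near.
Qed.

Lemma ismean_uniq f c d : ismean f c -> ismean f d -> c = d.
Proof.
move=> hc hd; apply: (@nm_le_eps_eq _ _ _ 2) => e e0.
have [s [s0 h1 h2]] := ismean2 hc hd e0.
apply: le_trans (nm_tri (avg s f 0) _ _) _.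
by rewrite mulr_natl mulr2n lerD // nm_distC.
Qed.

Lemma ismeanD f g c d : ismean f c -> ismean g d ->
  ismean (fun x => f x + g x) (c + d).
Proof.
move=> hf hg e e0; have e2 : 0 < e / 2 by lra.
have [s [s0 h1 h2]] := ismean2 hf hg e2; exists s; split=> // x.
rewrite avgD opprD addrACA (le_trans (nmD _ _)) //.
by have := h1 x; have := h2 x; lra.
Qed.

Lemma ismeanZ (a : C) f c : ismean f c -> ismean (fun x => a * f x) (a * c).
Proof.
move=> hf e e0; have a0 := nm_ge0 a; have e2 : 0 < e / (nm a + 1).
  by apply: divr_gt0 => //; lra.
have [s [s0 hs]] := hf _ e2; exists s; split=> // x.
rewrite avgZ -mulrBr nmM; have := hs x.
rewrite ler_pdivlMr; last lra.
move: (nm _) (nm_ge0 (avg s f x - c)) => y y0; nra.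
Qed.

Lemma ismeanJ f c : ismean f c -> ismean (fun x => conjc (f x)) (conjc c).
Proof.
move=> hf e e0; have [s [s0 hs]] := hf e e0; exists s; split=> // x.
by rewrite avgJ -conjB nmJ.
Qed.

Lemma ismean_cst (c : C) : ismean (fun=> c) c.
Proof.
move=> e e0; exists [:: 0]; split=> // x.
by rewrite avg_cst // subrr nm0 ltW.
Qed.

Lemma ismean_shift f c a : ismean f c -> ismean (fun x => f (x + a)) c.
Proof.
move=> hf e e0; have [s [s0 hs]] := hf e e0; exists s; split=> // x.
rewrite (_ : avg _ _ _ = avg s f (x + a)) //.
by congr (_ * _); apply: eq_bigr => u _; rewrite addrAC.
Qed.

Lemma ismean_opp f c : ismean f c -> ismean (fun x => f (- x)) c.
Proof.
move=> hf e e0; have [s [s0 hs]] := hf e e0.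
exists [seq - u | u <- s]; split; first by case: (s) s0.
move=> x; rewrite (_ : avg _ _ _ = avg s f (- x)) //.
rewrite /avg size_map big_map; congr (_ * _).
by apply: eq_bigr => u _; rewrite opprD opprK.
Qed.

Lemma ismean_dist f g c d (b : R) : ismean f c -> ismean g d ->
  (forall x, nm (f x - g x) <= b) -> nm (c - d) <= b.
Proof.
move=> hf hg hb; apply/ler_addgt0Pl => e e0; have e2 : 0 < e / 2 by lra.
have [s [s0 h1 h2]] := ismean2 hf hg e2.
have h3 : nm (avg s f 0 - avg s g 0) <= b by apply: avg_dist.
have h4 := nm_tri (avg s f 0) c d.
have h5 := nm_tri (avg s g 0) (avg s f 0) d.
have := h1 0; have := h2 0; rewrite [nm (avg s f 0 - c)]nm_distC; lra.
Qed.

Lemma ismean_le f c (b : R) : ismean f c -> (forall x, nm (f x) <= b) ->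
  nm c <= b.
Proof.
move=> hf hb; rewrite -[c]subr0.
by apply: (ismean_dist hf (ismean_cst 0)) => x; rewrite subr0.
Qed.

Lemma Re_avg s f x :
  complex.Re (avg s f x) = (size s)%:R^-1 * \sum_(u <- s) complex.Re (f (x + u)).
Proof.
rewrite /avg -Re_sum -ReZ; congr (complex.Re (_ * _)).
by rewrite fmorphV rmorph_nat.
Qed.

Lemma Re_avg_le s f x (b : R) : s != [::] ->
  (forall y, complex.Re (f y) <= b) -> complex.Re (avg s f x) <= b.
Proof.
move=> s0 h; rewrite Re_avg.
have sz : 0 < (size s)%:R :> R by rewrite ltr0n; case: (s) s0.
rewrite mulrC ler_pdivrMr //.
have -> : b * (size s)%:R = \sum_(u <- s) b.
  by rewrite big_const_seq count_predT iter_addr addr0 mulr_natr.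
by apply: ler_sum.
Qed.

Lemma Re_avg_ge s f x (b : R) : s != [::] ->
  (forall y, b <= complex.Re (f y)) -> b <= complex.Re (avg s f x).
Proof.
move=> s0 h; rewrite Re_avg.
have sz : 0 < (size s)%:R :> R by rewrite ltr0n; case: (s) s0.
rewrite mulrC ler_pdivlMr //.
have -> : b * (size s)%:R = \sum_(u <- s) b.
  by rewrite big_const_seq count_predT iter_addr addr0 mulr_natr.
by apply: ler_sum.
Qed.

Lemma ismean_Re_ge f c (b : R) : ismean f c ->
  (forall x, b <= complex.Re (f x)) -> b <= complex.Re c.
Proof.
move=> hf hb; apply/ler_addgt0Pl => e e0.
have [s [s0 h]] := hf e e0; have h1 := Re_avg_ge 0 s0 hb.
have := le_trans (Re_le_nm _) (h 0); rewrite ReD ReN; lra.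
Qed.

Lemma ap_net f (e : R) : ap f -> 0 < e -> exists s, s != [::] /\
  forall t : G, exists2 u, u \in s & forall x, nm (f (x + t) - f (x + u)) <= e.
Proof.
move=> hf e0; have [I [k hk]] := hf e e0.
exists [seq xget 0 [set t | k t = i] | i <- enum I]; split.
  by have := mem_enum I (k 0); case: (enum I).
move=> t; exists (xget 0 [set t' | k t' = k t]).
  by apply: map_f; rewrite mem_enum.
have h : k (xget 0 [set t' | k t' = k t]) = k t.
  by apply: (@xgetPex _ 0 [set t' | k t' = k t]); exists t.
by apply: hk; rewrite h.
Qed.

(* One averaging over an e-net shrinks the oscillation of the real part by a
   definite factor: every translate of the net meets a point where f is small. *)
Lemma osc_step f s (a b e : R) : s != [::] ->
  (forall t : G, exists2 u, u \in s &
     forall x, nm (f (x + t) - f (x + u)) <= e) ->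
  (forall x, a <= complex.Re (f x) <= b) -> e *+ 4 <= b - a ->
  exists a' b', (forall x, a' <= complex.Re (avg s f x) <= b') /\
    b' - a' <= b - a - e / (size s)%:R.
Proof.
move=> s0 net hab hD.
have sz : 1 <= (size s)%:R :> R by rewrite ler1n; case: (s) s0.
have ha x := andP (hab x).
have e0 : 0 <= e by have [u _ /(_ 0)] := net 0; apply: le_trans; exact: nm_ge0.
have hes : e / (size s)%:R <= e.
  by rewrite ler_pdivrMr ?ler_peMr //; lra.
have [[x0 hx0]|hn] := pselect (exists x0, complex.Re (f x0) <= (a + b) / 2).
  exists a, (b - e / (size s)%:R); split; last lra.
  move=> x; rewrite Re_avg_ge //=; last by move=> y; have [] := ha y.
  have [u us hu] := net (x0 - x).
  (* The value is within [e] of one that is at most the midpoint, and [(a + b) / 2 + e <= b - e] is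
     exactly the assumption that the oscillation is at least [4 e]. *)
  have fu : complex.Re (f (x + u)) <= b - e.
    have := hu x; rewrite [x + (_ - _)]addrC subrK.
    rewrite nm_distC => /(le_trans (Re_le_nm _)); rewrite ReD ReN; lra.
  rewrite Re_avg mulrC ler_pdivrMr; last lra.
  rewrite mulrBl divfK; last by apply: lt0r_neq0; lra.
  rewrite (big_rem u) //= .
  have : \sum_(v <- rem u s) complex.Re (f (x + v)) <= \sum_(v <- rem u s) b.
    by apply: ler_sum => v _; have [] := ha (x + v).
  rewrite big_const_seq count_predT iter_addr addr0 size_rem // -mulr_natr.
  have -> : (size s)%:R = ((size s).-1)%:R + 1 :> R.
    by rewrite natr1 prednK //; case: (s) s0.
  by rewrite mulrDr mulr1; lra.
exists ((a + b) / 2), b; split; last lra.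
move=> x; rewrite Re_avg_ge ?Re_avg_le // => y; first by have [] := ha y.
by rewrite leNgt; apply/negP => /ltW h; apply: hn; exists y.
Qed.

Lemma ap_bounded f : ap f -> exists2 b : R, 0 < b & forall x, nm (f x) <= b.
Proof.
move=> hf; have [s [s0 hs]] := ap_net hf ltr01.
exists (\sum_(u <- s) nm (f u) + 1).
  by rewrite ltr_wpDl // sumr_ge0 // => i _; exact: nm_ge0.
move=> x; have [u us /(_ 0)] := hs x; rewrite !add0r => h.
have := nm_tri (f u) (f x) 0; rewrite !subr0 => /le_trans; apply.
rewrite addrC lerD //(big_rem u) //= lerDl sumr_ge0 // => i _; exact: nm_ge0.
Qed.

(** The net of [f] is also a net for every average of [f], so [osc_step] can be iterated with the
    same gain [dl] each time; starting from oscillation [2 B], finitely many steps suffice. *)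
Lemma osc_small f (e : R) : ap f -> 0 < e -> exists s a b, [/\ s != [::],
  forall x, a <= complex.Re (avg s f x) <= b & b - a <= e].
Proof.
move=> hf; wlog: e / exists e', e = e' *+ 4.
  by move=> h; apply: h; exists (e / 4); lra.
case=> {}e -> e4; have e0 : 0 < e by lra.
have [s [s0 net]] := ap_net hf e0; have [B B0 hB] := ap_bounded hf.
have sz : 1 <= (size s)%:R :> R by rewrite ler1n; case: (s) s0.
pose dl := e / (size s)%:R; have dl0 : 0 < dl by apply: divr_gt0 => //; lra.
have key k : exists t a b, [/\ t != [::],
    forall x, a <= complex.Re (avg t f x) <= b &
    b - a <= e *+ 4 \/ b - a <= B *+ 2 - k%:R * dl].
  elim: k => [|k [t [a [b [t0 hab hD]]]]].
    exists [:: 0], (- B), B; split=> //; last by right; lra.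
    move=> x; rewrite -ler_norml; apply: le_trans (le_Re_nm _) _.
    rewrite -[avg _ _ _]subr0; apply: avg_near => // u.
    by rewrite subr0.
  have [hs|/ltW hs] := leP (b - a) (e *+ 4).
    by exists t, a, b; split=> //; left.
  have net' (t' : G) : exists2 u, u \in s &
      forall x, nm (avg t f (x + t') - avg t f (x + u)) <= e.
    have [u us hu] := net t'; exists u => // x; apply: avg_dist => // v.
    by rewrite addrAC [x + u + v]addrAC; exact: hu.
  have [a' [b' [h1 h2]]] := osc_step s0 net' hab hs.
  exists [seq u + v | u <- s, v <- t], a', b'; split.
  - exact: allpairs_neq0.
  - by move=> x; rewrite -avgA.
  - rewrite -/dl in h2; case: hD => hD; first by left; lra.
    right; rewrite -natr1 mulrDl mul1r; lra.
have [n hn] : exists n : nat, B *+ 2 / dl <= n%:R.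
  by exists (Num.bound (B *+ 2 / dl)); rewrite ltW // archi_boundP // divr_ge0 //; lra.
have [t [a [b [t0 hab hD]]]] := key n; exists t, a, b; split=> //.
by case: hD => // hD; rewrite ler_pdivrMr // in hn; lra.
Qed.

(** The mean is the supremum of the uniform lower bounds of averages. A lower bound of one average
    is below every upper bound of another because the two averages commute, so small oscillation
    pins the supremum down. *)
Lemma Re_mean_exists f : ap f -> exists c : R, forall e, 0 < e ->
  exists s, s != [::] /\ forall x, `|complex.Re (avg s f x) - c| <= e.
Proof.
move=> hf.
pose S := [set a : R | exists s, s != [::] /\ forall x, a <= complex.Re (avg s f x)].
have Sub s b : s != [::] -> (forall x, complex.Re (avg s f x) <= b) -> ubound S b.
  move=> s0 hb a [t [t0 ha]].
  apply: (@le_trans _ _ (complex.Re (avg t (avg s f) 0))).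
    by rewrite avgC; apply: Re_avg_ge.
  exact: Re_avg_le.
exists (sup S) => e e0; have [s [a [b [s0 hab hD]]]] := osc_small hf e0.
have Sa : S a by exists s; split=> // x; have /andP[] := hab x.
have Sb : ubound S b by apply: (Sub s) => // x; have /andP[] := hab x.
have h1 : a <= sup S by apply: ub_le_sup => //; exists b.
have h2 : sup S <= b by apply: ge_sup => //; exists a.
exists s; split=> // x; have /andP[h3 h4] := hab x.
by rewrite ler_norml; apply/andP; split; lra.
Qed.

Lemma ap_scale (a : C) f : ap f -> ap (fun x => a * f x).
Proof.
move=> hf e e0; have a0 := nm_ge0 a; have e2 : 0 < e / (nm a + 1).
  by apply: divr_gt0 => //; lra.
have [I [k hk]] := hf _ e2; exists I, k => t t' tt' x.
rewrite -mulrBr nmM; have := hk _ _ tt' x.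
rewrite ler_pdivlMr; last lra.
move: (nm _) (nm_ge0 (f (x + t) - f (x + t'))) => y y0; nra.
Qed.

Lemma ap_ismean f : ap f -> exists c, ismean f c.
Proof.
move=> hf; have [c hc] := Re_mean_exists hf.
have [d hd] := Re_mean_exists (ap_scale (Complex 0 1) hf).
(* The sign comes from [Re (i z) = - Im z]: [d] is the mean of the real part of [i f]. *)
exists (Complex c (- d)) => e e0; have e2 : 0 < e / 2 by lra.
have [s [s0 hs]] := hc _ e2; have [t [t0 ht]] := hd _ e2.
exists [seq u + v | u <- s, v <- t]; split; first exact: allpairs_neq0.
move=> x; apply: le_trans (nm_le_ReIm _) _.
have -> : e = e / 2 + e / 2 by lra.
apply: lerD.
  rewrite -avgA avgC ReD ReN /= ler_norml; apply/andP; split.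
    rewrite lerBrDl; apply: Re_avg_ge => // y.
    by have := hs y; rewrite ler_norml => /andP[]; lra.
  rewrite lerBlDl; apply: Re_avg_le => // y.
  by have := hs y; rewrite ler_norml => /andP[]; lra.
rewrite -normrN -avgA ImD ImN /= opprD -Re_iM opprK -avgZ.
rewrite ler_norml; apply/andP; split.
  rewrite lerBrDr.
  have -> : avg s (fun y => Complex 0 1 * avg t f y) x
          = avg s (avg t (fun y => Complex 0 1 * f y)) x.
    by congr (avg s _ x); apply/funext => y; rewrite avgZ.
  apply: Re_avg_ge => // y.
  by have := ht y; rewrite ler_norml => /andP[]; lra.
rewrite -lerBrDr.
have -> : avg s (fun y => Complex 0 1 * avg t f y) x
        = avg s (avg t (fun y => Complex 0 1 * f y)) x.
  by congr (avg s _ x); apply/funext => y; rewrite avgZ.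
apply: Re_avg_le => // y.
by have := ht y; rewrite ler_norml => /andP[]; lra.
Qed.

End almost_periodic_means.

Section almost_periodic_algebra.
Variables (R : realType) (G : zmodType).
Local Notation C := R[i].
Local Notation nm := (@ComplexField.Normc.normc R).
Local Notation rc := (real_complex R).
Implicit Types (f g h : G -> C).

Lemma ap_cst (c : C) : ap (fun _ : G => c).
Proof.
move=> e e0; exists unit, (fun=> tt) => t t' _ x.
by rewrite subrr nm0 ltW.
Qed.

(** A colouring for [f] at a smaller scale also works for [g] when the translates of [g] depend on
    those of [f] in a Lipschitz way. *)
Lemma ap_dom f g (K : R) : ap f ->
  (forall t t' (e : R), (forall x, nm (f (x + t) - f (x + t')) <= e) ->
    forall x, nm (g (x + t) - g (x + t')) <= K * e) -> ap g.
Proof.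
move=> hf hg e e0; have e2 : 0 < e / (`|K| + 1) by rewrite divr_gt0 // ltr_wpDl.
have [I [k hk]] := hf _ e2; exists I, k => t t' tt' x.
apply: le_trans (hg _ _ _ (hk _ _ tt') x) _.
rewrite mulrCA ger_pMr // ler_pdivrMr ?ltr_wpDl // mul1r.
by rewrite (le_trans (ler_norm _)) // lerDl.
Qed.

Lemma ap_dom2 f1 f2 g (K : R) : ap f1 -> ap f2 ->
  (forall t t' (e : R), (forall x, nm (f1 (x + t) - f1 (x + t')) <= e) ->
    (forall x, nm (f2 (x + t) - f2 (x + t')) <= e) ->
    forall x, nm (g (x + t) - g (x + t')) <= K * e) -> ap g.
Proof.
move=> hf1 hf2 hg e e0.
have e2 : 0 < e / (`|K| + 1) by rewrite divr_gt0 // ltr_wpDl.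
have [I [k hk]] := hf1 _ e2; have [J [l hl]] := hf2 _ e2.
exists (I * J)%type, (fun t => (k t, l t)) => t t' [/hk ht /hl ht'] x.
apply: le_trans (hg _ _ _ ht ht' x) _.
rewrite mulrCA ger_pMr // ler_pdivrMr ?ltr_wpDl // mul1r.
by rewrite (le_trans (ler_norm _)) // lerDl.
Qed.

Lemma apD f g : ap f -> ap g -> ap (fun x => f x + g x).
Proof.
move=> hf hg; apply: (ap_dom2 (K := 2) hf hg) => t t' e h1 h2 x.
rewrite opprD addrACA; apply: le_trans (nmD _ _) _.
by have := h1 x; have := h2 x; lra.
Qed.

Lemma apM f g : ap f -> ap g -> ap (fun x => f x * g x).
Proof.
move=> hf hg; have [a a0 ha] := ap_bounded hf; have [b b0 hb] := ap_bounded hg.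
apply: (ap_dom2 (K := a + b) hf hg) => t t' e h1 h2 x.
have -> : f (x + t) * g (x + t) - f (x + t') * g (x + t') =
   f (x + t) * (g (x + t) - g (x + t')) + (f (x + t) - f (x + t')) * g (x + t').
  by ring.
apply: le_trans (nmD _ _) _; rewrite !nmM.
have := h1 x; have := h2 x; have := ha (x + t); have := hb (x + t').
have := nm_ge0 (f (x + t)); have := nm_ge0 (g (x + t')).
have := nm_ge0 (g (x + t) - g (x + t')); have := nm_ge0 (f (x + t) - f (x + t')).
move: (nm _) (nm _) (nm _) (nm _) => p q r s p0 q0 r0 s0 *.
by rewrite mulrDl lerD //; [rewrite ler_pM|rewrite [leRHS]mulrC ler_pM].
Qed.

Lemma apJ f : ap f -> ap (fun x => conjc (f x)).
Proof.
move=> hf; apply: (ap_dom (K := 1) hf) => t t' e h1 x.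
by rewrite -conjB nmJ mul1r.
Qed.

Lemma ap_shift f a : ap f -> ap (fun x => f (x + a)).
Proof.
move=> hf; apply: (ap_dom (K := 1) hf) => t t' e h1 x.
by rewrite addrAC [x + t' + a]addrAC mul1r.
Qed.

Lemma ap_comp (G' : zmodType) (phi : G' -> G) f :
  (forall x y, phi (x + y) = phi x + phi y) -> ap f -> ap (fun x => f (phi x)).
Proof.
move=> hphi hf e e0; have [I [k hk]] := hf _ e0.
by exists I, (fun x => k (phi x)) => t t' tt' x; rewrite !hphi; apply: hk.
Qed.

Lemma ap_opp f : ap f -> ap (fun x => f (- x)).
Proof. by apply: ap_comp => x y; rewrite opprD. Qed.

Lemma ap_refl f a : ap f -> ap (fun x => f (a - x)).
Proof.
move=> hf; have := ap_opp (ap_shift a hf); congr ap.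
by apply/funext => x; rewrite addrC.
Qed.

Lemma ap_lim f : (forall e : R, 0 < e ->
  exists2 g, ap g & forall x, nm (f x - g x) <= e) -> ap f.
Proof.
move=> h e e0; have e3 : 0 < e / 3 by lra.
have [g hg hfg] := h _ e3; have [I [k hk]] := hg _ e3.
exists I, k => t t' tt' x.
have h1 := hfg (x + t); have h2 := hfg (x + t'); have h3 := hk _ _ tt' x.
have h4 := nm_tri (g (x + t)) (f (x + t)) (f (x + t')).
have h5 := nm_tri (g (x + t')) (g (x + t)) (f (x + t')).
by rewrite nm_distC in h2; lra.
Qed.

(** The value is the junk [0] when no mean exists; when one exists, [ismean_uniq] makes the choice
    immaterial. *)
Definition mean f : C := xget 0 [set c | ismean f c].

Lemma meanP f : ap f -> ismean f (mean f).
Proof. by move=> /ap_ismean[c hc]; apply: (@xgetPex _ 0 [set c | ismean f c]); exists c. Qed.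

Lemma mean_eq f c : ismean f c -> mean f = c.
Proof.
move=> hc; apply: (@ismean_uniq _ _ f) => //.
by apply: (@xgetPex _ 0 [set c | ismean f c]); exists c.
Qed.

Lemma meanD f g : ap f -> ap g -> mean (fun x => f x + g x) = mean f + mean g.
Proof. by move=> hf hg; apply/mean_eq/ismeanD; exact: meanP. Qed.

Lemma meanZ (a : C) f : ap f -> mean (fun x => a * f x) = a * mean f.
Proof. by move=> hf; apply/mean_eq/ismeanZ/meanP. Qed.

Lemma meanJ f : ap f -> mean (fun x => conjc (f x)) = conjc (mean f).
Proof. by move=> hf; apply/mean_eq/ismeanJ/meanP. Qed.

Lemma mean_shift f a : ap f -> mean (fun x => f (x + a)) = mean f.
Proof. by move=> hf; apply/mean_eq/ismean_shift/meanP. Qed.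

Lemma mean_opp f : ap f -> mean (fun x => f (- x)) = mean f.
Proof. by move=> hf; apply/mean_eq/ismean_opp/meanP. Qed.

Lemma mean_refl f a : ap f -> mean (fun x => f (a - x)) = mean f.
Proof.
move=> hf; rewrite -(mean_shift a hf) -(mean_opp (ap_shift a hf)).
by congr mean; apply/funext => x; rewrite addrC.
Qed.

Lemma mean_cst (c : C) : mean (fun _ : G => c) = c.
Proof. exact/mean_eq/ismean_cst. Qed.

Lemma mean_dist f g (b : R) : ap f -> ap g ->
  (forall x, nm (f x - g x) <= b) -> nm (mean f - mean g) <= b.
Proof. by move=> /meanP hf /meanP hg; exact: ismean_dist. Qed.

Lemma mean_le f (b : R) : ap f -> (forall x, nm (f x) <= b) -> nm (mean f) <= b.
Proof. by move=> /meanP hf; exact: ismean_le. Qed.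

Lemma mean_Re_ge f (b : R) : ap f -> (forall x, b <= complex.Re (f x)) ->
  b <= complex.Re (mean f).
Proof. by move=> /meanP hf; exact: ismean_Re_ge. Qed.

Lemma ap_sum (I : Type) (s : seq I) (F : I -> G -> C) : (forall i, ap (F i)) ->
  ap (fun x => \sum_(i <- s) F i x).
Proof.
move=> hF; elim: s => [|i s ih].
  by have := ap_cst 0; congr ap; apply/funext => x; rewrite big_nil.
have := apD (hF i) ih; congr ap; apply/funext => x.
by rewrite big_cons.
Qed.

Lemma mean_sum (I : Type) (s : seq I) (F : I -> G -> C) : (forall i, ap (F i)) ->
  mean (fun x => \sum_(i <- s) F i x) = \sum_(i <- s) mean (F i).
Proof.
move=> hF; elim: s => [|i s ih].
  by rewrite big_nil -[RHS]mean_cst; congr mean; apply/funext => x; rewrite big_nil.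
rewrite big_cons -ih -meanD //; last exact: ap_sum.
by congr mean; apply/funext => x; rewrite big_cons.
Qed.

End almost_periodic_algebra.

(** * Convolution, idempotents and characters *)

Section convolution_algebra.
Variables (R : realType) (G : zmodType).
Local Notation C := R[i].
Local Notation nm := (@ComplexField.Normc.normc R).
Local Notation rc := (real_complex R).
Implicit Types (f g h : G -> C).

Lemma ap_slice (k : G * G -> C) x : ap k -> ap (fun y => k (x, y)).
Proof.
move=> hk; have := ap_comp (phi := fun y : G => (0, y)) _ (ap_shift (x, 0) hk).
move=> h; suff : ap (fun y : G => k ((0, y) + (x, 0))).
  by congr ap; apply/funext => y; congr k; congr pair; rewrite ?add0r ?addr0.
by apply: h => a b; congr pair; rewrite addr0.
Qed.

Lemma ap_slice2 (k : G * G -> C) y : ap k -> ap (fun x => k (x, y)).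
Proof.
move=> hk; have := ap_comp (phi := fun x : G => (x, 0)) _ (ap_shift (0, y) hk).
move=> h; suff : ap (fun x : G => k ((x, 0) + (0, y))).
  by congr ap; apply/funext => x; congr k; congr pair; rewrite ?add0r ?addr0.
by apply: h => a b; congr pair; rewrite addr0.
Qed.

(** Take a list of pairs whose average is uniformly close to [c]. The inner mean absorbs the second
    components by shift invariance, so the first components alone form a list for the iterated
    mean. *)
Lemma fubini (k : G * G -> C) (hk : ap k) c : ismean k c ->
  mean (fun x => mean (fun y => k (x, y))) = c.
Proof.
move=> hc; apply: mean_eq => e e0; have [s [s0 hs]] := hc e e0.
exists [seq u.1 | u <- s]; split; first by case: (s) s0.
move=> x; have -> : avg [seq u.1 | u <- s] (fun x => mean (fun y => k (x, y))) x =
   mean (fun y => avg s k (x, y)).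
  rewrite /avg size_map big_map /=.
  rewrite meanZ; last first.
    by apply: ap_sum => u; apply: (ap_slice (k := fun z => k (z + u))); exact: ap_shift.
  rewrite mean_sum; last first.
    by move=> u; apply: (ap_slice (k := fun z => k (z + u))); exact: ap_shift.
  congr (_ * _); apply: eq_bigr => u _.
  by rewrite -(mean_shift u.2) //; exact: ap_slice.
rewrite -(mean_cst G c); apply: mean_dist => //; last exact: ap_cst.
have ha : ap (avg s k).
  rewrite /avg; apply: ap_scale; apply: ap_sum => u; exact: ap_shift.
exact: ap_slice.
Qed.

Lemma fubini_swap (k : G * G -> C) : ap k ->
  mean (fun x => mean (fun y => k (x, y))) = mean (fun y => mean (fun x => k (x, y))).
Proof.
move=> hk; have hc := meanP hk; rewrite (fubini hk hc).
have hk' : ap (fun z : G * G => k (z.2, z.1)).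
  by apply: (ap_comp (phi := fun z : G * G => (z.2, z.1))) hk => -[a b] [c d].
rewrite (fubini (k := fun z => k (z.2, z.1)) hk' (c := mean k)) // => e e0.
have [s [s0 hs]] := hc e e0; exists [seq (u.2, u.1) | u <- s].
split; first by case: (s) s0.
move=> x; rewrite (_ : avg _ _ _ = avg s k (x.2, x.1)) //.
by rewrite /avg size_map big_map.
Qed.

(** This is convolution on the Bohr compactification of [G], with the mean playing the role of its
    Haar integral. *)
Definition conv f g x := mean (fun s => f (x - s) * g s).

Lemma ap_conv_arg f g x : ap f -> ap g -> ap (fun s => f (x - s) * g s).
Proof. by move=> hf hg; apply: apM => //; exact: ap_refl. Qed.

Lemma convC f g : ap f -> ap g -> conv f g = conv g f.
Proof.
move=> hf hg; apply/funext => x; rewrite /conv.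
rewrite -(mean_refl x (ap_conv_arg x hf hg)); congr mean; apply/funext => s.
by rewrite subKr mulrC.
Qed.

Lemma convDl f g h : ap f -> ap g -> ap h ->
  conv (fun x => f x + g x) h = fun x => conv f h x + conv g h x.
Proof.
move=> hf hg hh; apply/funext => x; rewrite /conv.
rewrite -meanD; [|exact: ap_conv_arg..].
by congr mean; apply/funext => s; rewrite mulrDl.
Qed.

Lemma convZl (a : C) f g : ap f -> ap g ->
  conv (fun x => a * f x) g = fun x => a * conv f g x.
Proof.
move=> hf hg; apply/funext => x; rewrite /conv -meanZ; last exact: ap_conv_arg.
by congr mean; apply/funext => s; rewrite mulrA.
Qed.

Lemma conv_shift f g a : conv (fun x => f (x + a)) g = fun x => conv f g (x + a).
Proof.
apply/funext => x; congr mean; apply/funext => s.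
by rewrite addrAC.
Qed.

Lemma ap_conv f g : ap f -> ap g -> ap (conv f g).
Proof.
move=> hf hg; have [b b0 hb] := ap_bounded hg.
apply: (ap_dom (K := b) hf) => t t' e h x.
rewrite /conv; apply: mean_dist; [exact: ap_conv_arg..|] => s.
rewrite -mulrBl nmM mulrC ler_pM ?nm_ge0 //.
by have := h (x - s); rewrite addrAC [x - s + t']addrAC.
Qed.

Lemma convA f g h : ap f -> ap g -> ap h ->
  conv f (conv g h) = conv (conv f g) h.
Proof.
move=> hf hg hh; apply/funext => x.
(* Both iterated convolutions are iterated means of this kernel, in opposite orders, up to a shift
   of the inner variable. *)
pose k (z : G * G) := f (x - z.1) * (g (z.1 - z.2) * h z.2).
have hk : ap k.
  apply: apM.
    by apply: (ap_comp (phi := fst) (f := fun z => f (x - z))) => //; exact: ap_refl.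
  apply: apM; last exact: (ap_comp (phi := snd)).
  by apply: (ap_comp (phi := fun z : G * G => z.1 - z.2)) => // a b; rewrite /= opprD addrACA.
transitivity (mean (fun u => mean (fun s => k (u, s)))).
  congr mean; apply/funext => u; rewrite /k -meanZ //; exact: ap_conv_arg.
rewrite fubini_swap //; congr mean; apply/funext => s.
rewrite mulrC /conv -meanZ; last exact: ap_conv_arg.
rewrite -(mean_shift s); last exact: ap_slice2.
congr mean; apply/funext => u; rewrite /k /= addrK opprD addrA [x - u - s]addrAC.
by ring.
Qed.

End convolution_algebra.

(** * Mean-square norm, Cauchy-Schwarz and self-adjointness *)

Section power_method.
Variables (R : realType) (G : zmodType).
Local Notation C := R[i].
Local Notation nm := (@ComplexField.Normc.normc R).
Local Notation rc := (real_complex R).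
Implicit Types (f g h : G -> C).

Lemma convDr f g h : ap f -> ap g -> ap h ->
  conv h (fun x => f x + g x) = fun x => conv h f x + conv h g x.
Proof.
move=> hf hg hh; rewrite (convC hh (apD hf hg)) convDl //.
by rewrite (convC hf hh) (convC hg hh).
Qed.

Lemma convZr (a : C) f g : ap f -> ap g ->
  conv g (fun x => a * f x) = fun x => a * conv g f x.
Proof.
by move=> hf hg; rewrite (convC hg (ap_scale a hf)) convZl // (convC hf hg).
Qed.

Definition msq f : R := complex.Re (mean (fun s => f s * conjc (f s))).

Lemma ap_sqr f : ap f -> ap (fun s => f s * conjc (f s)).
Proof. by move=> hf; apply: apM => //; exact: apJ. Qed.

Lemma mean_sqr f : ap f -> mean (fun s => f s * conjc (f s)) = rc (msq f).
Proof.
move=> hf; have h : conjc (mean (fun s => f s * conjc (f s))) =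
    mean (fun s => f s * conjc (f s)).
  rewrite -meanJ; last exact: ap_sqr.
  by congr mean; apply/funext => s; rewrite conjM conjcK mulrC.
rewrite /msq; case: (mean _) h => a b [] /eqP; rewrite eq_sym -subr_eq0 opprK.
by rewrite -mulr2n mulrn_eq0 /= => /eqP ->.
Qed.

Lemma msq_ge0 f : ap f -> 0 <= msq f.
Proof.
move=> hf; apply: mean_Re_ge; first exact: ap_sqr.
by move=> x; rewrite mulJ /= sqr_ge0.
Qed.

Lemma msq_le f (b : R) : ap f -> (forall x, nm (f x) ^+ 2 <= b) -> msq f <= b.
Proof.
move=> hf h; apply: le_trans (Re_le_nm _) _; apply: mean_le; first exact: ap_sqr.
by move=> x; rewrite mulJ nm_real ger0_norm ?sqr_ge0.
Qed.

(** If [f x0] is nonzero, some translate from a finite net is large at each point, so the sum of the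
    squared translates is bounded below; by shift invariance its mean is a multiple of [msq f]. *)
Lemma msq_eq0 f : ap f -> msq f = 0 -> forall x, f x = 0.
Proof.
move=> hf h0 x0; apply/nm_eq0/eqP; rewrite eq_le nm_ge0 andbT leNgt.
apply/negP => fx0; have d0 : 0 < nm (f x0) / 2 by lra.
have [s [s0 net]] := ap_net hf d0.
have hs := ap_sqr hf.
have hsum : ap (fun x => \sum_(u <- s) f (x + u) * conjc (f (x + u))).
  by apply: ap_sum => u; exact: (ap_shift _ hs).
have : (nm (f x0) / 2) ^+ 2 <=
    complex.Re (mean (fun x => \sum_(u <- s) f (x + u) * conjc (f (x + u)))).
  apply: mean_Re_ge => // x; rewrite Re_sum.
  have [u us /(_ x)] := net (x0 - x); rewrite [x + (_ - _)]addrC subrK => hu.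
  rewrite (big_rem u) //= mulJ /=.
  apply: (@le_trans _ _ (nm (f (x + u)) ^+ 2)).
    rewrite ler_pXn2r ?nnegrE ?nm_ge0 //; last lra.
    have := nm_tri (f (x + u)) (f x0) 0; rewrite !subr0; lra.
  by rewrite lerDl sumr_ge0 // => v _; rewrite mulJ /= sqr_ge0.
rewrite mean_sum; last by move=> u; exact: (ap_shift _ hs).
rewrite big1.
  by rewrite /= leNgt exprn_gt0.
by move=> u _; rewrite (mean_shift u hs) mean_sqr // h0.
Qed.

Lemma msq_refl f a : ap f -> msq (fun x => f (a - x)) = msq f.
Proof. by move=> hf; rewrite /msq -(mean_refl a (ap_sqr hf)). Qed.

(** The quadratic polynomial behind Cauchy-Schwarz. The pairing [m] is bilinear rather than
    sesquilinear, which is why [conjc (g x)] is subtracted. *)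
Lemma msq_lin f g (t : R) : ap f -> ap g -> let m := mean (fun x => f x * g x) in
  msq (fun x => f x + - rc t * m * conjc (g x)) =
  msq f - 2 * t * nm m ^+ 2 + t ^+ 2 * nm m ^+ 2 * msq g.
Proof.
move=> hf hg m.
have hfg := apM hf hg.
pose a := - rc t * m.
have E : msq (fun x => f x + a * conjc (g x)) = complex.Re
   (rc (msq f) + conjc a * m + (a * conjc m + a * conjc a * rc (msq g))).
  rewrite /msq; congr complex.Re; rewrite -!mean_sqr // -(meanZ _ hfg).
  rewrite -meanJ // -(meanZ _ (apJ hfg)) -(meanZ _ (ap_sqr hg)).
  have h1 := ap_sqr hf; have h2 := ap_scale (conjc a) hfg.
  have h3 := ap_scale a (apJ hfg); have h4 := ap_scale (a * conjc a) (ap_sqr hg).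
  rewrite -(meanD h1 h2) -(meanD h3 h4) -(meanD (apD h1 h2) (apD h3 h4)).
  by congr mean; apply/funext => x; rewrite conjD !conjM conjcK; ring.
rewrite {}E /a conjM conjN conj_rc.
set N := msq f; set N' := msq g; set mm := nm m.
have -> : rc N + - rc t * conjc m * m + (- rc t * m * conjc m +
      - rc t * m * (- rc t * conjc m) * rc N') =
    rc N + (- (rc 2 * rc t) + rc t ^+ 2 * rc N') * (m * conjc m).
  by rewrite rmorph_nat; ring.
rewrite mulJ -!rmorphM -rmorphXn -!rmorphM -rmorphN -rmorphD -rmorphM -rmorphD /=.
by rewrite /mm; ring.
Qed.

Lemma mean_cs f g : ap f -> ap g ->
  nm (mean (fun x => f x * g x)) ^+ 2 <= msq f * msq g.
Proof.
move=> hf hg; set m := mean _; have Nf := msq_ge0 hf; have Ng := msq_ge0 hg.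
have key t : 0 <= msq f - 2 * t * nm m ^+ 2 + t ^+ 2 * nm m ^+ 2 * msq g.
  rewrite -(msq_lin t hf hg); apply: msq_ge0.
  by apply: apD => //; apply: ap_scale; exact: apJ.
have M0 : 0 <= nm m ^+ 2 by exact: sqr_ge0.
move: (nm m ^+ 2) (msq f) (msq g) key M0 Nf Ng => M a b key M0 a0 b0.
have [b1|] := ltP 0 b.
  have := key b^-1; rewrite -[X in _ * M * X]invrK.
  have -> : a - 2 * b^-1 * M + b^-1 ^+ 2 * M * b^-1^-1 = a - M / b.
    by rewrite invrK; field; exact: lt0r_neq0.
  by rewrite subr_ge0 ler_pdivrMr.
move=> b1; have bE : b = 0 by apply/eqP; rewrite eq_le b1 b0.
(* With [b = 0] the quadratic degenerates to [a - 2 t M], and [t = (a + 1) / M] makes it [- a - 2],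
   which is negative. *)
rewrite bE in key *; rewrite mulr0 leNgt; apply/negP => M1; have := key ((a + 1) / M).
rewrite !mulr0 addr0 -mulrA divfK; last exact: lt0r_neq0.
lra.
Qed.

(** This bounds a convolution pointwise by mean-square norms, and so turns mean-square convergence
    into uniform convergence. *)
Lemma conv_cs f g x : ap f -> ap g -> nm (conv f g x) ^+ 2 <= msq f * msq g.
Proof.
move=> hf hg; rewrite -(msq_refl x hf); apply: mean_cs => //; exact: ap_refl.
Qed.

Lemma msq_conv f g : ap f -> ap g -> msq (conv f g) <= msq f * msq g.
Proof.
by move=> hf hg; apply: msq_le => [|x]; [exact: ap_conv|exact: conv_cs].
Qed.

(** The functions whose convolution operator is self-adjoint. *)
Definition herm f := forall x, conjc (f (- x)) = f x.

Lemma hermD f g : herm f -> herm g -> herm (fun x => f x + g x).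
Proof. by move=> hf hg x; rewrite conjD hf hg. Qed.

Lemma hermZ (a : R) f : herm f -> herm (fun x => rc a * f x).
Proof. by move=> hf x; rewrite conjM conj_rc hf. Qed.

Lemma herm_conv f g : ap f -> ap g -> herm f -> herm g -> herm (conv f g).
Proof.
move=> af ag hf hg x; rewrite /conv -meanJ; last exact: ap_conv_arg.
rewrite -mean_opp; last exact/apJ/ap_conv_arg.
congr mean; apply/funext => s.
rewrite conjM hg -(hf (x - s)); congr (conjc (f _) * _).
by rewrite opprB opprK addrC.
Qed.

Lemma conv_herm0 f : ap f -> herm f -> conv f f 0 = rc (msq f).
Proof.
move=> af hf; rewrite -mean_sqr // /conv; congr mean; apply/funext => s.
by rewrite sub0r mulrC -(hf (- s)) opprK.
Qed.

End power_method.

(** * Spectral idempotents from convolution powers *)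

Section idempotents.
Variables (R : realType) (G : zmodType).
Local Notation C := R[i].
Local Notation nm := (@ComplexField.Normc.normc R).
Local Notation rc := (real_complex R).
Implicit Types (f g h : G -> C).

Lemma real_cauchy (u : nat -> R) :
  (forall e, 0 < e -> exists K, forall m n, (K <= m)%N -> (K <= n)%N ->
     `|u m - u n| <= e) -> u @ \oo --> lim (u @ \oo).
Proof.
move=> h; apply: cauchy_cvg; apply: cauchy_exP => e e0.
have [K hK] := h _ (divr_gt0 e0 (ltr0Sn R 1)).
exists (u K); exists K => // n /= Kn; rewrite /ball /=.
by apply: le_lt_trans (hK _ _ (leqnn K) Kn) _; lra.
Qed.

Lemma complex_cauchy (u : nat -> C) :
  (forall e, 0 < e -> exists K, forall m n, (K <= m)%N -> (K <= n)%N ->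
     nm (u m - u n) <= e) ->
  exists l, forall e, 0 < e -> exists K, forall n, (K <= n)%N -> nm (u n - l) <= e.
Proof.
move=> h.
have hr := @real_cauchy (fun n => complex.Re (u n)).
have hi := @real_cauchy (fun n => complex.Im (u n)).
have {}hr : (fun n => complex.Re (u n)) @ \oo --> lim ((fun n => complex.Re (u n)) @ \oo).
  apply: hr => e /h[K hK]; exists K => m n Km Kn; apply: le_trans (hK _ _ Km Kn).
  by rewrite -ReN -ReD le_Re_nm.
have {}hi : (fun n => complex.Im (u n)) @ \oo --> lim ((fun n => complex.Im (u n)) @ \oo).
  apply: hi => e /h[K hK]; exists K => m n Km Kn; apply: le_trans (hK _ _ Km Kn).
  by rewrite -ImN -ImD le_Im_nm.
move: (lim _) (lim _) hr hi => b a /cvgrPdist_le hr /cvgrPdist_le hi.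
exists (Complex a b) => e e0; have e2 : 0 < e / 2 by lra.
have [K1 _ h1] := hr _ e2; have [K2 _ h2] := hi _ e2.
exists (maxn K1 K2) => n; rewrite geq_max => /andP[n1 n2].
apply: le_trans (nm_le_ReIm _) _; rewrite ReD ReN ImD ImN.
have {}h1 : `|complex.Re (u n) - a| <= e / 2 by rewrite distrC; exact: (h1 _ n1).
have {}h2 : `|complex.Im (u n) - b| <= e / 2 by rewrite distrC; exact: (h2 _ n2).
by have := lerD h1 h2; rewrite -splitr.
Qed.

(** Convolution by [e] is then an orthogonal projection; the value [e 0], equal to [msq e], is its
    trace and will serve as a dimension. *)
Definition idem (e : G -> C) := [/\ ap e, herm e & conv e e = e].

(* Spectral projection of the positive operator g |-> h * h * g on its top
   eigenspace, as the limit of the normalised convolution powers of h. *)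
Lemma spectral_idempotent h : ap h -> herm h -> msq h != 0 ->
  exists e (l : R), [/\ idem e, complex.Re (e 0) >= 1,
    0 < l & conv (conv h h) e = fun x => rc l * e x].
Proof.
move=> ah hh h0.
(* [p n] is the convolution power of exponent [n + 1]; this shift explains the successors in the
   index formulas below. *)
pose p n := iter n (conv h) h.
have ap_p n : ap (p n) by elim: n => //= n ih; exact: ap_conv.
have herm_p n : herm (p n) by elim: n => //= n ih; exact: herm_conv.
have p_add m n : conv (p m) (p n) = p (m + n).+1.
  elim: m => [|m ih] //=.
  by rewrite -(convA ah (ap_p m) (ap_p n)) ih.
pose c n := msq (p n).
have cE n : p (n + n).+1 0 = rc (c n) by rewrite -p_add conv_herm0.
have c_ge0 n : 0 <= c n by exact: msq_ge0.
have c00 : 0 < c 0%N by rewrite lt_neqAle eq_sym h0 c_ge0.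
have c_gt0 n : 0 < c n.
  (* If [p n.+1] vanished, so would all later powers, in particular [p (n + n).+1], whose value at 0
     is [c n]. *)
  elim: n => // n ih; rewrite lt_neqAle c_ge0 andbT eq_sym; apply/negP => /eqP c0.
  have p0 k : p (n.+1 + k)%N = fun=> 0.
    elim: k => [|k ihk]; first by rewrite addn0; apply/funext/msq_eq0.
    rewrite addnS; have -> : p (n.+1 + k).+1 = conv h (p (n.+1 + k)%N) by [].
    rewrite ihk; apply/funext => x.
    by rewrite /conv -[RHS](mean_cst G); congr mean; apply/funext => s; rewrite mulr0.
  have := cE n; rewrite -addSn p0 => -[] /esym cn0; move: ih; rewrite cn0.
  by rewrite ltxx.
(* Log-convexity: [p n] and [p n.+2] convolve to the same power as [p n.+1] with itself, so this is
   Cauchy-Schwarz at 0. *)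
have c_log n : c n.+1 ^+ 2 <= c n * c n.+2.
  have <- : nm (conv (p n) (p n.+2) 0) ^+ 2 = c n.+1 ^+ 2.
    by rewrite p_add addnS -addSn cE nm_real ger0_norm.
  exact: conv_cs.
have c_sub m n : c (m + n).+1 <= c m * c n.
  by rewrite /c -p_add; exact: msq_conv.
(* The ratios increase by log-convexity and are bounded by [c 0]; their limit [l] will be the top
   eigenvalue of convolution by [conv h h]. *)
pose r n := c n.+1 / c n.
have r_nd : nondecreasing_seq r.
  apply/nondecreasing_seqP => n; rewrite /r ler_pdivrMr // mulrAC.
  by rewrite ler_pdivlMr // mulrC -expr2 mulrC c_log.
have r_ub n : r n <= c 0%N by rewrite /r ler_pdivrMr //; exact: (c_sub 0%N n).
have r_gt0 n : 0 < r n by exact: divr_gt0.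
have r_cvg : r @ \oo --> sup (range r).
  by apply: nondecreasing_cvgn => //; exists (c 0%N) => _ [n _ <-].
set l := sup (range r) in r_cvg.
have r_le n : r n <= l.
  apply: ub_le_sup; last by exists n.
  by exists (c 0%N) => _ [m _ <-].
have l0 : 0 < l by apply: lt_le_trans (r_gt0 0%N) (r_le 0%N).
(* Growing from index [m] by ratios at least [r m], and bounding [c (m + n).+1] by [c m * c n],
   gives [r m ^+ n.+1 <= c n] after cancelling [c m]; then [m] tends to infinity. *)
have c_pow n : l ^+ n.+1 <= c n.
  have h1 m : r m ^+ n.+1 <= c n.
    have h2 k : c m * r m ^+ k <= c (m + k)%N.
      elim: k => [|k ih]; first by rewrite expr0 mulr1 addn0.
      rewrite exprS mulrCA addnS.
      have -> : c (m + k).+1 = r (m + k)%N * c (m + k)%N by rewrite /r divfK ?gt_eqF.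
      apply: ler_pM => //; first exact: ltW.
        by rewrite mulr_ge0 // exprn_ge0 // ltW.
      by apply: r_nd; exact: leq_addr.
    have := le_trans (h2 n.+1) _; rewrite addnS => /(_ _ (c_sub m n)).
    by rewrite ler_pM2l.
  have h3 : (fun m => r m ^+ n.+1) @ \oo --> l ^+ n.+1.
    by apply: (@continuous_cvg _ _ _ _ _ r (fun x : R => x ^+ n.+1) l) => //; exact: exprn_continuous.
  rewrite -(cvg_lim _ h3) //; apply: limr_le; first by apply/cvg_ex; exists (l ^+ n.+1).
  by apply: nearW.
have c_S n : c n.+1 <= l * c n by rewrite -ler_pdivrMr // r_le.
pose be n := c n / l ^+ n.+1.
have be_ge1 n : 1 <= be n by rewrite /be ler_pdivlMr ?exprn_gt0 // mul1r.
have be_ni : nonincreasing_seq be.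
  apply/nonincreasing_seqP => n; rewrite /be ler_pdivrMr ?exprn_gt0 //.
  by rewrite [l ^+ n.+2]exprSr mulrA divfK ?gt_eqF ?exprn_gt0 // mulrC c_S.
have be_cvg : be @ \oo --> inf (range be).
  by apply: nonincreasing_cvgn => //; exists 1 => _ [n _ <-].
set bi := inf _ in be_cvg.
have be_ge n : bi <= be n.
  by apply: ge_inf; [exists 1 => _ [m _ <-]|exists n].
(* Only even powers of [h] occur, which removes the sign of the eigenvalues of [h]. The
   normalisation is chosen so that [b m] and [b n] convolve to [b (m + n).+1]. *)
pose b n x := rc (l ^+ n.+1)^-1 * p (n + n).+1 x.
have ap_b n : ap (b n) by exact: ap_scale.
have herm_b n : herm (b n) by exact: hermZ.
have bE n : b n 0 = rc (be n) by rewrite /b cE -rmorphM mulrC.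
have b_conv m n : conv (b m) (b n) = b (m + n).+1.
  rewrite /b convZl // ?convZr //; last exact: ap_scale.
  rewrite p_add; apply/funext => x; rewrite mulrA -rmorphM -invfM -exprD.
  have -> : (m.+1 + n.+1 = (m + n).+2)%N by rewrite addnS addSn.
  suff -> : ((m + m).+1 + (n + n).+1 = (m + n).+1 + (m + n).+1)%N by [].
  by rewrite !addnS !addSn addnACA.
(* Evaluate the convolution square of the difference at 0. Since [be] converges, the right-hand side
   tends to 0, so [b] is Cauchy in mean square. *)
have b_msq m n : msq (fun x => b m x - b n x) =
    be (m + m).+1 - 2 * be (m + n).+1 + be (n + n).+1.
  pose nb x := - 1 * b n x; have apn : ap nb by exact: ap_scale.
  pose D x := b m x + nb x; have apD' : ap D by exact: apD.
  have -> : (fun x => b m x - b n x) = D.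
    by apply/funext => x; rewrite /D /nb mulN1r.
  have hD : herm D by move=> x; rewrite /D /nb conjD !mulN1r conjN !herm_b.
  have -> : msq D = complex.Re (rc (msq D)) by [].
  rewrite -conv_herm0 //.
  have E1 : conv D D = fun x => conv (b m) D x + conv nb D x.
    exact: (convDl (ap_b m) apn apD').
  have E2 : conv (b m) D = fun x => conv (b m) (b m) x + conv (b m) nb x.
    exact: (convDr (ap_b m) apn (ap_b m)).
  have E3 : conv nb D = fun x => conv nb (b m) x + conv nb nb x.
    exact: (convDr (ap_b m) apn apn).
  have E4 : conv (b m) nb = fun x => - 1 * b (m + n).+1 x.
    by rewrite (convZr (- 1) (ap_b n) (ap_b m)) b_conv.
  have E5 : conv nb (b m) = fun x => - 1 * b (m + n).+1 x.
    by rewrite (convZl (- 1) (ap_b n) (ap_b m)) b_conv addnC.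
  have E6 : conv nb nb = fun x => - 1 * (- 1 * b (n + n).+1 x).
    by rewrite (convZl (- 1) (ap_b n) apn) (convZr (- 1) (ap_b n) (ap_b n)) b_conv.
  rewrite E1 E2 E3 E4 E5 E6 b_conv !bE !mulN1r opprK !ReD !ReN /=; lra.
have b_unif (e : R) : 0 < e -> exists K, forall m n, (K <= m)%N -> (K <= n)%N ->
    forall x, nm (b m x - b n x) <= e.
  move=> e0; have B0 : 0 <= msq (b 0%N) by exact: msq_ge0.
  have d0 : 0 < e ^+ 2 / (2 * (msq (b 0%N) + 1)).
    by rewrite divr_gt0 ?exprn_gt0 ?mulr_gt0 //; lra.
  move/cvgrPdist_le : be_cvg => /(_ _ d0)[K _ hK].
  exists K.+1 => -[|m] // [|n] //; rewrite !ltnS => Km Kn x.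
  have hbe k : (K <= k)%N -> be k <= bi + e ^+ 2 / (2 * (msq (b 0%N) + 1)).
    move=> Kk; have := hK k Kk; rewrite /= distrC; move=> /(le_trans (ler_norm _)).
    by rewrite lerBlDl.
  have hb : msq (fun x => b m x - b n x) <= e ^+ 2 / (msq (b 0%N) + 1).
    rewrite b_msq; have := be_ge (m + n).+1.
    have := hbe (m + m).+1 (leq_trans Km (leq_trans (leq_addr m m) (leqnSn _))).
    have := hbe (n + n).+1 (leq_trans Kn (leq_trans (leq_addr n n) (leqnSn _))).
    have -> : e ^+ 2 / (2 * (msq (b 0%N) + 1)) = e ^+ 2 / (msq (b 0%N) + 1) / 2.
      by field; apply: lt0r_neq0; lra.
    lra.
  have apn : ap (fun x => b m x - b n x).
    apply: apD => //.
    by have := ap_scale (- 1) (ap_b n); congr ap; apply/funext => y; rewrite mulN1r.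
  rewrite -(@ler_pXn2r _ 2) // ?nnegrE ?nm_ge0 //; last exact: ltW.
  (* Factoring out [b 0] lets [conv_cs] upgrade the mean-square estimate to a uniform one. *)
  have -> : b m.+1 x - b n.+1 x = conv (b 0%N) (fun x => b m x - b n x) x.
    have -> : (fun x => b m x - b n x) = (fun x => b m x + - 1 * b n x).
      by apply/funext => y; rewrite mulN1r.
    rewrite (convDr (ap_b m) (ap_scale (- 1) (ap_b n)) (ap_b 0%N)).
    by rewrite (convZr (- 1) (ap_b n) (ap_b 0%N)) !b_conv !add0n mulN1r.
  apply: le_trans (conv_cs x (ap_b 0%N) apn) _.
  apply: le_trans (ler_wpM2l B0 hb) _.
  rewrite mulrCA ger_pMr ?exprn_gt0 // ler_pdivrMr; lra.
have e_ex x : exists z, forall e, 0 < e ->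
    exists K, forall n, (K <= n)%N -> nm (b n x - z) <= e.
  apply: complex_cauchy => e /b_unif[K hK]; exists K => m n Km Kn; exact: hK.
have [e he] := choice e_ex.
have e_unif (d : R) : 0 < d -> exists K, forall n, (K <= n)%N ->
    forall x, nm (b n x - e x) <= d.
  move=> d0; have d2 : 0 < d / 2 by lra.
  have [K hK] := b_unif _ d2; exists K => n Kn x.
  have [K' hK'] := he x _ d2.
  have := nm_tri (b (maxn K K') x) (b n x) (e x).
  have := hK _ _ Kn (leq_maxl K K') x; have := hK' _ (leq_maxr K K'); lra.
have ap_e : ap e.
  apply: ap_lim => d /e_unif[K hK]; exists (b K) => // x.
  by rewrite nm_distC hK.
have herm_e : herm e.
  move=> x; apply: (@nm_le_eps_eq _ _ _ 2) => d /e_unif[K hK].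
  have h1 := hK K (leqnn K) x; have h2 := hK K (leqnn K) (- x).
  have := nm_tri (b K x) (conjc (e (- x))) (e x).
  have h3 : nm (conjc (e (- x)) - b K x) <= d.
    by rewrite nm_distC -(herm_b K x) -conjB nmJ.
  lra.
have e_0 : 1 <= complex.Re (e 0).
  apply/ler_addgt0Pr => d /e_unif[K hK]; have := hK K (leqnn K) 0.
  move=> /(le_trans (Re_le_nm _)); rewrite ReD ReN bE /=.
  by have := be_ge1 K; lra.
have b0e : conv (b 0%N) e = e.
  have [B B0 hB] := ap_bounded (ap_b 0%N).
  apply/funext => x; apply: (@nm_le_eps_eq _ _ _ (B + 1)) => d /e_unif[K hK].
  have h1 := hK K.+1 (leqnSn K) x.
  have h2 : nm (conv (b 0%N) e x - b K.+1 x) <= B * d.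
    have <- : conv (b 0%N) (b K) = b K.+1 by rewrite b_conv.
    rewrite /conv; apply: mean_dist; [exact: ap_conv_arg..|] => s.
    by rewrite -mulrBr nmM ler_pM ?nm_ge0 // nm_distC hK.
  have := nm_tri (b K.+1 x) (conv (b 0%N) e x) (e x); lra.
have bne n : conv (b n) e = e.
  elim: n => // n ih; have <- : conv (b 0%N) (b n) = b n.+1 by rewrite b_conv.
  by rewrite -convA // ih.
exists e, l; split => //; first split => //.
  have [B B0 hB] := ap_bounded ap_e.
  apply/funext => x; apply: (@nm_le_eps_eq _ _ _ B) => d /e_unif[K hK].
  have -> : conv e e x - e x = conv e e x - conv (b K) e x by rewrite bne.
  rewrite mulrC /conv; apply: mean_dist; [exact: ap_conv_arg..|] => s.
  by rewrite -mulrBl nmM ler_pM ?nm_ge0 // nm_distC hK.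
(* [b 0] is [conv h h] divided by [l], so [b0e] is the eigenvalue equation. *)
have := b0e; rewrite /b convZl // => E; rewrite -[in RHS]E.
apply/funext => x; rewrite mulrA -rmorphM expr1 mulfV ?gt_eqF // mul1r.
by [].
Qed.

End idempotents.

(** * Minimal idempotents and the characters they carry *)

Section characters.
Variables (R : realType) (G : zmodType).
Local Notation C := R[i].
Local Notation nm := (@ComplexField.Normc.normc R).
Local Notation rc := (real_complex R).
Implicit Types (f g h e p q : G -> C).

Lemma conv0r f : conv f (fun=> 0) = fun=> 0.
Proof.
apply/funext => x; rewrite /conv -[RHS](mean_cst G).
by congr mean; apply/funext => s; rewrite mulr0.
Qed.

Lemma apB f g : ap f -> ap g -> ap (fun x => f x - g x).
Proof.
move=> hf hg; apply: apD => //.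
by have := ap_scale (- 1) hg; congr ap; apply/funext => x; rewrite mulN1r.
Qed.

Lemma convBr f g h : ap f -> ap g -> ap h ->
  conv h (fun x => f x - g x) = fun x => conv h f x - conv h g x.
Proof.
move=> hf hg hh.
have -> : (fun x => f x - g x) = (fun x => f x + - 1 * g x).
  by apply/funext => x; rewrite mulN1r.
rewrite (convDr hf (ap_scale (- 1) hg) hh) (convZr (- 1) hg hh).
by apply/funext => x; rewrite mulN1r.
Qed.

Lemma idem_0 e : idem e -> e 0 = rc (msq e).
Proof. by case=> ae he ee; rewrite -conv_herm0 // ee. Qed.

(** From [e = conv e e], submultiplicativity bounds [msq e] by its square. This gap above 0 makes
    the descent in [exists_irr] terminate. *)
Lemma idem_ge1 e : idem e -> msq e != 0 -> 1 <= msq e.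
Proof.
case=> ae he ee e0; have := msq_conv ae ae; rewrite ee.
by rewrite ler_pMr // lt_neqAle eq_sym e0 msq_ge0.
Qed.

Lemma msq_neq0 f x : ap f -> f x != 0 -> msq f != 0.
Proof. by move=> hf; apply: contra => /eqP/(msq_eq0 hf) ->. Qed.

(** Minimality among nonzero idempotents, where [conv p q = p] says that [p] lies below [q]. *)
Definition irr q := [/\ idem q, msq q != 0 &
  forall p, idem p -> conv p q = p -> msq p != 0 -> p = q].

Lemma idemB e p : idem e -> idem p -> conv p e = p -> idem (fun x => e x - p x).
Proof.
move=> [ae he ee] [ap_p hp pp] pe; split; first exact: apB.
  by move=> x; rewrite conjB he hp.
have ep : conv e p = p by rewrite convC.
rewrite (convBr ae ap_p (apB ae ap_p)).
rewrite (convC (apB ae ap_p) ae) (convC (apB ae ap_p) ap_p).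
rewrite (convBr ae ap_p ae) (convBr ae ap_p ap_p) ee ep pe pp.
by apply/funext => x; rewrite subrr subr0.
Qed.

(** If [p] lies strictly below [e], then [p] and [e - p] are both nonzero idempotents with [msq] at
    least 1, so passing from [e] to [p] lowers [msq] by at least 1. *)
Lemma exists_irr n e : idem e -> msq e != 0 -> msq e <= n%:R ->
  exists2 q, irr q & conv q e = q.
Proof.
elim: n e => [|n ih] e ie e0 en.
  by have := idem_ge1 ie e0; lra.
have [ire|nire] := pselect (irr e); first by exists e => //; case: ie.
have [p [ip pe p0 pne]] : exists p, [/\ idem p, conv p e = p, msq p != 0 & p <> e].
  apply: contrapT => nex; apply: nire; split=> // p ip pe p0.
  by apply: contrapT => pne; apply: nex; exists p.
have id := idemB ie ip pe.
have d0 : msq (fun x => e x - p x) != 0.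
  apply/eqP => m0; apply: pne; apply/funext => x; case: id => ad _ _.
  by apply/esym/eqP; rewrite -subr_eq0; apply/eqP; exact: (msq_eq0 ad m0).
have msqB : msq (fun x => e x - p x) = msq e - msq p.
  by have := idem_0 id; rewrite (idem_0 ie) (idem_0 ip) -rmorphB => /complexI.
have := idem_ge1 id d0; rewrite msqB => h1.
have pn : msq p <= n%:R by move: en; rewrite -natr1; lra.
have [q irq qp] := ih p ip p0 pn; exists q => //.
case: irq => -[aq _ _] _ _; case: ie => ae _ _; case: ip => ap_p _ _.
by rewrite -{1}qp -convA // pe qp.
Qed.

(** For nonzero [h] the spectral idempotent lies below [q], hence equals [q], so [conv h h] is [l]
    times [q]. Then [k = h / sqrt l] squares to [q], the half-sum of [q] and [k] is an idempotent
    below [q], and minimality leaves [k = q] or [k = - q]. *)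
Lemma irr_scalar q h : irr q -> ap h -> herm h -> conv h q = h ->
  exists c : R, h = fun x => rc c * q x.
Proof.
move=> [[aq hq qq] q0 qmin] ah hh hhq.
have [h0|h0] := eqVneq (msq h) 0.
  exists 0; apply/funext => x; rewrite (msq_eq0 ah h0) rmorph0 mul0r.
  by [].
have [e [l [ie e0 l0 he]]] := spectral_idempotent ah hh h0.
have [ae hee ee] := ie; have ahh := ap_conv ah ah.
have eE : e = fun x => rc l^-1 * conv (conv h h) e x.
  apply/funext => x; rewrite he mulrA -rmorphM mulVf ?gt_eqF //.
  by rewrite rmorph1 mul1r.
have hq_h : conv q h = h by rewrite convC.
have eq_e : conv e q = e.
  rewrite [in LHS]eE (convZl _ (ap_conv ahh ae) aq) [RHS]eE.
  congr (fun F : G -> C => fun x => rc l^-1 * F x).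
  rewrite (convC (ap_conv ahh ae) aq) (convA aq ahh ae) (convA aq ah ah).
  by rewrite hq_h.
have e_q : e = q.
  apply: qmin => //; apply: (@msq_neq0 _ 0) => //.
  by apply/eqP => e00; move: e0; rewrite e00 /=; lra.
have hhE : conv h h = fun x => rc l * q x.
  by rewrite -e_q -he e_q -(convA ah ah aq) hhq.
pose m := Num.sqrt l; have m0 : 0 < m by rewrite sqrtr_gt0.
have mm : m * m = l by rewrite -expr2 sqr_sqrtr // ltW.
pose k x := rc m^-1 * h x; have ak : ap k by exact: ap_scale.
have kk : conv k k = q.
  rewrite (convZl _ ah ak) (convZr _ ah ah) hhE; apply/funext => x.
  rewrite !mulrA -!rmorphM -mm -[RHS]mul1r -(rmorph1 rc).
  by congr (rc _ * _); field; exact: lt0r_neq0.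
have kq : conv k q = k by rewrite (convZl _ ah aq) hhq.
have qk : conv q k = k by rewrite convC.
pose s x := q x + k x; have as_ : ap s by exact: apD.
pose p x := rc 2^-1 * s x; have ap_p : ap p by exact: ap_scale.
have two : rc 2^-1 * (1 + 1) = 1 :> C.
  by rewrite -(rmorph1 rc) -rmorphD -rmorphM; congr rc; field.
have qs : conv q s = s by rewrite (convDr aq ak aq) qq qk.
have ks : conv k s = s.
  by rewrite (convDr aq ak ak) kq kk; apply/funext => x; rewrite addrC.
have ss : conv s s = fun x => s x + s x by rewrite (convDl aq ak as_) qs ks.
have pp : conv p p = p.
  rewrite (convZl _ as_ ap_p) (convZr _ as_ as_) ss; apply/funext => x.
  rewrite /p; congr (_ * _); rewrite -[X in X + _]mul1r -[X in _ + X]mul1r.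
  by rewrite -mulrDl mulrA two mul1r.
have hp : herm p by apply: hermZ; apply: hermD => //; exact: hermZ.
have pq : conv p q = p by rewrite (convZl _ as_ aq) convC // qs.
have qE x : q x = rc 2^-1 * (q x + q x).
  by rewrite -[X in X + _]mul1r -[X in _ + X]mul1r -mulrDl mulrA two mul1r.
have hE x : h x = rc m * k x.
  by rewrite /k mulrA -rmorphM mulfV ?gt_eqF // rmorph1 mul1r.
have half0 : rc 2^-1 != 0.
  by apply/eqP => h20; have := two; rewrite h20 mul0r => /eqP; rewrite eq_sym oner_eq0.
have [p0|p0] := eqVneq (msq p) 0.
  exists (- m); apply/funext => x; rewrite hE rmorphN mulNr -mulrN; congr (_ * _).
  have /eqP := msq_eq0 ap_p p0 x.
  by rewrite /p mulf_eq0 (negbTE half0) /= /s addrC addr_eq0 => /eqP.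
exists m; apply/funext => x; rewrite hE; congr (_ * _).
have : p x = q x by rewrite (qmin p).
by rewrite [X in _ = X -> _]qE => /(mulfI half0) /addrI.
Qed.

(** A translate of [q] is not self-adjoint, so it is split as [(u - i v) / 2] with [u] and [v]
    self-adjoint in the ideal of [q]; each is a real multiple of [q] by [irr_scalar]. *)
Lemma irr_translate q t : irr q -> exists c : C, forall x, q (x + t) = c * q x.
Proof.
move=> irq; have [[aq hq qq] q0 qmin] := irq.
have at_ := ap_shift t aq; have amt := ap_shift (- t) aq.
have tq u : conv (fun x => q (x + u)) q = fun x => q (x + u).
  by rewrite conv_shift qq.
pose u x := q (x + t) + q (x - t); have au : ap u by exact: apD.
pose v x := Complex 0 1 * (q (x + t) - q (x - t)).
have av : ap v by apply: ap_scale; exact: apB.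
have hu : herm u.
  move=> x; rewrite /u conjD -(hq (x + t)) -(hq (x - t)) addrC !opprD !opprK.
  by [].
have ii : conjc (Complex 0 1) = - Complex 0 1 :> C.
  by apply/eqP; rewrite eq_complex /= oppr0 !eqxx.
have hv : herm v.
  move=> x; rewrite /v conjM conjB ii -(hq (x + t)) -(hq (x - t)) !opprD !opprK.
  by rewrite mulNr -mulrN opprB.
have uq : conv u q = u by rewrite (convDl at_ amt aq) !tq.
have vq : conv v q = v.
  rewrite (convZl _ (apB at_ amt) aq) (convC (apB at_ amt) aq).
  by rewrite (convBr at_ amt aq) (convC aq at_) (convC aq amt) !tq.
have [a ha] := irr_scalar irq au hu uq; have [b hb] := irr_scalar irq av hv vq.
exists (2^-1 * (rc a - Complex 0 1 * rc b)) => x.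
have -> : 2^-1 * (rc a - Complex 0 1 * rc b) * q x =
    2^-1 * (rc a * q x - Complex 0 1 * (rc b * q x)) by ring.
have -> : rc a * q x = u x by rewrite ha.
have -> : rc b * q x = v x by rewrite hb.
rewrite /u /v [_ 0 1 * (_ 0 1 * _)]mulrA.
have -> : Complex 0 1 * Complex 0 1 = - 1 :> C.
  by apply/eqP; rewrite eq_complex /= !mulr0 !mul0r mulr1 sub0r addr0 oppr0 !eqxx.
have two : 2 != 0 :> C by rewrite pnatr_eq0.
by field.
Qed.

(* A nonzero almost periodic function has a nonzero Fourier coefficient: a
   minimal spectral idempotent q of the positive-definite function f * f~ spans
   a minimal ideal, so translations act on it by scalars. *)
Theorem ap_character f : ap f -> msq f != 0 -> exists chi : G -> C,
  [/\ ap chi, forall s t, chi (s + t) = chi s * chi t, forall t, nm (chi t) = 1 &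
      mean (fun s => f s * conjc (chi s)) != 0].
Proof.
move=> af f0; pose f' x := conjc (f (- x)); have af' : ap f' by exact/apJ/ap_opp.
pose h := conv f f'; have ah : ap h by exact: ap_conv.
have hh : herm h.
  move=> x; rewrite /h /conv -meanJ; last exact: ap_conv_arg.
  rewrite -(mean_shift (- x)); last exact/apJ/ap_conv_arg.
  congr mean; apply/funext => s.
  rewrite conjM /f' conjcK mulrC; congr (f _ * conjc (f _)).
    by rewrite opprB.
  by rewrite opprB addKr.
have h00 : h 0 = rc (msq f).
  rewrite -mean_sqr // -(mean_opp (ap_sqr af)); congr mean; apply/funext => s.
  by rewrite sub0r.
have h0 : msq h != 0.
  apply: (@msq_neq0 _ 0) => //; rewrite h00; apply: contra f0 => /eqP.
  by rewrite -(rmorph0 rc) => /complexI ->.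
have [e [l [ie e1 l0 he]]] := spectral_idempotent ah hh h0.
have e0 : msq e != 0.
  have := e1; rewrite (idem_0 ie) /= => h1; apply/eqP => m0.
  by rewrite m0 ler10 in h1.
have [n hn] : exists n : nat, msq e <= n%:R.
  by exists (Num.bound (msq e)); rewrite ltW // archi_boundP // msq_ge0 //; case: ie.
have [q irq qe] := exists_irr ie e0 hn.
have [iq q0 _] := irq; have [aq hq qq] := iq.
have q1 : 0 < msq q by apply: lt_le_trans (idem_ge1 iq q0).
have q00 := idem_0 iq.
have q0c : q 0 != 0.
  by rewrite q00 -(rmorph0 rc); apply: contra q0 => /eqP/complexI ->.
pose chi t := q t / q 0.
have qt x t : q (x + t) = chi t * q x.
  have [c hc] := irr_translate t irq.
  by have := hc 0; rewrite add0r hc /chi => ->; rewrite mulfK.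
have chiM s t : chi (s + t) = chi s * chi t by rewrite {1}/chi qt -mulrA mulrC.
(* Cauchy-Schwarz for [q = conv q q] bounds [q] by [msq q], which is [q 0]. Equality follows from
   [chi t * chi (- t) = 1]. *)
have chi_le t : nm (chi t) <= 1.
  have := conv_cs t aq aq; rewrite qq => h1.
  rewrite /chi q00 nmM nmV nm_real gtr0_norm // ler_pdivrMr //.
  by rewrite mul1r -(@ler_pXn2r _ 2) // ?nnegrE ?nm_ge0 // ltW.
have chi0 : chi 0 = 1 by rewrite /chi divff.
have chiV t : chi t * chi (- t) = 1 by rewrite -chiM subrr chi0.
have chi1 t : nm (chi t) = 1.
  apply/eqP; rewrite eq_le chi_le /=; have := congr1 nm (chiV t).
  rewrite nmM nm1 => h1; rewrite -[leLHS]h1 ler_piMr ?nm_ge0 //; exact: chi_le.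
have chiN t : chi (- t) = conjc (chi t).
  have ct0 : chi t != 0.
    by apply/eqP => c0; have /eqP := chi1 t; rewrite c0 nm0 eq_sym oner_eq0.
  by apply: (mulfI ct0); rewrite chiV mulJ chi1 expr1n.
have achi : ap chi.
  have := ap_scale (q 0)^-1 aq; congr ap; apply/funext => x.
  by rewrite /chi mulrC.
(* A zero coefficient makes [q] annihilate [f], hence [h]; but [q] lies below [e], on which
   [conv h h] acts as the positive scalar [l]. *)
exists chi; split=> //; apply/eqP => m0.
have qf : conv q f = fun=> 0.
  apply/funext => x; rewrite /conv.
  have -> : (fun s => q (x - s) * f s) = (fun s => q x * (f s * conjc (chi s))).
    by apply/funext => s; rewrite qt chiN; ring.
  by rewrite meanZ ?m0 ?mulr0 //; apply: apM => //; exact: apJ.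
have qh : conv h q = fun=> 0.
  rewrite (convC ah aq) /h (convA aq af af') qf (convC _ af') ?conv0r //.
  exact: ap_cst.
have [ae _ _] := ie; have eq_q : conv e q = q by rewrite convC.
have : conv (conv (conv h h) e) q = fun x => rc l * q x.
  by rewrite he (convZl _ ae aq) eq_q.
rewrite -(convA (ap_conv ah ah) ae aq) eq_q -(convA ah ah aq) qh conv0r.
move=> /(congr1 (fun F => F 0)) /esym /eqP; rewrite mulf_eq0 (negbTE q0c) orbF.
by rewrite -(rmorph0 rc) => /eqP/complexI l00; rewrite l00 ltxx in l0.
Qed.

End characters.

(** * Continuous characters of the real line and of R^d *)

Section real_characters.
Variable R : realType.
Local Notation C := R[i].
Local Notation nm := (@ComplexField.Normc.normc R).
Local Notation rc := (real_complex R).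

Definition cis (x : R) : C := Complex (cos x) (sin x).

Lemma cisD x y : cis (x + y) = cis x * cis y.
Proof. by rewrite /cis cosD sinD; congr Complex; rewrite addrC. Qed.

Lemma cis0 : cis 0 = 1.
Proof. by rewrite /cis cos0 sin0. Qed.

Lemma nm_cis x : nm (cis x) = 1.
Proof. by rewrite /= cos2Dsin2 sqrtr1. Qed.

Lemma cis_cont0 (e : R) : 0 < e ->
  exists2 d : R, 0 < d & forall x, `|x| < d -> nm (cis x - 1) <= e.
Proof.
move=> e0; have e2 : 0 < e / 2 by lra.
have /cvgrPdist_le/(_ _ e2) := @continuous_cos R 0.
have /cvgrPdist_le/(_ _ e2) := @continuous_sin R 0.
move=> /nbhs_ballP[d1 /= d10 h1] /nbhs_ballP[d2 /= d20 h2].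
exists (Num.min d1 d2); first by rewrite lt_min d10 d20.
move=> x; rewrite lt_min => /andP[x1 x2].
have {}h1 := h1 x; have {}h2 := h2 x.
rewrite /ball /= sub0r normrN sin0 sub0r normrN in h1.
rewrite /ball /= sub0r normrN cos0 distrC in h2.
apply: le_trans (nm_le_ReIm (cis x - 1)) _; rewrite /cis /= oppr0 addr0.
by have := lerD (h2 x2) (h1 x1); rewrite -splitr.
Qed.

(** Near 0 the character stays in the right half-plane, where square roots are unique. So the angle
    read off at one point [D] determines [c] at all [D / 2 ^+ n], and continuity does the rest. *)
Lemma real_character (c : R -> C) :
  (forall s t, c (s + t) = c s * c t) -> (forall t, nm (c t) = 1) ->
  (forall e, 0 < e -> exists2 d : R, 0 < d &
     forall x, `|x| < d -> nm (c x - 1) <= e) ->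
  exists a : R, forall r, c r = cis (a * r).
Proof.
move=> cD c1 cc.
have c_neq0 r : c r != 0.
  by apply/eqP => c0; have /eqP := c1 r; rewrite c0 nm0 eq_sym oner_eq0.
(* Distance at most one half from 1 forces a positive real part. *)
have [d d0 hd] := cc 2^-1 ltac:(by rewrite invr_gt0).
pose D := d / 2; have D0 : 0 < D by apply: divr_gt0.
have Re_gt0 r : `|r| <= D -> 0 < complex.Re (c r).
  move=> rD; have /hd : `|r| < d by rewrite /D in rD D0; lra.
  move=> /(le_trans (le_Re_nm _)); rewrite ReD ReN /= ler_norml => /andP[]; lra.
pose z := c D; pose th := asin (complex.Im z).
have z1 : complex.Re z ^+ 2 + complex.Im z ^+ 2 = 1 by rewrite -sqr_nm c1 expr1n.
have Imz : -1 <= complex.Im z <= 1.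
  by rewrite -ler_norml (le_trans (le_Im_nm _)) // c1.
have zE : z = cis th.
  rewrite /cis asinK // cos_asin // -z1 addrK sqrtr_sqr ger0_norm; first by case: (z).
  by rewrite ltW // Re_gt0 // gtr0_norm.
have cos_th n : 0 < cos (th / 2 ^+ n).
  have h2 : 1 <= 2 ^+ n :> R by rewrite exprn_ege1 // ler1n.
  have th0 : `|th| < pi / 2.
    have zR : 0 < complex.Re z by rewrite Re_gt0 // gtr0_norm.
    have : -1 < complex.Im z < 1 by apply/andP; split; nra.
    case/andP => h1 h3; rewrite ltr_norml /th; apply/andP; split.
      by apply: asin_gtNpi2; rewrite h1 ltW.
    by apply: asin_ltpi2; rewrite h3 ltW.
  apply: cos_gt0_pihalf; rewrite -ltr_norml; apply: le_lt_trans th0.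
  by rewrite normrM [X in _ * X]ger0_norm ?invr_ge0 // ?ler_pdivrMr ?ler_peMr //; lra.
pose g r := c r * cis (- (th / D * r)).
have gD s t : g (s + t) = g s * g t.
  by rewrite /g cD mulrDr opprD cisD; ring.
have cisV r : cis (- r) * cis r = 1 by rewrite -cisD addNr cis0.
have gn n : g (D / 2 ^+ n) = 1.
  have -> : g (D / 2 ^+ n) = c (D / 2 ^+ n) * cis (- (th / 2 ^+ n)).
    rewrite /g; congr (_ * cis (- _)); field.
    by rewrite expf_neq0 //= lt0r_neq0.
  suff -> : c (D / 2 ^+ n) = cis (th / 2 ^+ n) by rewrite mulrC cisV.
  elim: n => [|n ih]; first by rewrite expr0 !divr1.
  have half (x : R) : x / 2 ^+ n = x / 2 ^+ n.+1 + x / 2 ^+ n.+1.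
    by rewrite exprS; field; rewrite expf_neq0.
  have : c (D / 2 ^+ n.+1) ^+ 2 == cis (th / 2 ^+ n.+1) ^+ 2.
    by rewrite !expr2 -cD -cisD -!half ih.
  rewrite eqf_sqr => /orP[/eqP//|/eqP h].
  have h2 : 1 <= 2 ^+ n.+1 :> R by rewrite exprn_ege1 // ler1n.
  have h3 : `|D / 2 ^+ n.+1| <= D.
    rewrite ger0_norm; last by rewrite divr_ge0 ?exprn_ge0 // ltW.
    by rewrite ler_pdivrMr ?ler_peMr ?exprn_gt0 // ltW.
  have := Re_gt0 _ h3; rewrite h ReN /= oppr_gt0 => /ltW.
  by rewrite leNgt cos_th.
have g0 : g 0 = 1 by rewrite /g mulr0 oppr0 cis0 mulr1 -[c 0]mulr1 -[X in _ * X](mulfV (c_neq0 0)) mulrA -cD addr0 mulfV.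
have gcont (e : R) : 0 < e -> exists2 d' : R, 0 < d' &
    forall x, `|x| < d' -> nm (g x - 1) <= e.
  move=> e0; have e2 : 0 < e / 2 by lra.
  have [d1 d10 h1] := cc _ e2; have [d2 d20 h2] := cis_cont0 e2.
  have t0 : 0 < `|th / D| + 1 by rewrite ltr_wpDl.
  exists (Num.min d1 (d2 / (`|th / D| + 1))); first by rewrite lt_min d10 divr_gt0.
  move=> x; rewrite lt_min => /andP[x1 x2].
  have -> : g x - 1 = (c x - 1) * cis (- (th / D * x)) + (cis (- (th / D * x)) - 1).
    by rewrite /g; ring.
  apply: le_trans (nmD _ _) _; rewrite nmM nm_cis mulr1 [e]splitr lerD ?h1 //.
  apply: h2; rewrite normrN normrM; apply: le_lt_trans (_ : (`|th / D| + 1) * `|x| < _).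
    by rewrite ler_wpM2r // lerDl.
  by rewrite mulrC -ltr_pdivlMr.
have g1 r : g r = 1.
  apply: (@nm_le_eps_eq _ _ _ 1) => e e0; rewrite mul1r.
  have [d' d'0 hd'] := gcont _ e0.
  have [n hn] : exists n : nat, D / d' < 2 ^+ n.
    exists (Num.bound (D / d')); apply: lt_le_trans (archi_boundP _) _.
      by rewrite divr_ge0 ?ltW.
    by rewrite -natrX ler_nat ltnW // ltn_expl.
  (* [g] is 1 on the multiples of [s], so [r] may be replaced by its remainder modulo [s], which is
     smaller than [d']. *)
  pose s := D / 2 ^+ n; have s0 : 0 < s by rewrite divr_gt0 ?exprn_gt0.
  have sd : s < d'.
    by rewrite /s ltr_pdivrMr ?exprn_gt0 // mulrC -ltr_pdivrMr.
  have gint (m : int) : g (s *~ m) = 1.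
    have gnat (k : nat) : g (s *+ k) = 1.
      by elim: k => [|k ih]; rewrite ?mulr0n ?g0 // mulrS gD ih gn mulr1.
    case: m => m; first exact: gnat.
    have := gD (s *+ m.+1) (- (s *+ m.+1)).
    by rewrite subrr g0 gnat mul1r NegzE mulrNz => <-.
  pose m := Num.floor (r / s).
  have -> : g r = g (r - s *~ m).
    by rewrite gD -mulrNz gint mulr1.
  apply: hd'; rewrite -[s *~ m]mulrzr.
  have /andP[m1 m2] := floor_itv (r / s).
  move: m1 m2; rewrite -/m ler_pdivlMr // ltr_pdivrMr // intrD mulrDl mul1r mulrC => m1 m2.
  by rewrite ger0_norm ?subr_ge0 //; lra.
exists (th / D) => r.
by rewrite -[RHS]mul1r -(g1 r) /g -mulrA cisV mulr1.
Qed.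

Lemma continuous_character d (chi : 'rV[R]_d -> C) :
  (forall s t, chi (s + t) = chi s * chi t) -> (forall t, nm (chi t) = 1) ->
  (forall e, 0 < e -> exists2 b : R, 0 < b &
     forall x, `|x| < b -> nm (chi x - 1) <= e) ->
  exists k, forall t, chi t = charexp k t.
Proof.
move=> chiD chi1 chic.
have key i : exists a : R, forall r, chi (r *: delta_mx 0 i) = cis (a * r).
  apply: real_character => [s t|t|e e0]; first by rewrite scalerDl.
    exact: chi1.
  have [b b0 hb] := chic e e0; pose n := `|delta_mx 0 i : 'rV[R]_d| + 1.
  have n0 : 0 < n by rewrite /n ltr_wpDl.
  exists (b / n); first exact: divr_gt0.
  move=> x hx; apply: hb; rewrite normrZ; apply: le_lt_trans (_ : `|x| * n < _).
    by rewrite ler_wpM2l // lerDl.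
  by rewrite -ltr_pdivlMr.
have [a ha] := choice key.
have chi0 : chi 0 = 1.
  have c0 : chi 0 != 0.
    by apply/eqP => c0; have /eqP := chi1 0; rewrite c0 nm0 eq_sym oner_eq0.
  by apply: (mulfI c0); rewrite -chiD addr0 mulr1.
(* Sign and factor undo those in [charexp], whose phase is [- 2 pi k t]. *)
exists (\row_i (- (a i / (2 * pi)))) => t.
have -> : charexp (\row_i (- (a i / (2 * pi)))) t = cis (\sum_i a i * t 0 i).
  rewrite /charexp -/(cis _); congr cis; rewrite /dotp mulr_sumr -sumrN.
  apply: eq_bigr => i _; rewrite mxE.
  by have := lt0r_neq0 (pi_gt0 R); move: (pi : R) => p p0; field.
rewrite [t in LHS]row_sum_delta.
apply: (big_rec2 (fun x y => chi x = cis y)); first by rewrite chi0 cis0.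
by move=> i y x _ h; rewrite chiD cisD ha h.
Qed.

End real_characters.

(** * Cubes, volumes and van Hove sequences *)

(** Finite subcovers for a choice of neighbourhoods that need not be open. Otherwise the sets
    containing [K] minus finitely many [U y] form a proper filter, whose cluster point [p]
    contradicts the removal of [U p]. *)
Lemma compact_nbhs_cover (T : topologicalType) (K : set T) (U : T -> set T) :
  compact K -> (forall x, K x -> nbhs x (U x)) ->
  exists s : seq T, (forall y, y \in s -> K y) /\
    forall x, K x -> exists2 y, y \in s & U y x.
Proof.
move=> cK hU; apply: contrapT => nex.
pose F := [set A : set T | exists s : seq T, (forall y, y \in s -> K y) /\
  forall x, K x -> (forall y, y \in s -> ~ U y x) -> A x].
have FF : Filter F.
  split.
  - by exists [::].
  - move=> A B [s [sK hs]] [t [tK ht]]; exists (s ++ t); split.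
      by move=> y; rewrite mem_cat => /orP[/sK|/tK].
    move=> x Kx hx; split; [apply: hs => // y ys|apply: ht => // y yt];
      by apply: hx; rewrite mem_cat ?ys ?yt ?orbT.
  - by move=> A B AB [s [sK hs]]; exists s; split=> // x Kx hx; apply/AB/hs.
have PF : ProperFilter F.
  apply: Build_ProperFilter_ex => A [s [sK hs]]; apply: contrapT => nA.
  apply: nex; exists s; split=> // x Kx; apply: contrapT => nx.
  apply: nA; exists x; apply: hs => // y ys Uy; apply: nx; exists y => //.
have FK : F K by exists [::].
have [p [Kp clp]] := cK F PF FK.
have FU : F (K `\` U p).
  exists [:: p]; split; first by move=> y; rewrite inE => /eqP ->.
  by move=> x Kx hx; split=> //; apply: hx; rewrite inE.
by have [z [[_ nUz] Uz]] := clp _ _ FU (hU p Kp).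
Qed.

Section lattice_cubes.
Variables (R : realType) (d : nat).
Local Notation E := 'rV[R]_d.
Implicit Types (S : set E) (z : 'rV[int]_d).

Definition cube z : set E :=
  [set x | forall i, (z 0 i)%:~R <= x 0 i <= (z 0 i)%:~R + 1].

Lemma compact_cube z : compact (cube z).
Proof.
have := @rV_compact R d (fun i => `[(z 0 i)%:~R, (z 0 i)%:~R + 1]%classic).
have -> : [set v : E | forall i, `[(z 0 i)%:~R, (z 0 i)%:~R + 1]%classic (v ord0 i)] = cube z.
  by apply/seteqP; split => x /= h i; have := h i; rewrite in_itv.
by apply=> i; exact: segment_compact.
Qed.

Lemma obox_nbhs (a b x : E) : obox a b x -> nbhs x (obox a b).
Proof.
move=> hx.
apply: (@filter_forall _ _ (fun i (v : E) => a 0 i < v 0 i < b 0 i) (nbhs x)) => i.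
have /andP[h1 h2] := hx i.
have H := @coord_continuous R 1 d 0 i x.
have : nbhs (x 0 i) `]a 0 i, b 0 i[%classic.
  by apply: open_nbhs_nbhs; split; [exact: interval_open|rewrite /= in_itv /= h1 h2].
move=> h; have sub : (fun M : E => M 0 i) @^-1` `]a 0 i, b 0 i[%classic `<=`
    (fun v : E => a 0 i < v 0 i < b 0 i) by move=> y /=; rewrite in_itv.
exact: (@filterS _ (nbhs x) _ _ _ sub (H _ h)).
Qed.

Lemma size_count_cover (T U : eqType) (s : seq T) (bs : seq U) (P : U -> pred T) :
  (forall x, x \in s -> exists2 b, b \in bs & P b x) ->
  (size s <= \sum_(b <- bs) count (P b) s)%N.
Proof.
elim: s => [|x s ih] h //=; rewrite big_split /= -add1n leq_add //.
  have [b bbs Pbx] := h x (mem_head _ _).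
  by rewrite (big_rem b) //= Pbx leq_addr.
by apply: ih => y ys; apply: h; rewrite inE ys orbT.
Qed.

Lemma card_int_box (s : seq 'rV[int]_d) (lo : 'I_d -> int) (n : 'I_d -> nat) :
  uniq s -> (forall w, w \in s -> forall i, lo i <= w 0 i < lo i + (n i)%:Z) ->
  (size s <= \prod_i n i)%N.
Proof.
move=> us hs; pose N := (\max_i n i)%N.
pose phi (w : 'rV[int]_d) : {ffun 'I_d -> 'I_N.+1} :=
  [ffun i => inord (absz (w 0 i - lo i)%R)].
have phiE w i : w \in s -> phi w i = absz (w 0 i - lo i)%R :> nat /\ (absz (w 0 i - lo i)%R < n i)%N.
  move=> ws; have /andP[h1 h2] := hs w ws i.
  have h3 : (absz (w 0 i - lo i)%R < n i)%N.
    by rewrite -ltz_nat gez0_abs ?subr_ge0 // ltrBlDl.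
  split=> //; rewrite ffunE inordK // ltnS (leq_trans (ltnW h3)) //.
  exact: leq_bigmax.
have phi_inj : {in s &, injective phi}.
  move=> w w' ws ws' e; apply/rowP => i.
  have [h1 _] := phiE w i ws; have [h2 _] := phiE w' i ws'.
  have : absz (w 0 i - lo i)%R = absz (w' 0 i - lo i)%R by rewrite -h1 -h2 e.
  have /andP[h3 _] := hs w ws i; have /andP[h4 _] := hs w' ws' i.
  move=> /(congr1 Posz); rewrite !gez0_abs ?subr_ge0 //.
  by move/addIr.
have um : uniq (map phi s) by rewrite map_inj_in_uniq.
rewrite -(size_map phi) -(card_uniqP um).
pose F (i : 'I_d) : pred 'I_N.+1 := fun k => (k < n i)%N.
have : (#|map phi s| <= #|family F|)%N.
  apply: subset_leq_card; apply/fintype.subsetP => f /mapP[w ws ->]; apply/familyP => i.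
  by rewrite unfold_in /F; have [-> h] := phiE w i ws.
move=> /leq_trans; apply; rewrite card_family.
rewrite foldrE big_map big_enum /=; apply: leq_prod => i _.
rewrite cardE -(size_map val) -[X in (_ <= X)%N](size_iota 0).
apply: uniq_leq_size; first by rewrite map_inj_uniq ?enum_uniq //; exact: val_inj.
move=> k /mapP[j]; rewrite mem_enum unfold_in => jn ->.
by rewrite mem_iota.
Qed.

Lemma count_grid (s : seq 'rV[int]_d) (m : nat) (a b : E) :
  uniq s -> (forall i, a 0 i <= b 0 i) -> (0 < m)%N ->
  (count (fun w : 'rV[int]_d => `[< obox a b (\row_i ((w 0 i)%:~R / m%:R)) >]) s)%:R <=
  m%:R ^+ d * \prod_i (b 0 i - a 0 i + m%:R^-1).
Proof.
move=> us ab m0; rewrite -size_filter.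
have m0' : 0 < m%:R :> R by rewrite ltr0n.
pose lo i := Num.floor (m%:R * a 0 i) + 1.
pose n i := absz (Num.ceil (m%:R * b 0 i) - lo i)%R.
have h := @card_int_box _ lo n (filter_uniq _ us).
apply: le_trans (_ : (\prod_i n i)%:R <= _).
  rewrite ler_nat; apply: h => w; rewrite mem_filter => /andP[/asboolP hw _] i.
  have := hw i; rewrite mxE ltr_pdivlMr // ltr_pdivrMr // => /andP[h1 h2].
  have h3 : lo i <= w 0 i.
    by rewrite /lo lezD1 floor_lt_int mulrC.
  have h4 : w 0 i < Num.ceil (m%:R * b 0 i) by rewrite ceil_gt_int mulrC.
  rewrite h3 /= /n gez0_abs ?subr_ge0 ?(le_trans h3 (ltW h4)) //.
  by rewrite addrC subrK.
rewrite natr_prod.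
have -> : m%:R ^+ d * \prod_i (b 0 i - a 0 i + m%:R^-1) =
    \prod_(i < d) (m%:R * (b 0 i - a 0 i + m%:R^-1)).
  by rewrite big_split /= prodr_const card_ord.
apply: ler_prod => i _; rewrite ler0n /=.
rewrite mulrDr mulfV ?gt_eqF // mulrBr.
have h1 := floor_le_tmp (m%:R * a 0 i).
have h2 := floorD1_gt (m%:R * a 0 i).
have h3 := ceil_ge (m%:R * b 0 i).
have h4 := ceilB1_lt (m%:R * b 0 i).
have h5 : m%:R * a 0 i <= m%:R * b 0 i by rewrite ler_pM2l.
rewrite natr_absz intr_norm /lo !rmorphB !rmorphD /= in h2 h4 *.
by rewrite ler_norml; apply/andP; split; lra.
Qed.

(** [lebesgue_d] is an outer measure, so lower bounds must be proved. Count points of the grid of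
    mesh [1 / m]: each unit cube supplies [m ^ d], an open box holds at most [m ^ d] times the
    product of its sides enlarged by [1 / m]. Then [m] tends to infinity. *)
Lemma finite_box_cover (Z : seq 'rV[int]_d) (bs : seq (E * E)) : uniq Z ->
  (forall p, p \in bs -> forall i, p.1 0 i <= p.2 0 i) ->
  (forall z x, z \in Z -> cube z x -> exists2 p, p \in bs & obox p.1 p.2 x) ->
  (size Z)%:R <= \sum_(p <- bs) boxvol p.1 p.2.
Proof.
move=> uZ hbs hZ.
have key (m : nat) : (size Z)%:R <=
    \sum_(p <- bs) \prod_i (p.2 0 i - p.1 0 i + m.+1%:R^-1).
  (* The offsets are strictly below the mesh count, so distinct cubes give distinct grid points
     although closed cubes share faces. *)
  pose g z (j : {ffun 'I_d -> 'I_m.+1}) : 'rV[int]_d :=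
    \row_i (z 0 i * m.+1%:Z + (j i)%:Z).
  pose s := [seq g z j | z <- Z, j <- enum {ffun 'I_d -> 'I_m.+1}].
  have us : uniq s.
    apply: allpairs_uniq => //; first exact: enum_uniq.
    move=> [z j] [z' j'] _ _ /= /rowP e.
    have e' i : z 0 i = z' 0 i /\ j i = j' i.
      have := e i; rewrite !mxE => ei.
      have h1 := divzMDl (z 0 i) (j i) (_ : m.+1%:Z != 0).
      have h2 := divzMDl (z' 0 i) (j' i) (_ : m.+1%:Z != 0).
      have zz : z 0 i = z' 0 i.
        move: (h1 isT) (h2 isT); rewrite ei => ->.
        by rewrite !divz_small ?addr0 //= ltz_nat ltn_ord.
      split=> //; apply/val_inj => /=; move: ei; rewrite zz => /addrI; case.
      by [].
    congr pair; first by apply/rowP => i; have [] := e' i.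
    by apply/ffunP => i; have [] := e' i.
  have sz : size s = (size Z * m.+1 ^ d)%N.
    by rewrite size_allpairs -cardE card_ffun !card_ord.
  have m0 : 0 < m.+1%:R :> R by rewrite ltr0n.
  have hs : forall w, w \in s -> exists2 p, p \in bs &
      `[< obox p.1 p.2 (\row_i ((w 0 i)%:~R / m.+1%:R)) >].
    move=> w /allpairsP[[z j] /= [zZ _ ->]].
    have : cube z (\row_i ((g z j 0 i)%:~R / m.+1%:R) : E).
      move=> i; rewrite !mxE rmorphD rmorphM /= mulrDl mulfK ?gt_eqF //.
      rewrite lerDl divr_ge0 //= lerD2l ler_pdivrMr // mul1r.
      by rewrite ler_nat ltnW // ltn_ord.
    by move=> /(hZ _ _ zZ)[p pbs hp]; exists p => //; apply/asboolP.
  have := size_count_cover hs; rewrite sz -(ler_nat R) natrM natrX natr_sum.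
  have : \sum_(p <- bs) (count (fun w : 'rV[int]_d => `[< obox p.1 p.2 (\row_i ((w 0 i)%:~R / m.+1%:R)) >]) s)%:R
    <= m.+1%:R ^+ d * \sum_(p <- bs) \prod_i (p.2 0 i - p.1 0 i + m.+1%:R^-1) :> R.
    rewrite mulr_sumr big_seq [leRHS]big_seq; apply: ler_sum => p pbs.
    by apply: count_grid => //; exact: hbs.
  move=> h1 h2; have := le_trans h2 h1.
  by rewrite mulrC ler_pM2l // exprn_gt0.
have hl : \sum_(p <- bs) \prod_i (p.2 0 i - p.1 0 i + @harmonic R m) @[m --> \oo] -->
    \sum_(p <- bs) boxvol p.1 p.2.
  apply: cvg_big => [|p _]; first exact: add_continuous.
  apply: cvg_big => [|i _]; first exact: mul_continuous.
  rewrite -[X in _ --> X]addr0; apply: cvgD; first exact: cvg_cst.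
  exact: cvg_harmonic.
rewrite -(cvg_lim _ hl) //; apply: limr_ge; first by apply/cvg_ex; eexists; exact: hl.
by apply: nearW => m; exact: key.
Qed.

(** The union of the cubes is compact, so finitely many boxes of a countable cover already cover
    it. *)
Lemma cubes_lebesgue S (Z : seq 'rV[int]_d) : uniq Z ->
  (forall z, z \in Z -> cube z `<=` S) -> ((size Z)%:R%:E <= lebesgue_d S)%E.
Proof.
move=> uZ hZ; apply: le_ereal_inf_tmp => _ [I [a [b [ab SI ->]]]].
pose Q := \bigcup_(z in [set` Z]) cube z.
have cQ : compact Q.
  by rewrite /Q bigcup_seq; apply: bigsetU_compact => z _; exact: compact_cube.
have hQ x : exists k, Q x -> I k /\ obox (a k) (b k) x.
  have [Qx|nQx] := pselect (Q x); last by exists 0%N.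
  by case: (Qx) => z zZ zx; have [k Ik kx] := SI x (hZ z zZ x zx); exists k.
have [k hk] := choice hQ.
have [s [sQ hs]] := @compact_nbhs_cover _ Q (fun x => obox (a (k x)) (b (k x))) cQ
  (fun x Qx => obox_nbhs (proj2 (hk x Qx))).
pose ks := undup [seq k x | x <- s].
have hks j : j \in ks -> I j.
  by rewrite mem_undup => /mapP[x xs ->]; have [] := hk x (sQ x xs).
apply: esum_ge; exists [set` ks]; first by split; [exact: finite_seq|move=> j /hks].
rewrite -fsbig_seq ?undup_uniq // sumEFin lee_fin.
have := @finite_box_cover Z [seq (a j, b j) | j <- ks] uZ.
rewrite big_map /=; apply.
  by move=> p /mapP[j _ ->] i; exact: ab.
move=> z x zZ zx; have [y ys yx] := hs x (ex_intro2 _ _ z zZ zx).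
by exists (a (k y), b (k y)) => //; apply: map_f; rewrite mem_undup map_f.
Qed.

Lemma lebesgue_bounded S (r : R) : (forall x, S x -> `|x| <= r) ->
  (lebesgue_d S < +oo)%E.
Proof.
move=> hS; pose a : E := \row_i (- (`|r| + 1)); pose b : E := \row_i (`|r| + 1).
have ab i : a 0 i <= b 0 i by rewrite !mxE; have := normr_ge0 r; lra.
apply: (@le_lt_trans _ _ (boxvol a b)%:E); last exact: ltry.
apply: ereal_inf_lbound; exists [set 0%N], (fun=> a), (fun=> b); split=> //.
  move=> x /hS xr; exists 0%N => // i.
  have xi : `|x 0 i| <= `|x|.
    rewrite [leRHS]/Num.norm /= mx_normrE.
    exact: (le_bigmax _ (fun ij : 'I_1 * 'I_d => `|x ij.1 ij.2|) (0, i)).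
  rewrite !mxE -ltr_norml (le_lt_trans (le_trans xi xr)) //.
  by rewrite (le_lt_trans (ler_norm r)) // ltrDl.
rewrite esum_set1 // lee_fin; apply: prodr_ge0 => i _; rewrite subr_ge0.
exact: ab.
Qed.

(** Boundedness matters because [fine] would send an infinite outer measure to 0. *)
Lemma cubes_vol S (r : R) (Z : seq 'rV[int]_d) : (forall x, S x -> `|x| <= r) ->
  uniq Z -> (forall z, z \in Z -> cube z `<=` S) -> (size Z)%:R <= vol S.
Proof.
move=> hS uZ hZ; have := cubes_lebesgue uZ hZ; have := lebesgue_bounded hS.
rewrite /vol; case: (lebesgue_d S) => //= x _.
Qed.

End lattice_cubes.

(** * Counting unit cubes along van Hove sequences *)

Section van_Hove_counting.
Variables (R : realType) (d : nat).
Local Notation E := 'rV[R]_d.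
Implicit Types (S : set E) (z : 'rV[int]_d) (x : E).

Lemma rV_norm_le x (r : R) : 0 <= r -> (forall i, `|x 0 i| <= r) -> `|x| <= r.
Proof.
move=> r0 h; rewrite [leLHS]/Num.norm /= mx_normrE; apply: bigmax_le => // -[j i] _ /=.
by rewrite ord1.
Qed.

Definition cball (r : R) : set E := [set x | `|x| <= r].

Lemma compact_cball r : compact (cball r).
Proof.
apply: bounded_closed_compact.
  exists r; split; first exact: num_real.
  by move=> s rs x /= /le_trans; apply; exact: ltW.
apply: (@closed_comp _ _ (fun x : E => `|x|) [set y | y <= r]); last exact: closed_le.
by move=> x _; exact: norm_continuous.
Qed.

Lemma compact_norm_le S : compact S -> exists2 r : R, 0 <= r & forall x, S x -> `|x| <= r.
Proof.
move=> /compact_bounded[M [Mr hM]]; exists (`|M| + 1); first by rewrite addr_ge0.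
by move=> x Sx; apply: hM => //; rewrite (le_lt_trans (ler_norm M)) // ltrDl.
Qed.

Definition zfl x : 'rV[int]_d := \row_i Num.floor (x 0 i).

Lemma cube_zfl x : cube (zfl x) x.
Proof.
by move=> i; rewrite mxE floor_le_tmp /= ltW // -[X in _ + X](mulr1z 1) -rmorphD floorD1_gt.
Qed.

Lemma cube_dist z x y : cube z x -> cube z y -> `|x - y| <= 1.
Proof.
move=> hx hy; apply: rV_norm_le => // i; rewrite !mxE.
have /andP[h1 h2] := hx i; have /andP[h3 h4] := hy i.
by rewrite ler_norml; apply/andP; split; lra.
Qed.

Lemma near_boundary S (r : R) w a y : S a -> `|w - a| <= r -> ~ S y ->
  `|w - y| <= r -> Kboundary (cball r) S w.
Proof.
move=> Sa wa Sy wy; have [Sw|nSw] := pselect (S w).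
  right; split=> //; exists y, (y - w); split; last by rewrite subKr.
    exact: subset_closure.
  by rewrite /cball /= distrC.
left; split; last by move=> /interior_subset.
by exists a, (w - a); split=> //; rewrite addrC subrK.
Qed.

Lemma Kboundary_bounded S (r s : R) : (forall x, S x -> `|x| <= s) ->
  forall x, Kboundary (cball r) S x -> `|x| <= s + `|r|.
Proof.
move=> hS x [[[a [k [Sa Kk ->]]] _]|[_ Sx]].
  by apply: le_trans (ler_normD _ _) _; rewrite lerD ?hS // (le_trans Kk) // ler_norm.
by rewrite (le_trans (hS _ Sx)) // lerDl.
Qed.

(** The extra 1 in the radius is the diameter of a unit cube in the max norm: every point of such a
    cube is within [r + 1] of both [S] and its complement. *)
Lemma cubes_boundary S (r s : R) (Z : seq 'rV[int]_d) :
  (forall x, S x -> `|x| <= s) -> uniq Z -> 0 <= r ->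
  (forall z, z \in Z -> exists x a y, [/\ cube z x, cube z y, ~ S y, S a & `|x - a| <= r]) ->
  (size Z)%:R <= vol (Kboundary (cball (r + 1)) S).
Proof.
move=> hS uZ r0 hZ; apply: (cubes_vol (Kboundary_bounded hS)) => // z zZ w zw.
have [x [a [y [zx zy nSy Sa xa]]]] := hZ z zZ.
apply: (near_boundary Sa _ nSy).
  rewrite -(subrK x w) -addrA addrC; apply: le_trans (ler_normD _ _) _.
  exact: lerD xa (cube_dist zw zx).
by apply: le_trans (cube_dist zw zy) _; rewrite lerDr.
Qed.

(** Cubes contained in [S] are counted by its volume; each other one contains a point outside [S]
    and is a boundary cube. *)
Lemma cubes_near S (r s : R) (Z : seq 'rV[int]_d) :
  (forall x, S x -> `|x| <= s) -> uniq Z -> 0 <= r ->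
  (forall z, z \in Z -> exists x a, [/\ cube z x, S a & `|x - a| <= r]) ->
  (size Z)%:R <= vol S + vol (Kboundary (cball (r + 1)) S).
Proof.
move=> hS uZ r0 hZ; pose P z := `[< cube z `<=` S >].
rewrite -(count_predC P) natrD lerD //; rewrite -size_filter.
  apply: (cubes_vol hS); first exact: filter_uniq.
  by move=> z; rewrite mem_filter => /andP[/asboolP].
apply: (cubes_boundary hS) => //; first exact: filter_uniq.
move=> z; rewrite mem_filter => /andP[/asboolP nzS zZ].
have [x [a [zx Sa xa]]] := hZ z zZ.
have [y [zy nSy]] : exists y, cube z y /\ ~ S y.
  apply: contrapT => ny; apply: nzS => y zy; apply: contrapT => nSy.
  by apply: ny; exists y.
by exists x, a, y.
Qed.

Variable A : nat -> set E.
Hypotheses (avA : averaging_seq A) (vHA : van_Hove A).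

Lemma averaging_mono m n : (m <= n)%N -> A m `<=` A n.
Proof.
case: avA => _ hA _; elim: n => [|n ih]; first by rewrite leqn0 => /eqP ->.
rewrite leq_eqVlt => /orP[/eqP -> //|/ih h] x /h /hA.
exact: interior_subset.
Qed.

Lemma averaging_cover S : compact S -> exists n0, forall n, (n0 <= n)%N -> S `<=` A n.
Proof.
move=> cS; have [_ hA covA] := avA.
have hx (x : E) : exists n, A n x.
  by have [n _ An] : (\bigcup_n A n) x by [rewrite covA]; exists n.
have [k hk] := choice hx.
have [s [_ hs]] := @compact_nbhs_cover _ S (fun x => A (k x).+1) cS
  (fun x _ => hA _ _ (hk x)).
exists (\max_(y <- s) (k y).+1)%N => n hn x /hs[y ys].
by apply: averaging_mono; apply: leq_trans hn; rewrite (big_rem y) //= leq_maxl.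
Qed.

Lemma averaging_vol_ge1 : exists n0, forall n, (n0 <= n)%N -> 1 <= vol (A n).
Proof.
have [n0 hn0] := averaging_cover (@compact_cube R d 0).
exists n0 => n /hn0 h; have [cA _ _] := avA.
have [s s0 hs] := compact_norm_le (cA n).
apply: (@cubes_vol _ _ _ s [:: 0]) => // z; rewrite inE => /eqP ->.
exact: h.
Qed.

Lemma van_Hove_small (r e : R) : 0 < e -> exists n0, forall n, (n0 <= n)%N ->
  1 <= vol (A n) /\ vol (Kboundary (cball r) (A n)) <= e * vol (A n).
Proof.
move=> e0; have [n1 h1] := averaging_vol_ge1.
have /cvgrPdist_le /(_ e e0)[n2 _ h2] := vHA (@compact_cball r).
exists (maxn n1 n2) => n; rewrite geq_max => /andP[/h1 h3 /h2 /=].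
rewrite sub0r normrN => h4; split=> //.
have v0 : 0 < vol (A n) by apply: lt_le_trans h3.
by rewrite -ler_pdivrMr // (le_trans (ler_norm _)).
Qed.

(** The factor 2 is one volume for the inner cubes and one for the boundary cubes, the van Hove
    ratio being eventually at most 1. *)
Lemma near_count (r : R) : 0 <= r -> exists n0, forall n, (n0 <= n)%N ->
  1 <= vol (A n) /\ forall Z : seq 'rV[int]_d, uniq Z ->
  (forall z, z \in Z -> exists x a, [/\ cube z x, A n a & `|x - a| <= r]) ->
  (size Z)%:R <= 2 * vol (A n).
Proof.
move=> r0; have [n0 h0] := van_Hove_small (r + 1) ltr01.
exists n0 => n /h0[v1 hv]; split=> // Z uZ hZ; have [cA _ _] := avA.
have [s s0 hs] := compact_norm_le (cA n).
by have := cubes_near hs uZ r0 hZ; lra.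
Qed.

Lemma boundary_count (r e : R) : 0 <= r -> 0 < e -> exists n0, forall n, (n0 <= n)%N ->
  forall Z : seq 'rV[int]_d, uniq Z ->
  (forall z, z \in Z -> exists x a, [/\ cube z x, ~ A n x, A n a & `|x - a| <= r]) ->
  (size Z)%:R <= e * vol (A n).
Proof.
move=> r0 e0; have [n0 h0] := van_Hove_small (r + 1) e0.
exists n0 => n /h0[v1 hv] Z uZ hZ; have [cA _ _] := avA.
have [s s0 hs] := compact_norm_le (cA n).
apply: le_trans hv; apply: (cubes_boundary hs) => // z /hZ[x [a [zx nx Aa xa]]].
by exists x, a, x.
Qed.

End van_Hove_counting.

(** * Integration against a complex Radon measure *)

Section complex_continuity.
Variables (R : realType).
Local Notation C := R[i].
Local Notation nm := (@ComplexField.Normc.normc R).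
Local Notation rc := (real_complex R).

Lemma cvg0_nm (u : nat -> C) :
  (forall e : R, 0 < e -> exists N, forall n, (N <= n)%N -> nm (u n) <= e) ->
  u @ \oo --> (0 : C).
Proof.
(* Here the tolerance is itself complex; positivity forces its imaginary part to vanish. *)
move=> h; apply/(@cvgrPdist_le _ (R[i])^o) => -[e e'].
rewrite ltcE /= => /andP[/eqP -> e0]; have [N hN] := h e e0.
exists N => // n /= /hN h1; rewrite sub0r normrN normc_def lecE /= eqxx /=.
by move: h1; case: (u n).
Qed.

Lemma nm_cvg0 (u : nat -> C) (e : R) : u @ \oo --> (0 : C) -> 0 < e ->
  exists N, forall n, (N <= n)%N -> nm (u n) <= e.
Proof.
move=> /(@cvgrPdist_le _ (R[i])^o)/(_ (rc e)) h e0.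
have := h; rewrite ltcR => /(_ e0)[N _ hN]; exists N => n /hN /=.
by rewrite sub0r normrN normc_def lecR; case: (u n).
Qed.

Definition ccont (T : topologicalType) (g : T -> C) :=
  forall x (e : R), 0 < e -> \forall y \near x, nm (g y - g x) <= e.

Lemma continuous_ccont (T : topologicalType) (g : T -> C) : continuous g -> ccont g.
Proof.
move=> cg x e e0; have cgx : g @ x --> g x := cg x.
have /(_ _ (rc e)) := proj1 (@cvgrPdist_le _ (R[i])^o _ _ _ g (g x)) cgx.
rewrite ltcR => /(_ e0); apply: filterS => y.
by rewrite -normrN opprB normc_def lecR; case: (g y - g x).
Qed.

Lemma ccont_Re (T : topologicalType) (g : T -> C) : ccont g ->
  continuous (fun x => complex.Re (g x)).
Proof.
move=> cg x; apply/cvgrPdist_le => e e0; have := cg x e e0.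
apply: filterS => y; rewrite distrC -ReN -ReD.
exact: le_trans (le_Re_nm _).
Qed.

Lemma ccont_Im (T : topologicalType) (g : T -> C) : ccont g ->
  continuous (fun x => complex.Im (g x)).
Proof.
move=> cg x; apply/cvgrPdist_le => e e0; have := cg x e e0.
apply: filterS => y; rewrite distrC -ImN -ImD.
exact: le_trans (le_Im_nm _).
Qed.

Lemma ccont_cst (T : topologicalType) (c : C) : ccont (fun _ : T => c).
Proof. by move=> x e e0; apply: nearW => y; rewrite subrr nm0 ltW. Qed.

Lemma ccontD (T : topologicalType) (f g : T -> C) : ccont f -> ccont g ->
  ccont (fun x => f x + g x).
Proof.
move=> cf cg x e e0; have e2 : 0 < e / 2 by lra.
have hf := cf x _ e2; have hg := cg x _ e2; near=> y.
have h1 : nm (f y - f x) <= e / 2 by near: y.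
have h2 : nm (g y - g x) <= e / 2 by near: y.
rewrite opprD addrACA (le_trans (nmD _ _)) //.
by have := lerD h1 h2; rewrite -splitr.
Unshelve. all: by end_near. Qed.

Lemma ccontZ (T : topologicalType) (a : C) (f : T -> C) : ccont f ->
  ccont (fun x => a * f x).
Proof.
move=> cf x e e0; have a0 : 0 < nm a + 1 by rewrite ltr_wpDl // nm_ge0.
have := cf x _ (divr_gt0 e0 a0); apply: filterS => y.
rewrite ler_pdivlMr // => h; rewrite -mulrBr nmM mulrC; apply: le_trans h.
by rewrite ler_wpM2l ?nm_ge0 // lerDl.
Qed.

Lemma ccont_sum (T : topologicalType) (I : Type) (s : seq I) (F : I -> T -> C) :
  (forall i, ccont (F i)) -> ccont (fun x => \sum_(i <- s) F i x).
Proof.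
move=> hF; elim: s => [|i s ih].
  have := @ccont_cst T 0; congr ccont; apply/funext => x; by rewrite big_nil.
have := ccontD (hF i) ih; congr ccont; apply/funext => x.
by rewrite big_cons.
Qed.

Lemma ccont_bounded (T : topologicalType) (K : set T) (g : T -> C) :
  compact K -> ccont g -> exists2 c : R, 0 <= c & forall x, K x -> nm (g x) <= c.
Proof.
move=> cK cg.
have [s [_ hs]] := @compact_nbhs_cover _ K (fun x y => nm (g y - g x) <= 1) cK
  (fun x _ => cg x 1 ltr01).
exists (\sum_(y <- s) nm (g y) + 1).
  by rewrite addr_ge0 // sumr_ge0 // => y _; exact: nm_ge0.
move=> x /hs[y ys h]; rewrite -(subrK (g y) (g x)) addrC (le_trans (nmD _ _)) //.
rewrite lerD // (big_rem y) //= lerDl sumr_ge0 // => z _; exact: nm_ge0.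
Qed.

End complex_continuity.

Lemma open_borel (T : ptopologicalType) (U : set T) : open U ->
  measurable (U : set (borel T)).
Proof. by move=> oU; exact: sub_gen_smallest. Qed.

Lemma closed_borel (T : ptopologicalType) (U : set T) : closed U ->
  measurable (U : set (borel T)).
Proof.
by move/closed_openC/open_borel/measurableC; rewrite setCK.
Qed.

Lemma continuous_borel (R : realType) (T : ptopologicalType) (f : T -> R)
  (D : set (borel T)) : measurable D -> continuous f ->
  measurable_fun D (f : borel T -> R).
Proof.
move=> mD /continuousP cf; apply: (measurability _ (measurable_realfun.RGenOInfty.measurableE R)).
move=> _ [_ [a ->] <-]; apply: measurableI => //.
by apply: open_borel; apply: cf; exact: interval_open.
Qed.

Section one_part.
Variables (R : realType) (T : ptopologicalType).
Local Notation C := R[i].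
Local Notation nm := (@ComplexField.Normc.normc R).
Local Notation rc := (real_complex R).
Variable nu : {measure set (borel T) -> \bar R}.
Implicit Types (D : set (borel T)) (g h : T -> C).

Definition intg D g :=
  nu.-integrable D (EFin \o (fun x : borel T => complex.Re (g x))) /\
  nu.-integrable D (EFin \o (fun x : borel T => complex.Im (g x))).

Definition pint D g : C :=
  Complex (Rintegral nu D (fun x : borel T => complex.Re (g x)))
          (Rintegral nu D (fun x : borel T => complex.Im (g x))).

Lemma ccont_intg (A : set T) D g (c : R) : measurable D -> D `<=` A -> (nu D < +oo)%E ->
  ccont g -> (forall x, A x -> nm (g x) <= c) -> intg D g.
Proof.
move=> mD DA nuD cg hc; split; apply: measurable_bounded_integrable => //.
- by apply: continuous_borel => //; exact: ccont_Re.
- exists c; split; first exact: num_real.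
  move=> M cM x Dx /=; apply: le_trans (le_Re_nm _) _.
  by apply: le_trans (hc _ (DA _ Dx)) _; exact: ltW.
- by apply: continuous_borel => //; exact: ccont_Im.
- exists c; split; first exact: num_real.
  move=> M cM x Dx /=; apply: le_trans (le_Im_nm _) _.
  by apply: le_trans (hc _ (DA _ Dx)) _; exact: ltW.
Qed.

Lemma eq_pint D g h : (forall x, D x -> g x = h x) -> pint D g = pint D h.
Proof.
move=> e; congr Complex; apply: eq_Rintegral => x /set_mem Dx; by rewrite e.
Qed.

Lemma pintD D g h : measurable D -> intg D g -> intg D h ->
  pint D (fun x => g x + h x) = pint D g + pint D h.
Proof.
move=> mD [g1 g2] [h1 h2]; rewrite /pint /=.
apply/eqP; rewrite eq_complex /= -!RintegralD //; apply/andP; split; apply/eqP.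
  by apply: eq_Rintegral => x _; rewrite ReD.
by apply: eq_Rintegral => x _; rewrite ImD.
Qed.

Lemma integrableZ D (f : borel T -> R) (r : R) : measurable D ->
  nu.-integrable D (EFin \o f) -> nu.-integrable D (EFin \o (fun x => r * f x)).
Proof. by move=> mD /(integrableZl mD r). Qed.

Lemma pintZ D (a : C) g : measurable D -> intg D g ->
  pint D (fun x => a * g x) = a * pint D g.
Proof.
case: a => a b mD [g1 g2]; rewrite /pint.
apply/eqP; rewrite eq_complex /= -!RintegralZl //.
have E1 := integrableZ a mD g1; have E2 := integrableZ b mD g1.
have E3 := integrableZ a mD g2; have E4 := integrableZ b mD g2.
rewrite -RintegralB // -RintegralD //; apply/andP; split; apply/eqP.
  by apply: eq_Rintegral => x _; case: (g x).
by apply: eq_Rintegral => x _; case: (g x).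
Qed.

Lemma pint_setU D1 D2 g : measurable D1 -> measurable D2 -> intg (D1 `|` D2) g ->
  D1 `&` D2 = set0 -> pint (D1 `|` D2) g = pint D1 g + pint D2 g.
Proof.
move=> m1 m2 [g1 g2] /eqP d12; have {}d12 : [disjoint D1 & D2] by apply/disj_setPS; rewrite (eqP d12).
by rewrite /pint !Rintegral_setU.
Qed.

(** The factor 2 comes from estimating real and imaginary parts separately. *)
Lemma pint_near D g (v : C) (e : R) : measurable D -> (nu D < +oo)%E ->
  intg D g -> (forall x, D x -> nm (g x - v) <= e) ->
  nm (pint D g - v * rc (fine (nu D))) <= 2 * e * fine (nu D).
Proof.
move=> mD nuD [g1 g2] hv.
have key (f : borel T -> R) (r : R) : nu.-integrable D (EFin \o f) ->
    (forall x, D x -> `|f x - r| <= e) ->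
    `|Rintegral nu D f - r * fine (nu D)| <= e * fine (nu D).
  move=> hf h; rewrite -Rintegral_cst //.
  have hcst (s : R) : nu.-integrable D (EFin \o (fun _ : borel T => s)).
    apply: measurable_bounded_integrable => //.
    by exists `|s|; split; [exact: num_real|move=> M sM x _ /=; exact: ltW].
  rewrite -RintegralB //.
  apply: le_trans (le_normr_Rintegral mD _) _.
    have := integrableB mD hf (hcst r); congr (nu.-integrable D _).
  rewrite -(Rintegral_cst nu mD e); apply: le_Rintegral => //.
  have := integrableB mD hf (hcst r) => /integrable_norm.
  by congr (nu.-integrable D _).
apply: le_trans (nm_le_ReIm _) _; rewrite /pint ReD ReN ImD ImN.
have -> : complex.Re (v * rc (fine (nu D))) = complex.Re v * fine (nu D).
  by case: (v) => a b /=; rewrite mulr0 subr0.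
have -> : complex.Im (v * rc (fine (nu D))) = complex.Im v * fine (nu D).
  by case: (v) => a b /=; rewrite mulr0 add0r.
rewrite (_ : 2 * e * fine (nu D) = e * fine (nu D) + e * fine (nu D)); last by ring.
apply: lerD; apply: key => // x Dx.
  by rewrite -ReN -ReD (le_trans (le_Re_nm _)) // hv.
by rewrite -ImN -ImD (le_trans (le_Im_nm _)) // hv.
Qed.

End one_part.

Section complex_radon.
Variables (R : realType) (d : nat).
Local Notation E := 'rV[R]_d.
Local Notation C := R[i].
Local Notation nm := (@ComplexField.Normc.normc R).
Local Notation rc := (real_complex R).
Variable mu : cradon R d.
Implicit Types (D : set (borel E)) (g h : E -> C) (A : set E).

Definition bborel D := measurable D /\ exists2 A, compact A & D `<=` A.

Lemma bborel_lt D j : bborel D -> (cr_part mu j D < +oo)%E.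
Proof.
case=> mD [A cA DA]; apply: le_lt_trans (cr_locfin mu j cA).
apply: le_measure; rewrite ?inE //; apply: closed_borel.
by apply: compact_closed cA; exact: norm_hausdorff.
Qed.

Lemma bborel_intg D g j : bborel D -> ccont g -> intg (cr_part mu j) D g.
Proof.
move=> bD cg; have [mD [A cA DA]] := bD.
have [c _ hc] := ccont_bounded cA cg.
exact: (ccont_intg mD DA (bborel_lt j bD) cg hc).
Qed.

Lemma bborelS D D' : bborel D -> measurable D' -> D' `<=` D -> bborel D'.
Proof.
by move=> [_ [A cA DA]] mD' sD; split=> //; exists A => // x /sD /DA.
Qed.

Lemma compact_bborel A : compact A -> bborel A.
Proof.
move=> cA; split; last by exists A.
by apply: closed_borel; apply: compact_closed cA; exact: norm_hausdorff.
Qed.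

Lemma cintE D g : cint mu D g =
  pint (cr_part mu 0) D g - pint (cr_part mu 1) D g +
  Complex 0 1 * (pint (cr_part mu 2) D g - pint (cr_part mu 3) D g).
Proof. by rewrite /cint -complexiE. Qed.

Lemma eq_cint D g h : (forall x, D x -> g x = h x) -> cint mu D g = cint mu D h.
Proof. by move=> e; rewrite !cintE !(@eq_pint _ _ _ D g h). Qed.

Lemma cintD D g h : bborel D -> ccont g -> ccont h ->
  cint mu D (fun x => g x + h x) = cint mu D g + cint mu D h.
Proof.
move=> bD cg ch; have [mD _] := bD.
rewrite !cintE !pintD //; try exact: bborel_intg.
by ring.
Qed.

Lemma cintZ D (a : C) g : bborel D -> ccont g ->
  cint mu D (fun x => a * g x) = a * cint mu D g.
Proof.
move=> bD cg; have [mD _] := bD.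
rewrite !cintE !pintZ //; try exact: bborel_intg.
by ring.
Qed.

Lemma cint0 D : bborel D -> cint mu D (fun=> 0) = 0.
Proof.
move=> bD; transitivity (cint mu D (fun x => 0 * (fun _ : E => 0 : C) x)).
  by apply: eq_cint => x _; rewrite mul0r.
by rewrite (cintZ 0 bD (@ccont_cst R E 0)) mul0r.
Qed.

Lemma cint_sum D (I : Type) (s : seq I) (F : I -> E -> C) : bborel D ->
  (forall i, ccont (F i)) ->
  cint mu D (fun x => \sum_(i <- s) F i x) = \sum_(i <- s) cint mu D (F i).
Proof.
move=> bD cF; elim: s => [|i s ih].
  by rewrite big_nil -[RHS](cint0 bD); apply: eq_cint => x _; rewrite big_nil.
rewrite big_cons -ih -cintD //; last exact: ccont_sum.
by apply: eq_cint => x _; rewrite big_cons.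
Qed.

Lemma cint_setU D1 D2 g : bborel (D1 `|` D2) -> measurable D1 -> measurable D2 ->
  ccont g -> D1 `&` D2 = set0 ->
  cint mu (D1 `|` D2) g = cint mu D1 g + cint mu D2 g.
Proof.
move=> bD m1 m2 cg d12; rewrite !cintE !pint_setU //; try exact: bborel_intg.
by ring.
Qed.

Lemma cint_split D D' g : bborel D -> measurable D' -> ccont g ->
  cint mu D g = cint mu (D `&` D') g + cint mu (D `\` D') g.
Proof.
move=> bD mD' cg; have [mD _] := bD.
rewrite -cint_setU //.
- by rewrite setUIDK.
- by rewrite setUIDK.
- exact: measurableI.
- exact: measurableD.
- by apply/seteqP; split=> x //= -[[_ D'x] [_ /(_ D'x)]].
Qed.

(** The four parts need not be mutually singular, so [mass] is not controlled by [ctotvar]. Only its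
    finiteness matters: it multiplies errors that are sent to 0. *)
Definition mass D : R := \sum_(j < 4) fine (cr_part mu j D).

Lemma mass_ge0 D : 0 <= mass D.
Proof. by apply: sumr_ge0 => j _; exact: fine_ge0. Qed.

Lemma cmeasE D : cmeas mu D =
  rc (fine (cr_part mu 0 D)) - rc (fine (cr_part mu 1 D)) +
  Complex 0 1 * (rc (fine (cr_part mu 2 D)) - rc (fine (cr_part mu 3 D))).
Proof.
apply/eqP; rewrite eq_complex; apply/andP; split; apply/eqP => /=; ring.
Qed.

Lemma cint_near D g (v : C) (e : R) : bborel D -> ccont g ->
  (forall x, D x -> nm (g x - v) <= e) ->
  nm (cint mu D g - v * cmeas mu D) <= 2 * e * mass D.
Proof.
move=> bD cg hv; have [mD _] := bD.
have h j := pint_near mD (bborel_lt j bD) (bborel_intg j bD cg) hv.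
rewrite cintE cmeasE /mass !big_ord_recr big_ord0 /= add0r.
have o j k (jk : j = k :> 'I_4) : cr_part mu j = cr_part mu k by rewrite jk.
rewrite (o (widen_ord _ (widen_ord _ (widen_ord _ ord_max))) 0); last exact/val_inj.
rewrite (o (widen_ord _ (widen_ord _ ord_max)) 1); last exact/val_inj.
rewrite (o (widen_ord _ ord_max) 2); last exact/val_inj.
rewrite (o ord_max 3); last exact/val_inj.
move: (h 0) (h 1) (h 2) (h 3).
move: (pint _ _ _) (pint _ _ _) (pint _ _ _) (pint _ _ _) => p3 p2 p1 p0.
move: (fine _) (fine _) (fine _) (fine _) => f3 f2 f1 f0 h0 h1 h2 h3.
rewrite (_ : _ - _ = (p0 - v * rc f0) - (p1 - v * rc f1) +
  Complex 0 1 * ((p2 - v * rc f2) - (p3 - v * rc f3))); last by ring.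
apply: le_trans (nmD _ _) _; rewrite nmM nm_i mul1r.
have := nmB (p0 - v * rc f0) (p1 - v * rc f1).
have := nmB (p2 - v * rc f2) (p3 - v * rc f3).
move: h0 h1 h2 h3; rewrite !mulrDr; lra.
Qed.

Lemma mass_setU D1 D2 : bborel (D1 `|` D2) -> measurable D1 -> measurable D2 ->
  D1 `&` D2 = set0 -> mass (D1 `|` D2) = mass D1 + mass D2.
Proof.
move=> bD m1 m2 d12; rewrite /mass -big_split; apply: eq_bigr => j _ /=.
have b1 : bborel D1 by apply: bborelS bD m1 _; exact: subsetUl.
have b2 : bborel D2 by apply: bborelS bD m2 _; exact: subsetUr.
by rewrite measureU // fineD // ge0_fin_numE // bborel_lt.
Qed.

Lemma ctotvar_ge0 D : measurable D -> (0 <= ctotvar mu D)%E.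
Proof.
move=> mD; apply: (@le_trans _ _ (\sum_(j < 1) nm (cmeas mu D))%:E).
  by rewrite lee_fin sumr_ge0 // => j _; exact: nm_ge0.
apply: ereal_sup_ubound; exists 1%N, (fun=> D); split=> //.
  by move=> j k; rewrite !ord1 eqxx.
by apply/seteqP; split=> x; [case=> i _|exists ord0].
Qed.

Lemma ctotvar_add D1 D2 : measurable D2 -> D1 `&` D2 = set0 ->
  (ctotvar mu D1 + (nm (cmeas mu D2))%:E <= ctotvar mu (D1 `|` D2))%E.
Proof.
move=> m2 d12; rewrite -leeBrDr //; apply: ge_ereal_sup => _ [m [P [mP dP uP ->]]].
rewrite leeBrDr // -EFinD; apply: ereal_sup_ubound.
pose Q (j : 'I_m.+1) := if unlift ord_max j is Some i then P i else D2.
have QE i : Q (lift ord_max i) = P i by rewrite /Q liftK.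
have Qm : Q ord_max = D2 by rewrite /Q unlift_none.
have PD2 i : P i `&` D2 = set0.
  by apply/seteqP; split=> x // [Px D2x]; rewrite -d12 -uP; split=> //; exists i.
exists m.+1, Q; split.
- by move=> j; rewrite /Q; case: unliftP.
- move=> j k; case: (unliftP ord_max j) => [j' ->|->]; case: (unliftP ord_max k) => [k' ->|->].
  + by rewrite !QE (inj_eq lift_inj); exact: dP.
  + by rewrite QE Qm.
  + by rewrite QE Qm setIC.
  + by rewrite eqxx.
- apply/seteqP; split=> x.
    case=> j _; case: (unliftP ord_max j) => [i ->|->]; rewrite ?QE ?Qm; last by right.
    by move=> Px; left; rewrite -uP; exists i.
  case=> [|D2x]; last by exists ord_max; rewrite ?Qm.
  by rewrite -uP => -[i _ Px]; exists (lift ord_max i); rewrite ?QE.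
- rewrite big_ord_recr /= Qm; congr (_ + _)%:E; apply: eq_bigr => i _.
  congr (nm (cmeas mu _)); rewrite -QE; congr Q.
  by apply/val_inj; rewrite /= /bump leqNgt ltn_ord.
Qed.

(** Induction over the centres: on the cell where [g] is within [e] of [g y], the integral is nearly
    [g y] times the measure of the cell, and by [ctotvar_add] the modulus of that measure is
    deducted from the total variation left for the rest. *)
Lemma cint_partition (g : E -> C) (c e : R) (s : seq E) (D : set (borel E)) (m : R) :
  ccont g -> 0 <= c -> (forall y, y \in s -> nm (g y) <= c) -> bborel D ->
  (forall x, D x -> exists2 y, y \in s & nm (g x - g y) < e) ->
  (ctotvar mu D <= m%:E)%E -> nm (cint mu D g) <= c * m + 2 * e * mass D.
Proof.
move=> cg c0; elim: s D m => [|y s ih] D m hs bD hD hm.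
  have D0 : D = set0 by apply/seteqP; split=> x // /hD[].
  have [mD _] := bD; have m0 : 0 <= m by rewrite -lee_fin (le_trans (ctotvar_ge0 mD)).
  have -> : mass D = 0 by rewrite D0 /mass big1 // => j _; rewrite measure0.
  rewrite mulr0 addr0.
  have -> : cint mu D g = 0 by rewrite -[RHS](cint0 bD); apply: eq_cint; rewrite D0.
  by rewrite nm0 mulr_ge0.
have [mD _] := bD.
pose O : set (borel E) := [set x | nm (g x - g y) < e].
have mO : measurable O.
  apply: open_borel; rewrite openE => x; rewrite /O /= => hx.
  have e' : 0 < (e - nm (g x - g y)) / 2 by rewrite divr_gt0 // subr_gt0.
  have := cg x _ e'; apply: filterS => z hz.
  by have := nm_tri (g x) (g z) (g y); move: hz e'; rewrite /=; lra.
have m1 : measurable (D `&` O) by exact: measurableI.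
have m2 : measurable (D `\` O) by exact: measurableD.
have DE : (D `\` O) `|` (D `&` O) = D by rewrite setUC setUIDK.
have dis : (D `\` O) `&` (D `&` O) = set0.
  by apply/seteqP; split=> x //= -[[_ nO] [_ /nO]].
have b1 : bborel (D `&` O) by apply: bborelS bD m1 _ => x [].
have b2 : bborel (D `\` O) by apply: bborelS bD m2 _ => x [].
have h1 : nm (cint mu (D `&` O) g) <= c * nm (cmeas mu (D `&` O)) + 2 * e * mass (D `&` O).
  have h := @cint_near (D `&` O) g (g y) e b1 cg _.
  have {}h : nm (cint mu (D `&` O) g - g y * cmeas mu (D `&` O)) <= 2 * e * mass (D `&` O).
    by apply: h => x [_ Ox]; exact: ltW.
  have := nm_tri (g y * cmeas mu (D `&` O)) (cint mu (D `&` O) g) 0.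
  rewrite !subr0 nmM => /le_trans; apply; rewrite addrC lerD //.
  by rewrite ler_wpM2r ?nm_ge0 // hs // mem_head.
have h2 : nm (cint mu (D `\` O) g) <= c * (m - nm (cmeas mu (D `&` O))) + 2 * e * mass (D `\` O).
  apply: ih => //.
  - by move=> z zs; apply: hs; rewrite inE zs orbT.
  - move=> x [Dx nOx]; have [z] := hD x Dx; rewrite inE => /orP[/eqP ->|zs h].
      by move=> /nOx.
    by exists z.
  - rewrite EFinB leeBrDr //; apply: le_trans hm; rewrite -[X in (_ <= ctotvar mu X)%E]DE.
    exact: ctotvar_add.
rewrite -[in mass D]DE mass_setU ?DE // -[in cint mu D]DE cint_setU ?DE //.
apply: le_trans (nmD _ _) _; have := lerD h2 h1; rewrite !mulrDr mulrN; lra.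
Qed.

(** Limit of [cint_partition] as the cells shrink. Compactness of [A] supplies finitely many
    centres, and the total variation passes from [B] to [D] by [ctotvar_add]. *)
Lemma cint_small (B A : set E) (D : set (borel E)) g (c M : R) : compact A ->
  compact B -> (ctotvar mu B <= M%:E)%E -> ccont g -> 0 <= c ->
  (forall x, A x -> nm (g x) <= c) -> measurable D -> D `<=` A -> D `<=` B ->
  nm (cint mu D g) <= c * M.
Proof.
move=> cA cB hM cg c0 hc mD DA DB.
have bD : bborel D by split=> //; exists A.
have [mB _] := compact_bborel cB.
have DM : (ctotvar mu D <= M%:E)%E.
  apply: le_trans hM; have BE : D `|` (B `\` D) = B.
    apply/seteqP; split=> [x [/DB //|[]] //|x Bx].
    by have [Dx|nDx] := pselect (D x); [left|right].
  have mBD : measurable ((B : set (borel E)) `\` D) by exact: measurableD.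
  rewrite -[X in (_ <= ctotvar mu X)%E]BE; apply: le_trans (ctotvar_add mBD _).
    by rewrite leeDl // lee_fin nm_ge0.
  by apply/seteqP; split=> x //= -[Dx [_ /(_ Dx)]].
apply/ler_addgt0Pr => e e0.
have k0 : 0 < 2 * (mass D + 1) by have := mass_ge0 D; lra.
have e1 : 0 < e / (2 * (mass D + 1)) by exact: divr_gt0.
have e2 : 0 < e / (2 * (mass D + 1)) / 2 by lra.
have [s [sA hs]] := @compact_nbhs_cover _ A
  (fun x y => nm (g y - g x) <= e / (2 * (mass D + 1)) / 2) cA (fun x _ => cg x _ e2).
have := @cint_partition g c (e / (2 * (mass D + 1))) s D M cg c0
  (fun y ys => hc y (sA y ys)) bD.
move=> /(_ _ DM) H; apply: le_trans (H _) _.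
  by move=> x /DA /hs[y ys h]; exists y => //; lra.
rewrite lerD2l; set t := mass D; have t0 : 0 <= t by exact: mass_ge0.
have -> : 2 * (e / (2 * (t + 1))) * t = e * (t / (t + 1)).
  by field; apply/lt0r_neq0; lra.
rewrite ger_pMr // ler_pdivrMr; lra.
Qed.

(** The translates of [K] are cut off from [D] one at a time, each piece costing [c * M]; [g]
    vanishes on what remains. *)
Lemma cint_bound (A K : set E) (D : set (borel E)) g (c M : R) (ts : seq E) : compact A ->
  compact K -> (forall t : E, (ctotvar mu [set (t + x)%R | x in K] <= M%:E)%E) ->
  ccont g -> 0 <= c -> (forall x, A x -> nm (g x) <= c) -> measurable D -> D `<=` A ->
  (forall x, D x -> g x <> 0 -> exists2 t, t \in ts & [set (t + x)%R | x in K] x) ->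
  nm (cint mu D g) <= (size ts)%:R * (c * M).
Proof.
move=> cA cK hM cg c0 hc; elim: ts D => [|t ts ih] D mD DA hD.
  have bD : bborel D by split=> //; exists A.
  rewrite mul0r (_ : cint mu D g = 0) ?nm0 //.
  rewrite -[RHS](cint0 bD); apply: eq_cint => x Dx.
  by apply: contrapT => /(hD x Dx)[].
have cB : compact [set (t + x)%R | x in K].
  apply: (@continuous_compact _ _ (fun x : E => t + x)) => //.
  apply: continuous_subspaceT => x.
  exact: (@cvgD _ E _ (nbhs x) _ (fun=> t) id t x (cvg_cst t) cvg_id).
have bD : bborel D by split=> //; exists A.
have [mB _] := compact_bborel cB.
rewrite (cint_split bD mB cg) -natr1 mulrDl mul1r addrC.
apply: le_trans (nmD _ _) _; apply: lerD.
  apply: ih.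
  - exact: measurableD.
  - by move=> x [/DA].
  - move=> x [Dx nBx] gx; have [z] := hD x Dx gx.
    by rewrite inE => /orP[/eqP ->|zs zx]; [move=> /nBx|exists z].
apply: (@cint_small [set (t + x)%R | x in K] A) => //.
- exact: measurableI.
- by move=> x [Dx _]; exact: DA.
Qed.

End complex_radon.

(** * Uniform bounds for translation-bounded measures *)

Section translation_bounded_means.
Variables (R : realType) (d : nat).
Local Notation E := 'rV[R]_d.
Local Notation C := R[i].
Local Notation nm := (@ComplexField.Normc.normc R).
Local Notation rc := (real_complex R).
Variables (mu : cradon R d) (A : nat -> set E).
Hypotheses (tb : translation_bounded mu) (avA : averaging_seq A) (vHA : van_Hove A).

Lemma nbhs_shift (x a : E) (B : set E) : nbhs a B -> nbhs x (fun y => B (y - x + a)).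
Proof.
move=> hB; have h : (fun y : E => y + (a - x)) @ x --> a.
  have e : a = x + (a - x) by rewrite addrC subrK.
  rewrite [X in _ --> X]e.
  exact: (@cvgD _ E _ (nbhs x) _ id (fun=> a - x) x (a - x) cvg_id (cvg_cst _)).
have sub : (fun y : E => y + (a - x)) @^-1` B `<=` (fun y => B (y - x + a)).
  by move=> y /=; rewrite addrA addrAC.
exact: (@filterS _ (nbhs x) _ _ _ sub (h _ hB)).
Qed.

Lemma ball_cover (K : set E) (r : R) : interior K !=set0 ->
  exists ts : seq E, forall x, `|x| <= r ->
    exists2 t, t \in ts & [set (t + k)%R | k in K] x.
Proof.
move=> [k0 hk0].
have [s [_ hs]] := @compact_nbhs_cover _ _ (fun x y : E => K (y - x + k0))
  (@compact_cball R d r) (fun x _ => nbhs_shift x hk0).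
exists [seq y - k0 | y <- s] => x /hs[y ys h]; exists (y - k0); first exact: map_f.
by exists (x - y + k0) => //; rewrite [x - y + k0]addrC addrA subrK addrC subrK.
Qed.

Lemma nbhs_cball (x : E) : nbhs x (fun y => `|y - x| <= 1).
Proof.
have := @nbhsx_ballx R E x 1 ltr01; apply: filterS => y.
by rewrite -ball_normE /= distrC => /ltW.
Qed.

(** At most [2 vol (A n)] unit cubes are needed to reach [A n], and the neighbourhood of each is
    covered by a fixed number of translates of [K]. *)
Lemma cint_vol_bound : exists2 c1 : R, 0 <= c1 & exists n0, forall n, (n0 <= n)%N ->
  1 <= vol (A n) /\ forall g (c : R), ccont g -> 0 <= c ->
  (forall x, A n x -> nm (g x) <= c) -> nm (cint mu (A n) g) <= c1 * c * vol (A n).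
Proof.
have [K [cK iK [M hM]]] := tb; have [cA _ _] := avA.
have M0 : 0 <= M.
  have mK : measurable ([set (0 + x)%R | x in K] : set (borel E)).
    rewrite (_ : [set _ | _ in _] = K); first by have [] := compact_bborel cK.
    apply/seteqP; split=> [x [y Ky <-]|x Kx]; first by rewrite add0r.
    by exists x; rewrite ?add0r.
  by rewrite -lee_fin (le_trans (ctotvar_ge0 mu mK)).
(* Radius 2: a point of [A n] is within 1 of some centre, which is within 1 of the corner of its
   cube. *)
have [ts0 hts0] := ball_cover 2 iK; have [n0 hn0] := near_count avA vHA (lexx 0).
exists (2 * (size ts0)%:R * M); first by rewrite !mulr_ge0.
exists n0 => n /hn0[v1 hZ]; split=> // g c cg c0 hc.
have [s [sA hs]] := @compact_nbhs_cover _ (A n) (fun x y => `|y - x| <= 1) (cA n)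
  (fun x _ => nbhs_cball x).
pose Z := undup [seq zfl y | y <- s].
pose p (z : 'rV[int]_d) : E := \row_i (z 0 i)%:~R.
have szZ : (size Z)%:R <= 2 * vol (A n).
  apply: hZ; first exact: undup_uniq.
  move=> z; rewrite mem_undup => /mapP[y ys ->]; exists y, y; split.
  - exact: cube_zfl.
  - exact: sA.
  - by rewrite subrr normr0.
have cp z : cube z (p z) by move=> i; rewrite mxE lexx lerDl ler01.
have [mA _] := compact_bborel (cA n).
have := @cint_bound _ _ mu (A n) K (A n) g c M [seq p z + t | z <- Z, t <- ts0]
  (cA n) cK hM cg c0 hc mA (@subset_refl _ _).
rewrite size_allpairs natrM => H; apply: le_trans (H _) _.
  move=> x Ax _; have [y ys xy] := hs x Ax.
  have := hts0 (x - p (zfl y)); case.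
    rewrite -(subrK y x) -addrA (le_trans (ler_normD _ _)) //.
    by have := cube_dist (cube_zfl y) (cp (zfl y)); lra.
  move=> t tts [k Kk e]; exists (p (zfl y) + t).
    by apply: allpairs_f => //; rewrite mem_undup map_f.
  by exists k => //; rewrite -addrA e addrC subrK.
have : (size Z)%:R * ((size ts0)%:R * (c * M)) <= 2 * vol (A n) * ((size ts0)%:R * (c * M)).
  by rewrite ler_wpM2r // !mulr_ge0.
by rewrite [X in X <= _]mulrA => /le_trans; apply; rewrite le_eqVlt; apply/orP; left; apply/eqP; ring.
Qed.

Lemma compact_support_bound (f : E -> C) (r : R) : ccont f ->
  (forall x, r < `|x| -> f x = 0) -> exists2 c, 0 <= c & forall x, nm (f x) <= c.
Proof.
move=> cf hf; have [c c0 hc] := ccont_bounded (@compact_cball R d r) cf.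
exists c => // x; have [xr|xr] := leP (`|x|) r; first exact: hc.
by rewrite hf // nm0.
Qed.

Lemma ccont_shift (f : E -> C) (y : E) : ccont f -> ccont (fun x : E => f (x + y)).
Proof.
move=> cf x e e0; have h : (fun z : E => z + y) @ x --> x + y.
  exact: (@cvgD _ E _ (nbhs x) _ id (fun=> y) x y cvg_id (cvg_cst _)).
by have := h _ (cf (x + y) e e0).
Qed.

(** The support of a translate lies in a ball of fixed radius, covered by a number of translates of
    [K] that depends on neither [n] nor [y]. *)
Lemma cint_translate_bound (f : E -> C) (r : R) : ccont f ->
  (forall x, r < `|x| -> f x = 0) ->
  exists2 c1 : R, 0 <= c1 & forall n (y : E), nm (cint mu (A n) (fun x : E => f (x + y))) <= c1.
Proof.
move=> cf hf; have [c c0 hc] := compact_support_bound cf hf.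
have [K [cK iK [M hM]]] := tb; have [cA _ _] := avA.
have [ts0 hts0] := ball_cover r iK.
have key n (y : E) : nm (cint mu (A n) (fun x : E => f (x + y))) <= (size ts0)%:R * (c * M).
  have [mA _] := compact_bborel (cA n).
  have := @cint_bound _ _ mu (A n) K (A n) (fun x : E => f (x + y)) c M
    [seq t - y | t <- ts0] (cA n) cK hM (ccont_shift y cf) c0 (fun x _ => hc _) mA
    (@subset_refl _ _).
  rewrite size_map; apply=> x _ fx.
  have [|t tts [k Kk e]] := hts0 (x + y).
    by rewrite leNgt; apply/negP => /hf.
  exists (t - y); first exact: map_f.
  by exists k => //; rewrite addrAC e addrK.
exists ((size ts0)%:R * (c * M)); last exact: key.
by apply: le_trans (key 0%N 0); exact: nm_ge0.
Qed.

End translation_bounded_means.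

(** * Measures with null Fourier-Bohr spectrum *)

Section ultralimits.
Variable R : realType.
Local Notation C := R[i].
Local Notation nm := (@ComplexField.Normc.normc R).
Variables (F : set_system nat).
Hypothesis UF : UltraFilter F.

Let PF : ProperFilter F := @ultra_proper _ _ UF.
Let FF : Filter F := @filter_filter _ _ PF.

Definition ulim (u : nat -> C) (l : C) := forall e : R, 0 < e ->
  F [set n | nm (u n - l) <= e].

(** Compactness of the interval gives a cluster point, and along an ultrafilter a cluster point is a
    limit. *)
Lemma real_ulim (u : nat -> R) (B : R) : F [set n | `|u n| <= B] ->
  exists l : R, forall e : R, 0 < e -> F [set n | `|u n - l| <= e].
Proof.
move=> hB; have cB : compact `[- B, B]%classic by exact: segment_compact.
have PG : ProperFilter (u @ F) by exact: fmap_proper_filter.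
have [|l [_ cl]] := cB (u @ F) PG.
  by apply: (@filterS _ F _ _ _ _ hB) => n /=; rewrite in_itv /= ler_norml.
exists l => e e0; have [//|nF] := in_ultra_setVsetC [set n | `|u n - l| <= e] UF.
have [y [[z nz zy] yl]] : (u @` ~` [set n | `|u n - l| <= e]) `&` ball l e !=set0.
  apply: cl; last exact: nbhsx_ballx.
  by apply: (@filterS _ F _ _ _ _ nF) => n nn; exists n.
by move: yl; rewrite -zy /ball /= distrC => /ltW.
Qed.

Lemma ulim_exists (u : nat -> C) (B : R) : F [set n | nm (u n) <= B] ->
  exists l, ulim u l.
Proof.
move=> hB.
have [a ha] := @real_ulim (fun n => complex.Re (u n)) B
  (@filterS _ F _ _ _ (fun n h => le_trans (le_Re_nm _) h) hB).
have [b hb] := @real_ulim (fun n => complex.Im (u n)) B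
  (@filterS _ F _ _ _ (fun n h => le_trans (le_Im_nm _) h) hB).
exists (Complex a b) => e e0; have e2 : 0 < e / 2 by lra.
apply: (@filterS _ F _ _ _ _ (filterI (ha _ e2) (hb _ e2))) => n /= [h1 h2].
apply: le_trans (nm_le_ReIm _) _; rewrite ReD ReN ImD ImN /=.
by have := lerD h1 h2; rewrite -splitr.
Qed.

Lemma ulimD u v l m : ulim u l -> ulim v m -> ulim (fun n => u n + v n) (l + m).
Proof.
move=> hu hv e e0; have e2 : 0 < e / 2 by lra.
apply: (@filterS _ F _ _ _ _ (filterI (hu _ e2) (hv _ e2))) => n /= [h1 h2].
rewrite opprD addrACA; apply: le_trans (nmD _ _) _.
by have := lerD h1 h2; rewrite -splitr.
Qed.

Lemma ulimZ a u l : ulim u l -> ulim (fun n => a * u n) (a * l).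
Proof.
move=> hu e e0; have a0 : 0 < nm a + 1 by rewrite ltr_wpDl // nm_ge0.
apply: (@filterS _ F _ _ _ _ (hu _ (divr_gt0 e0 a0))) => n /=.
rewrite ler_pdivlMr // => h; rewrite -mulrBr nmM mulrC; apply: le_trans h.
by rewrite ler_wpM2l ?nm_ge0 // lerDl.
Qed.

Lemma ulim_cst l : ulim (fun=> l) l.
Proof. by move=> e e0; apply: filterE => n /=; rewrite subrr nm0 ltW. Qed.

Lemma ulim_sum (I : Type) (s : seq I) (u : I -> nat -> C) (l : I -> C) :
  (forall i, ulim (u i) (l i)) ->
  ulim (fun n => \sum_(i <- s) u i n) (\sum_(i <- s) l i).
Proof.
move=> h; elim: s => [|i s ih].
  rewrite big_nil; have := ulim_cst 0; congr ulim; apply/funext => n.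
  by rewrite big_nil.
rewrite big_cons; have := ulimD (h i) ih; congr ulim; apply/funext => n.
by rewrite big_cons.
Qed.

Lemma ulim_le u l (b : R) : ulim u l -> F [set n | nm (u n) <= b] -> nm l <= b.
Proof.
move=> hu hb; apply/ler_addgt0Pr => e e0.
have [n /= [h1 h2]] := filter_ex (filterI (hu _ e0) hb).
have := nm_tri (u n) l 0; rewrite !subr0 nm_distC => /le_trans; apply.
by rewrite addrC lerD.
Qed.

Lemma ulim_dist u v l m (b : R) : ulim u l -> ulim v m ->
  F [set n | nm (u n - v n) <= b] -> nm (l - m) <= b.
Proof.
move=> hu hv; apply: ulim_le.
have := ulimD hu (ulimZ (- 1) hv); rewrite mulN1r; congr ulim.
by apply/funext => n; rewrite mulN1r.
Qed.

End ultralimits.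

(** * Vanishing averages of almost periodic functions *)

Section null_means.
Variables (R : realType) (d : nat).
Local Notation E := 'rV[R]_d.
Local Notation C := R[i].
Local Notation nm := (@ComplexField.Normc.normc R).
Local Notation rc := (real_complex R).
Variables (mu : cradon R d) (A : nat -> set E).
Hypotheses (tb : translation_bounded mu) (avA : averaging_seq A) (vHA : van_Hove A).
Hypothesis nullA : null_FB mu A.

Definition amean n (g : E -> C) : C := rc (vol (A n))^-1 * cint mu (A n) g.

Let bA n : bborel (A n). Proof. by apply: compact_bborel; case: avA. Qed.

Lemma ameanD n g h : ccont g -> ccont h ->
  amean n (fun x => g x + h x) = amean n g + amean n h.
Proof. by move=> cg ch; rewrite /amean cintD // mulrDr. Qed.

Lemma ameanZ n a g : ccont g -> amean n (fun x => a * g x) = a * amean n g.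
Proof. by move=> cg; rewrite /amean cintZ // mulrCA. Qed.

Lemma amean_sum n (I : Type) (s : seq I) (G : I -> E -> C) :
  (forall i, ccont (G i)) ->
  amean n (fun x => \sum_(i <- s) G i x) = \sum_(i <- s) amean n (G i).
Proof. by move=> cG; rewrite /amean cint_sum // mulr_sumr. Qed.

Lemma amean_bound : exists2 c1 : R, 0 <= c1 & exists n0, forall n, (n0 <= n)%N ->
  forall g (c : R), ccont g -> 0 <= c -> (forall x, nm (g x) <= c) ->
  nm (amean n g) <= c1 * c.
Proof.
have [c1 c10 [n0 hn0]] := cint_vol_bound tb avA vHA.
exists c1 => //; exists n0 => n /hn0[v1 h] g c cg c0 hc.
have v0 : 0 < vol (A n) by apply: lt_le_trans v1.
rewrite nmM nm_real gtr0_norm ?invr_gt0 // [leLHS]mulrC ler_pdivrMr //.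
by apply: h => // x _; exact: hc.
Qed.

Definition ucont (g : E -> C) := forall e : R, 0 < e ->
  exists2 b : R, 0 < b & forall t, `|t| < b -> forall x, nm (g (x + t) - g x) <= e.

Lemma ucont_ccont g : ucont g -> ccont g.
Proof.
move=> ug x e e0; have [b b0 hb] := ug e e0.
have := @nbhsx_ballx R E x b b0; apply: filterS => y.
rewrite -ball_normE /= distrC => /hb /(_ x).
by rewrite [x + _]addrC subrK.
Qed.

Theorem ap_null_mean (f : E -> C) (e : R) : ap f -> ucont f -> 0 < e ->
  exists n0, forall n, (n0 <= n)%N -> nm (amean n f) <= e.
Proof.
move=> af uf e0; apply: contrapT => nex.
(* The tails of the indices where the average exceeds [e]; proper because these indices are assumed
   to recur forever. Any ultrafilter finer than it keeps the limit at [t = 0] away from 0. *)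
pose F0 := [set S : set nat | exists N, forall n, (N <= n)%N -> e < nm (amean n f) -> S n].
have F0F : Filter F0.
  split.
  - by exists 0%N.
  - move=> S T [N hN] [M hM]; exists (maxn N M) => n; rewrite geq_max => /andP[nN nM] h.
    by split; [exact: hN|exact: hM].
  - by move=> S T ST [N hN]; exists N => n nN h; apply/ST/hN.
have F0P : ProperFilter F0.
  apply: Build_ProperFilter_ex => S [N hN]; apply: contrapT => nS; apply: nex.
  exists N => n nN; rewrite leNgt; apply/negP => h; apply: nS; exists n; exact: hN.
have [F [UF F0F']] := ultraFilterLemma F0P.
have PF : ProperFilter F := @ultra_proper _ _ UF.
have FF : Filter F := @filter_filter _ _ PF.
have Fev (S : set nat) N : (forall n, (N <= n)%N -> S n) -> F S.
  by move=> h; apply: F0F'; exists N => n nN _; exact: h.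
have [c1 c10 [n1 hc1]] := amean_bound.
have [B B0 hB] := ap_bounded af.
have cf : ccont f := ucont_ccont uf.
have cft (t : E) : ccont (fun x : E => f (x + t)) := ccont_shift t cf.
have phi_ex (t : E) : exists l, ulim F (fun n => amean n (fun x : E => f (x + t))) l.
  apply: (@ulim_exists _ F UF _ (c1 * B)); apply: (Fev _ n1) => n nn.
  by apply: hc1 => //; exact: ltW.
have [phi hphi] := choice phi_ex.
have phi_dist t t' (b : R) : 0 <= b -> (forall x, nm (f (x + t) - f (x + t')) <= b) ->
    nm (phi t - phi t') <= c1 * b.
  move=> b0 hb; apply: (ulim_dist UF (hphi t) (hphi t')); apply: (Fev _ n1) => n nn; rewrite /mkset.
  have -> : amean n (fun x : E => f (x + t)) - amean n (fun x : E => f (x + t')) =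
      amean n (fun x : E => f (x + t) + - 1 * f (x + t')).
    by rewrite ameanD // ?ameanZ ?mulN1r //; exact: ccontZ.
  apply: hc1 => // [|x]; first by apply: ccontD => //; exact: ccontZ.
  by rewrite mulN1r; exact: hb.
have aphi : ap phi.
  apply: (ap_dom (K := c1) af) => t t' b hb x; apply: phi_dist.
    by apply: le_trans (hb 0); exact: nm_ge0.
  by move=> y; rewrite !addrA; exact: hb.
have phi0 : msq phi != 0.
  apply: (@msq_neq0 _ _ _ 0) => //; apply/eqP => p0.
  have h := hphi 0 (e / 2); have e2 : 0 < e / 2 by lra.
  have F1 : F [set n | e < nm (amean n f)] by apply: F0F'; exists 0%N.
  have [n [+ h1]] := filter_ex (filterI (h e2) F1).
  rewrite /mkset p0 subr0; have -> : (fun x : E => f (x + 0)) = f.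
    by apply/funext => x; rewrite addr0.
  move=> /(lt_le_trans h1); rewrite ltNge => /negP; apply.
  by rewrite ler_pdivrMr // ler_peMr ?ler1n // ltW.
have [chi [achi chiM chi1 m0]] := ap_character aphi phi0.
have a0 : 0 < nm (mean (fun s => phi s * conjc (chi s))).
  rewrite lt_neqAle nm_ge0 andbT eq_sym; apply: contra m0 => /eqP h.
  by apply/eqP; exact: nm_eq0.
have chiV t : conjc (chi (- t)) = chi t.
  have h1 : chi t * chi (- t) = chi 0 by rewrite -chiM subrr.
  have nz s : chi s != 0.
    by apply/eqP => c0; have /eqP := chi1 s; rewrite c0 nm0 eq_sym oner_eq0.
  have h0 : chi 0 = 1 by apply: (mulfI (nz 0)); rewrite -chiM addr0 mulr1.
  apply: (mulIf (nz (- t))); rewrite h1 h0 mulrC mulJ chi1 expr1n.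
  by [].
have amul : ap (fun s => phi s * conjc (chi s)) by apply: apM => //; exact: apJ.
(* The character comes from the discrete group, so continuity must be recovered: shifting [phi] by
   [t] multiplies its coefficient at [chi] by [chi t], while uniform continuity of [f] keeps the
   shifted [phi] uniformly close to [phi]. *)
have chi_cont (b : R) : 0 < b -> exists2 dl : R, 0 < dl &
    forall x, `|x| < dl -> nm (chi x - 1) <= b.
  move=> b0; set a := nm _ in a0.
  have b1 : 0 < b * a / (c1 + 1) by rewrite divr_gt0 ?mulr_gt0 //; lra.
  have [dl dl0 hdl] := uf _ b1; exists dl => // t ht.
  have h1 s : nm (phi (s + t) - phi s) <= b * a.
    apply: (le_trans (phi_dist _ _ _ (ltW b1) _)).
      by move=> x; rewrite addrA -[x + s in X in _ - X]addr0; have := hdl t ht (x + s); rewrite addr0.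
    rewrite mulrCA ger_pMr ?mulr_gt0 // ler_pdivrMr; lra.
  have h2 : mean (fun s => phi (s + t) * conjc (chi s)) =
      chi t * mean (fun s => phi s * conjc (chi s)).
    rewrite -(meanZ _ amul) -(mean_shift (- t)); last first.
      by apply: apM; [exact: ap_shift|exact: apJ].
    by congr mean; apply/funext => s; rewrite subrK chiM conjM chiV; ring.
  have h3 : nm (chi t * mean (fun s => phi s * conjc (chi s)) -
      mean (fun s => phi s * conjc (chi s))) <= b * a.
    rewrite -h2; apply: mean_dist => //.
      by apply: apM; [exact: ap_shift|exact: apJ].
    by move=> s; rewrite -mulrBl nmM nmJ chi1 mulr1.
  move: h3; rewrite -[X in _ - X]mul1r -mulrBl nmM -/a.
  by rewrite ler_pM2r.
have [k hk] := continuous_character chiM chi1 chi_cont.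
have cchi : ccont chi.
  apply: ucont_ccont => b b0; have [dl dl0 hdl] := chi_cont b b0.
  exists dl => // t ht x; rewrite chiM -{2}[chi x]mulr1 -mulrBr nmM chi1 mul1r.
  exact: hdl.
have chi0 : ulim F (fun n => amean n chi) 0.
  move=> b b0; have := nullA k => /nm_cvg0 /(_ b0)[N hN].
  apply: (Fev _ N) => n nN; rewrite /mkset subr0.
  have -> : amean n chi = rc (vol (A n))^-1 * cint mu (A n) (charexp k).
    by congr (_ * cint mu _ _); apply/funext.
  exact: hN.
have afc : ap (fun s => f s * conjc (chi s)) by apply: apM => //; exact: apJ.
have [b hb] := ap_ismean afc.
move/eqP: m0; apply; apply: mean_eq => e1 e10.
have e2 : 0 < e1 / (c1 + 1) by rewrite divr_gt0 //; lra.
(* A list that averages [f] times the conjugate character uniformly to [b] also serves for [phi];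
   the tolerance anticipates the factor [c1] of [amean_bound]. *)
have [s [s0 hs]] := hb _ e2; exists s; split=> // y; rewrite subr0.
(* Being a finite sum, [w] passes to the ultralimit. It also equals the average of a function
   uniformly close to [b * chi], and the averages of [chi] tend to 0 by hypothesis. *)
pose w n := (size s)%:R^-1 * \sum_(u <- s)
  conjc (chi (y + u)) * amean n (fun x : E => f (x + (y + u))).
have lw : ulim F w (avg s (fun s => phi s * conjc (chi s)) y).
  apply: ulimZ => //; apply: ulim_sum => // u; rewrite mulrC; apply: ulimZ => //.
have wE n : w n = amean n (fun x : E => chi x * avg s (fun s => f s * conjc (chi s)) (x + y)).
  rewrite /w; pose G u (x : E) := (size s)%:R^-1 * conjc (chi (y + u)) * f (x + (y + u)).
  have cG u : ccont (G u) by apply: ccontZ; exact: cft.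
  have -> : (fun x : E => chi x * avg s (fun s => f s * conjc (chi s)) (x + y)) =
      (fun x => \sum_(u <- s) G u x).
    apply/funext => x; rewrite /avg mulrCA mulr_sumr mulr_sumr; apply: eq_bigr => u _.
    rewrite /G -addrA; have -> : conjc (chi (y + u)) = chi x * conjc (chi (x + (y + u))).
      rewrite (chiM x) conjM mulrA mulJ chi1 expr1n rmorph1 mul1r.
      by [].
    by ring.
  rewrite amean_sum // mulr_sumr; apply: eq_bigr => u _.
  by rewrite /G ameanZ // mulrA.
have w0 : ulim F (fun n => b * amean n chi) 0.
  by have := ulimZ UF b chi0; rewrite mulr0.
have := ulim_dist UF lw w0 (b := e1); rewrite subr0; apply.
apply: (Fev _ n1) => n nn; rewrite /mkset wE.
have caf : ccont (fun x : E => chi x * avg s (fun s => f s * conjc (chi s)) (x + y)).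
  have -> : (fun x : E => chi x * avg s (fun s => f s * conjc (chi s)) (x + y)) =
      (fun x => \sum_(u <- s) (size s)%:R^-1 * conjc (chi (y + u)) * f (x + (y + u))).
    apply/funext => x; rewrite /avg mulrCA mulr_sumr mulr_sumr; apply: eq_bigr => u _.
    rewrite -addrA; have -> : conjc (chi (y + u)) = chi x * conjc (chi (x + (y + u))).
      rewrite (chiM x) conjM mulrA mulJ chi1 expr1n rmorph1 mul1r.
      by [].
    by ring.
  by apply: ccont_sum => u; apply: ccontZ; exact: cft.
have -> : amean n (fun x : E => chi x * avg s (fun s => f s * conjc (chi s)) (x + y)) -
    b * amean n chi = amean n (fun x : E =>
      chi x * avg s (fun s => f s * conjc (chi s)) (x + y) + - b * chi x).
  by rewrite ameanD // ?ameanZ ?mulNr //; exact: ccontZ.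
apply: le_trans (hc1 n nn _ (e1 / (c1 + 1)) _ (ltW e2) _) _.
- by apply: ccontD => //; exact: ccontZ.
- move=> x; rewrite mulNr [b * _]mulrC -mulrBr nmM chi1 mul1r.
  exact: hs.
- by rewrite mulrCA ger_pMr // ler_pdivrMr; lra.
Qed.

End null_means.

(** * Periodization over the lattice *)

Section topological_group.
Variable M : topologicalZmodType.
Implicit Types (x y a v : M) (B N : set M).

Lemma add_cvg a x : (fun y => y + a) @ x --> x + a.
Proof.
apply: (@cvg_comp _ _ _ (fun y => (y, a)) (fun p : M * M => p.1 + p.2) (nbhs x)
  (nbhs (x, a))).
  by apply: cvg_pair; [exact: cvg_id|exact: cvg_cst].
exact: (@tvs.add_continuous M (x, a)).
Qed.

Lemma nbhs_addr a x B : nbhs (x + a) B -> nbhs x (fun y => B (y + a)).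
Proof. exact: add_cvg. Qed.

Lemma nbhs_to0 x B : nbhs x B -> nbhs (0 : M) (fun v => B (v + x)).
Proof. by move=> h; apply: nbhs_addr; rewrite add0r. Qed.

Lemma nbhs_of0 x N : nbhs (0 : M) N -> nbhs x (fun y => N (y - x)).
Proof. by move=> h; apply: nbhs_addr; rewrite subrr. Qed.

Lemma nbhs0_opp N : nbhs (0 : M) N -> nbhs (0 : M) (fun v => N (- v)).
Proof.
move=> h; have c := @tvs.opp_continuous M 0.
by apply: c; rewrite oppr0.
Qed.

Lemma nbhs0_sub N : nbhs (0 : M) N -> exists N', nbhs (0 : M) N' /\
  forall a v, N' a -> N' v -> N (a - v).
Proof.
move=> h; have := @tvs.sub_continuous M (0, 0).
move=> /(_ N); rewrite /= subr0 => /(_ h) [[P1 P2] /= [h1 h2] hP].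
exists (P1 `&` P2); split; first exact: filterI.
by move=> a v [a1 _] [_ v2]; apply: (hP (a, v)).
Qed.

Lemma nbhs0_add N : nbhs (0 : M) N -> exists N', [/\ nbhs (0 : M) N',
  (forall v, N' v -> N v), (forall v, N' v -> N' (- v)) &
  forall a v, N' a -> N' v -> N (a + v)].
Proof.
move=> h; have [P [hP PN]] := nbhs0_sub h.
exists ((P `&` (fun v => P (- v))) `&` (N `&` (fun v => N (- v)))); split.
- by do 2?apply: filterI => //; exact: nbhs0_opp.
- by move=> v [_ []].
- by move=> v [[p1 p2] [n1 n2]]; split; split; rewrite ?opprK.
- by move=> a v [[p1 _] _] [[_ p2] _]; rewrite -[v]opprK; exact: PN.
Qed.

(** A finite cover of [K], taken at half scale in the group, makes the modulus of continuity uniform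
    on [K]. *)
Lemma compact_support_ucont (R : realType) (g : M -> R[i]) (K : set M) (e : R) :
  ccont g -> compact K -> (forall x, ~ K x -> g x = 0) -> 0 < e ->
  exists N, nbhs (0 : M) N /\
    forall x v, N v -> ComplexField.Normc.normc (g (x + v) - g x) <= e.
Proof.
move=> cg cK hK e0; have e2 : 0 < e / 2 by lra.
pose P x N := [/\ nbhs (0 : M) N, (forall v, N v -> N (- v)) & forall a v, N a -> N v ->
  ComplexField.Normc.normc (g (x + (a + v)) - g x) <= e / 2].
have hP x : exists N, P x N.
  have [N' [h1 _ h3 h4]] := nbhs0_add (nbhs_to0 (cg x _ e2)).
  by exists N'; split=> // a v Na Nv; rewrite [x + _]addrC; exact: h4.
have [N hN] := choice hP.
have N0 x v : N x v -> forall a, N x a -> N x 0.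
  by move=> _ a _; have [h _ _] := hN x; exact: nbhs_singleton h.
have [s [_ hs]] := @compact_nbhs_cover _ K (fun x y => N x (y - x)) cK
  (fun x _ => let: And3 h _ _ := hN x in nbhs_of0 x h).
pose NN := [set v | forall x, x \in s -> N x v].
have hNN : nbhs (0 : M) NN.
  rewrite /NN; elim: (s) => [|x t ih]; first by apply: filterE.
  have [h _ _] := hN x; apply: (filterS _ (filterI h ih)) => v [Nv tv] y.
  by rewrite inE => /orP[/eqP ->|/tv].
have key x v : K x -> NN v -> ComplexField.Normc.normc (g (x + v) - g x) <= e.
  move=> Kx Nv; have [y ys Ny] := hs x Kx; have [h1 h2 h3] := hN y.
  have h4 := h3 _ _ Ny (Nv y ys); have h5 := h3 _ _ Ny (nbhs_singleton h1).
  rewrite addr0 [y + (x - y)]addrC subrK in h5.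
  rewrite addrA [y + (x - y)]addrC subrK in h4.
  rewrite nm_distC in h5; have := nm_tri (g y) (g (x + v)) (g x); lra.
exists NN; split=> // x v Nv; have [Kx|nKx] := pselect (K x); first exact: key.
(* From outside [K] the step can only matter if it lands in [K]; then the estimate is used
   backwards, which is why the neighbourhoods are symmetric. *)
have [Kxv|nKxv] := pselect (K (x + v)); last by rewrite !hK // subrr nm0 ltW.
have Nv' : NN (- v) by move=> y ys; have [_ h _] := hN y; apply/h/Nv.
by have := key _ _ Kxv Nv'; rewrite addrK nm_distC.
Qed.

End topological_group.

(** A list that misses an element of [P] can be extended; the bound stops this process. *)
Lemma uniq_bounded_list (T : eqType) (P : set T) (B : nat) :
  (forall s, uniq s -> (forall x, x \in s -> P x) -> (size s <= B)%N) ->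
  exists2 s, uniq s & forall x, x \in s <-> P x.
Proof.
move=> hB.
have key k : (exists2 s, uniq s & forall x, x \in s <-> P x) \/
    (exists s, [/\ uniq s, (forall x, x \in s -> P x) & size s = k]).
  elim: k => [|k [|[s [us sP sk]]]]; [by right; exists [::]|by left|].
  have [h|/existsNP[x hx]] := pselect (forall x, P x -> x \in s).
    by left; exists s => // x; split; [exact: sP|exact: h].
  have [Px /negP xs] : P x /\ ~ x \in s by apply/not_implyP.
  right; exists (x :: s); split; rewrite /= ?xs ?us ?sk //.
  by move=> y; rewrite inE => /orP[/eqP ->|/sP].
have [//|[s [us sP sk]]] := key B.+1.
by have := hB s us sP; rewrite sk ltnn.
Qed.

(** * Uniform discreteness and counting of lattice points *)

Section lattice_points.
Variables (R : realType) (d : nat) (H : topologicalZmodType).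
Local Notation E := 'rV[R]_d.
Variable L : set (E * H).
Hypothesis cps : cut_project_scheme L.

Lemma lattice0 : L 0. Proof. by have [[h _] _ _ _ _] := cps. Qed.

Lemma latticeB l m : L l -> L m -> L (l - m).
Proof. by have [[_ h] _ _ _ _] := cps; exact: h. Qed.

Lemma latticeN l : L l -> L (- l).
Proof. by move=> Ll; rewrite -[- l]add0r; apply: latticeB => //; exact: lattice0. Qed.

Lemma latticeD l m : L l -> L m -> L (l + m).
Proof. by move=> Ll Lm; rewrite -[m]opprK; apply: latticeB => //; exact: latticeN. Qed.

Lemma nbhs0_prod (U : set (E * H)) : nbhs (0 : E * H) U ->
  exists (r : R) (N : set H), [/\ 0 < r, nbhs (0 : H) N &
    forall t v, `|t| < r -> N v -> U (t, v)].
Proof.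
move=> [[P1 P2] /= [h1 h2] hP].
move/nbhs_ballP : h1 => [r r0 hr]; exists r, P2; split=> // t v tr Nv.
by apply: hP; split=> //=; apply: hr; rewrite -ball_normE /= sub0r normrN.
Qed.

(** Discreteness at 0 becomes uniform because the difference of two lattice points is a lattice
    point. *)
Lemma lattice_separated : exists (r : R) (N : set H), [/\ 0 < r, nbhs (0 : H) N &
  forall (w l m : E * H), L l -> L m -> `|l.1 - w.1| < r -> N (l.2 - w.2) ->
    `|m.1 - w.1| < r -> N (m.2 - w.2) -> l = m].
Proof.
have [_ hd _ _ _] := cps; have [U [oU U0 UL]] := hd 0 lattice0.
have [r [N [r0 hN hU]]] := nbhs0_prod (open_nbhs_nbhs (conj oU U0)).
have [N' [hN' NN']] := nbhs0_sub hN.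
exists (r / 2), N'; split=> //; first exact: divr_gt0.
move=> w l m Ll Lm l1 l2 m1 m2.
have : (U `&` L) (l - m).
  split; last exact: latticeB.
  have -> : l - m = ((l.1 - w.1) - (m.1 - w.1), (l.2 - w.2) - (m.2 - w.2)).
    by rewrite !opprB !addrA !subrK.
  apply: hU; last exact: NN'.
  by apply: le_lt_trans (ler_normB _ _) _; lra.
by rewrite UL => /= /eqP; rewrite subr_eq0 => /eqP.
Qed.

(** The bound does not depend on the translation [(a, z)]: a fixed compact set is covered by
    finitely many separation neighbourhoods, each holding at most one point of the translated
    lattice. *)
Lemma lattice_count (r : R) (Q : set H) : compact Q -> exists B : nat,
  forall (a : E) (z : H) (s : seq (E * H)), uniq s ->
  (forall l, l \in s -> [/\ L l, `|a + l.1| <= r & Q (z + l.2)]) -> (size s <= B)%N.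
Proof.
move=> cQ; have [r0 [N [r00 hN sep]]] := lattice_separated.
have cK : compact (@cball R d r `*` Q) by apply: compact_setX => //; exact: compact_cball.
have hnb (x : E * H) : nbhs x [set y | `|y.1 - x.1| < r0 /\ N (y.2 - x.2)].
  exists ([set t | `|t - x.1| < r0], (fun v => N (v - x.2))) => //=; split=> /=.
    have := @nbhsx_ballx R E x.1 r0 r00; apply: filterS => y.
    by rewrite -ball_normE /= distrC.
  exact: nbhs_of0.
have [cs [_ hcs]] := @compact_nbhs_cover _ _ _ cK (fun x _ => hnb x).
exists (size cs) => a z s us hs.
have hc l : exists c, l \in s -> c \in cs /\
    `|a + l.1 - c.1| < r0 /\ N (z + l.2 - c.2).
  have [ls|nls] := boolP (l \in s); last by exists 0.
  have [Ll l1 l2] := hs l ls.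
  have [c ccs [h1 h2]] := hcs (a + l.1, z + l.2) (conj l1 l2).
  by exists c.
have [c hcc] := choice hc.
have inj : {in s &, injective c}.
  move=> l m ls ms e; have [Ll _ _] := hs l ls; have [Lm _ _] := hs m ms.
  have [_ [l1 l2]] := hcc l ls; have [_ [m1 m2]] := hcc m ms.
  have sh (M : zmodType) (x y u : M) : x + y - u = y - (u - x).
    by rewrite opprB addrCA addrA.
  apply: (sep ((c l).1 - a, (c l).2 - z)) => //=; rewrite -?sh // e //.
rewrite -(size_map c); apply: uniq_leq_size; first by rewrite map_inj_in_uniq.
by move=> x /mapP[l ls ->]; have [] := hcc l ls.
Qed.

Lemma lattice_list (r : R) (Q : set H) (a : E) (z : H) : compact Q ->
  exists2 s : seq (E * H), uniq s &
    forall l, l \in s <-> [/\ L l, `|a + l.1| <= r & Q (z + l.2)].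
Proof.
move=> cQ; have [B hB] := lattice_count r cQ.
exact: (uniq_bounded_list (hB a z)).
Qed.

End lattice_points.

(** * The periodized function and its almost periodicity *)

Section periodization.
Variables (R : realType) (d : nat) (H : topologicalZmodType).
Local Notation E := 'rV[R]_d.
Local Notation C := R[i].
Local Notation nm := (@ComplexField.Normc.normc R).
Variable L : set (E * H).
Hypothesis cps : cut_project_scheme L.
Variables (f : E -> C) (h : H -> C) (r : R) (Q : set H).
Hypotheses (cf : ccont f) (f0 : forall x, r < `|x| -> f x = 0).
Hypotheses (ch : ccont h) (cQ : compact Q) (h0 : forall z, ~ Q z -> h z = 0).

(** The internal variable [z] is kept because invariance under [L] holds only jointly in [x] and
    [z]. The sum over [L] has finite support by [lattice_count]. *)
Definition per x z : C := (\sum_(l \in L) f (x + l.1) * h (z + l.2))%R.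

Lemma per_term0 x z (l : E * H) : ~ (`|x + l.1| <= r /\ Q (z + l.2)) ->
  f (x + l.1) * h (z + l.2) = 0.
Proof.
move=> nl; have [xr|xr] := leP (`|x + l.1|) r; last by rewrite f0 // mul0r.
by rewrite h0 ?mulr0 // => Qz; apply: nl.
Qed.

Lemma per_list x z (s : seq (E * H)) : uniq s -> (forall l, l \in s -> L l) ->
  (forall l, L l -> `|x + l.1| <= r -> Q (z + l.2) -> l \in s) ->
  per x z = \sum_(l <- s) f (x + l.1) * h (z + l.2).
Proof.
move=> us sL hs; rewrite /per (fsbigE s) //; last first.
  by move=> l Ll nls; apply: per_term0 => -[h1 h2]; move: nls; rewrite hs.
rewrite big_seq_cond [RHS]big_seq; apply: eq_bigl => l.
by case: (boolP (l \in s)) => //= ls; rewrite mem_set //; exact: sL.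
Qed.

Lemma per_shift x z l : L l -> per (x + l.1) (z + l.2) = per x z.
Proof.
move=> Ll; rewrite /per (reindex_fsbig (fun m : E * H => m - l) L L); last first.
  split.
  - by move=> m Lm; exact: (latticeB cps).
  - by move=> m m' _ _ /addIr.
  - by move=> m Lm; exists (m + l); [exact: (latticeD cps)|rewrite addrK].
apply: eq_fsbigr => m _ /=.
by congr (f _ * h _); rewrite -addrA; congr (_ + _); rewrite addrC subrK.
Qed.

Lemma per_ucont (e : R) : 0 < e -> exists (r0 : R) (N : set H),
  [/\ 0 < r0, nbhs (0 : H) N & forall x z t v, `|t| < r0 -> N v ->
    nm (per (x + t) (z + v) - per x z) <= e].
Proof.
move=> e0; have [B hB] := lattice_count cps r cQ.
have [a a0 ha] := compact_support_bound cf f0.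
have [b b0' hb'] := ccont_bounded cQ ch.
have hb z : nm (h z) <= b.
  by have [Qz|nQz] := pselect (Q z); [exact: hb'|rewrite h0 // nm0].
(* At most [B] lattice points matter for each of the two arguments, and each difference of products
   is at most [(a + b) * (e / k)]; the 1 keeps [k] positive. *)
pose k : R := (B + B)%:R * (a + b) + 1.
have k0 : 0 < k by rewrite /k ltr_wpDl // mulr_ge0 // addr_ge0.
have e1 : 0 < e / k by exact: divr_gt0.
have fc x : ~ @cball R d r x -> f x = 0.
  by move=> nx; apply: f0; rewrite ltNge; apply/negP.
have [N1 [hN1 uf]] := compact_support_ucont cf (@compact_cball R d r) fc e1.
have [N [hN uh]] := compact_support_ucont ch cQ h0 e1.
move/nbhs_ballP : hN1 => [r0 r00 hr0]; exists r0, N; split=> // x z t v tr Nv.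
have Nt : N1 t by apply: hr0; rewrite -ball_normE /= sub0r normrN.
have [s1 us1 hs1] := lattice_list cps r x z cQ.
have [s2 us2 hs2] := lattice_list cps r (x + t) (z + v) cQ.
pose s := undup (s1 ++ s2).
have us : uniq s by exact: undup_uniq.
have sL l : l \in s -> L l.
  by rewrite mem_undup mem_cat => /orP[/hs1[]|/hs2[]].
have sz : (size s <= B + B)%N.
  rewrite (leq_trans (size_undup _)) // size_cat leq_add //.
    by apply: (hB x z) => // l /hs1.
  by apply: (hB (x + t) (z + v)) => // l /hs2.
rewrite (per_list us sL); last first.
  move=> l Ll l1 l2; rewrite mem_undup mem_cat; apply/orP; right; exact/hs2.
rewrite (per_list us sL); last first.
  move=> l Ll l1 l2; rewrite mem_undup mem_cat; apply/orP; left; exact/hs1.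
rewrite -sumrB; apply: le_trans (nm_sum _ _) _.
have term l : nm (f (x + t + l.1) * h (z + v + l.2) - f (x + l.1) * h (z + l.2)) <=
    (a + b) * (e / k).
  have -> : f (x + t + l.1) * h (z + v + l.2) - f (x + l.1) * h (z + l.2) =
    f (x + t + l.1) * (h (z + v + l.2) - h (z + l.2)) +
    (f (x + t + l.1) - f (x + l.1)) * h (z + l.2) by ring.
  apply: le_trans (nmD _ _) _; rewrite !nmM mulrDl lerD //.
    by rewrite ler_pM ?nm_ge0 // [z + v + _]addrAC; exact: uh.
  by rewrite mulrC ler_pM ?nm_ge0 // [x + t + _]addrAC; exact: uf.
apply: (@le_trans _ _ (\sum_(l <- s) (a + b) * (e / k))); first exact: ler_sum.
rewrite big_const_seq count_predT iter_addr addr0 -[X in X <= _]mulr_natl.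
apply: (@le_trans _ _ ((B + B)%:R * ((a + b) * (e / k)))).
  by rewrite ler_wpM2r ?ler_nat // mulr_ge0 ?addr_ge0 // ltW.
have ek : e = k * (e / k) by rewrite mulrCA mulfV ?mulr1 // gt_eqF.
by rewrite [X in _ <= X]ek mulrA ler_wpM2r ?(ltW e1) // lerDl.
Qed.

Lemma per_ucont0 : ucont (fun x => per x 0).
Proof.
move=> e e0; have [r0 [N [r00 hN hu]]] := per_ucont e0.
exists r0 => // t tr x; have := hu x 0 t 0 tr (nbhs_singleton hN).
by rewrite addr0.
Qed.

(** Co-compactness gives finitely many classes modulo [L] that are small neighbourhoods. Colouring
    [t] by the class of [(t, 0)] works, since equal colours bring both translates near one value of
    the periodization. *)
Lemma per_ap : ap (fun x => per x 0).
Proof.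
move=> e e0; have e2 : 0 < e / 2 by lra.
have [r0 [N [r00 hN hu]]] := per_ucont e2.
have [_ _ coc _ _] := cps.
pose U (w : E * H) := [set p : E * H | exists l, L l /\
  (`|(p - l - w).1| < r0 /\ interior N (p - l - w).2)].
have [J finJ covJ] : exists2 J : set (E * H), finite_set J & \bigcup_(i in J) U i = setT.
  apply: coc.
  - move=> w; rewrite openE => p [l [Ll [h1 h2]]].
    pose c := l + w.
    have nbp : nbhs p [set q : E * H | `|q.1 - c.1| < r0 /\ interior N (q.2 - c.2)].
      exists ([set t | `|t - c.1| < r0], (fun v => interior N (v - c.2))); last by [].
      split=> /=.
        have h1' : 0 < r0 - `|p.1 - c.1| by rewrite subr_gt0 /c opprD addrA; exact: h1.
        have := @nbhsx_ballx R E p.1 _ h1'; apply: filterS => t.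
        rewrite -ball_normE /= distrC => ht.
        have := ler_normD (t - p.1) (p.1 - c.1); rewrite addrA subrK; lra.
      apply: nbhs_addr; apply: open_nbhs_nbhs; split; first exact: open_interior.
      by rewrite /c opprD addrA; exact: h2.
    apply: filterS nbp => q [q1 q2]; exists l; split=> //=.
    by rewrite -!addrA -!opprD.
  - move=> w z l [m [Lm h1]] Ll; exists (m + l); split; first exact: (latticeD cps).
    by rewrite opprD addrACA [l - l]subrr addr0.
  - apply/seteqP; split=> // p _; exists p => //; exists 0; split.
      exact: (lattice0 cps).
    rewrite subr0 subrr normr0; split=> //; exact: nbhs_interior.
have /finite_seqP[js jsE] := finJ.
have hk (x : E) : exists w, w \in js /\ U w (x, 0).
  have [w Jw Uw] : (\bigcup_(i in J) U i) (x, 0) by rewrite covJ.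
  by exists w; split=> //; move: Jw; rewrite jsE.
have [w hw] := choice hk.
(* The successor is there so that [inord] has an inhabited ordinal type. *)
exists 'I_(size js).+1, (fun x => inord (index (w x) js)) => t t' tt' x.
have ww : w t = w t'.
  have lt s : (index (w s) js < (size js).+1)%N by rewrite ltnS index_size.
  have := congr1 val tt'; rewrite /= !inordK // => ii.
  by rewrite -(nth_index 0 (proj1 (hw t))) ii nth_index //; have [] := hw t'.
have near_w (s : E) : nm (per (x + s) 0 - per (x + (w s).1) (w s).2) <= e / 2.
  have [_ [l [Ll [/= h1 h2]]]] := hw s.
  have E1 : x + (w s).1 + (s - l.1 - (w s).1) = x + s + (- l).1.
    by rewrite -addrA [(w s).1 + _]addrC subrK addrA.
  have E2 : (w s).2 + (0 - l.2 - (w s).2) = 0 + (- l).2 by rewrite addrC subrK.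
  have := hu (x + (w s).1) (w s).2 _ _ h1 (interior_subset h2).
  by rewrite E1 E2 (per_shift (x + s) 0 (latticeN cps Ll)).
have h1 := near_w t'; rewrite -ww nm_distC in h1; have h2 := near_w t.
have := nm_tri (per (x + (w t).1) (w t).2) (per (x + t) 0) (per (x + t') 0).
by have := lerD h2 h1; rewrite -splitr => h3 /le_trans; apply.
Qed.

(* The mean over R^d of the periodization does not depend on the internal
   variable, because L projects densely to H. *)
Lemma per_mean (e : R) : 0 < e -> exists2 s : seq E, s != [::] &
  forall x z, nm (avg s (fun y => per y z) x - mean (fun y => per y 0)) <= e.
Proof.
move=> e0; have e2 : 0 < e / 2 by lra.
have [s [s0 hs]] := meanP per_ap e2.
have [r0 [N [r00 hN hu]]] := per_ucont e2.
exists s => // x z; have [_ _ _ _ dens] := cps.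
(* By density some [l.2] is close to [- z], so shifting by [l] moves the internal variable close to
   0. *)
have nz : nbhs (- z) [set v | N (v + z)].
  by have := nbhs_of0 (- z) hN; rewrite opprK.
have [_ [[l Ll <-] /= hl]] : [set y.2 | y in L] `&` [set v | N (v + z)] !=set0.
  have : closure [set y.2 | y in L] (- z) by rewrite dens.
  by apply.
have h1 : nm (avg s (fun y => per y z) x - avg s (fun y => per y 0) (x + l.1)) <= e / 2.
  apply: avg_dist => // u.
  rewrite -(per_shift (x + u) z Ll).
  have := hu (x + l.1 + u) 0 0 (l.2 + z); rewrite normr0 => /(_ r00 hl).
  by rewrite addr0 add0r addrAC [l.2 + z]addrC.
have h2 := hs (x + l.1).
have := nm_tri (avg s (fun y => per y 0) (x + l.1)) (avg s (fun y => per y z) x)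
  (mean (fun y => per y 0)).
by have := lerD h1 h2; rewrite -splitr => h3 /le_trans; apply.
Qed.

End periodization.

(** * Density of lattice points *)

(** Integrate the pointwise lower bound over [B]. The empty index type is treated apart because the
    sign of [t] is read off some [V i]. *)
Lemma measure_weighted_cover d (T : measurableType d) (R : realType)
  (th : {measure set T -> \bar R}) (B : set T) (I : Type) (s : seq I)
  (V : I -> set T) (c : I -> R) (k t : R) : measurable B -> (th B < +oo)%E ->
  (forall i, measurable (V i)) -> (forall i, (th (V i) <= t%:E)%E) ->
  (forall i, 0 <= c i) ->
  (forall y, B y -> k <= \sum_(i <- s) c i * \1_(V i) y) ->
  k * fine (th B) <= (\sum_(i <- s) c i) * t.
Proof.
move=> mB finB mV thV c0 hk.
have fB : th B \is a fin_num by rewrite ge0_fin_numE.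
have [[i is_]|ns] := pselect (exists i : I, True); last first.
  have -> : s = [::] by case: (s) => // i s'; case: ns; exists i.
  rewrite big_nil mul0r; have [B0|] := pselect (B = set0).
    by rewrite B0 measure0 mulr0.
  move=> /eqP/set0P[y /hk]; have -> : s = [::] by case: (s) => // i s'; case: ns; exists i.
  by rewrite big_nil => k0; rewrite mulr_le0_ge0 // fine_ge0.
have t0 : 0 <= t by rewrite -lee_fin (le_trans _ (thV i)).
have [k0|k0] := leP k 0.
  apply: (@le_trans _ _ 0); first by rewrite mulr_le0_ge0 // fine_ge0.
  by rewrite mulr_ge0 // sumr_ge0.
have mVi j : measurable_fun B (EFin \o (\1_(V j) : T -> R)).
  by apply: measurableT_comp => //; exact: measurable_indic.
have mVc j : measurable_fun B (fun y : T => ((c j)%:E * (\1_(V j) y)%:E)%E).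
  by apply: emeasurable_funM => //; exact: mVi.
rewrite -lee_fin EFinM fineK // -integral_cst //.
apply: (@le_trans _ _ (\int[th]_(y in B) \sum_(i <- s) ((c i)%:E * (\1_(V i) y)%:E))%E).
  apply: ge0_le_integral => //.
  - by move=> y _ /=; rewrite lee_fin ltW.
  - by apply: emeasurable_sum => j; exact: mVc.
  - move=> y By; under eq_bigr do rewrite -EFinM; rewrite sumEFin lee_fin.
    exact: hk.
rewrite ge0_integral_sum //; first last.
- by move=> j y _; rewrite mule_ge0 ?lee_fin.
rewrite mulr_suml -sumEFin; apply: lee_sum => j _.
rewrite ge0_integralZl ?lee_fin //; last exact: mVi.
rewrite integral_indic // EFinM lee_wpmul2l ?lee_fin //.
apply: le_trans (thV j); apply: le_measure; rewrite ?inE //; first exact: measurableI.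
Qed.

Lemma ler_sum_subset (R : realType) (T : eqType) (s t : seq T) (F : T -> R) :
  uniq s -> uniq t -> {subset s <= t} -> (forall x, 0 <= F x) ->
  \sum_(x <- s) F x <= \sum_(x <- t) F x.
Proof.
move=> us ut st F0.
have : perm_eq s [seq x <- t | x \in s].
  apply: uniq_perm => //; first exact: filter_uniq.
  move=> x; rewrite mem_filter; case: (boolP (x \in s)) => //= xs.
  by rewrite st.
move=> h; rewrite (perm_big _ h) big_filter big_mkcond; apply: ler_sum => x _.
by case: ifP.
Qed.

Section density.
Variables (R : realType) (d : nat) (H : topologicalZmodType).
Local Notation E := 'rV[R]_d.
Local Notation C := R[i].
Local Notation nm := (@ComplexField.Normc.normc R).
Local Notation rc := (real_complex R).
Variable L : set (E * H).
Hypothesis cps : cut_project_scheme L.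
Variable th : {measure set (borel (zpt H)) -> \bar R}.
Hypothesis haar : haar_measure th.
Hypothesis hausH : hausdorff_space H.

(** A continuous tent, at least 1 on differences of two points of a unit cube and zero beyond norm
    2. *)
Definition bump (x : E) : R := Num.max 0 (2 - `|x|).

Lemma bump_ge0 x : 0 <= bump x. Proof. by rewrite /bump le_max lexx. Qed.

Lemma bump_le2 x : bump x <= 2.
Proof. by rewrite /bump ge_max ler0n /= gerBl. Qed.

Lemma bump_ge1 x : `|x| <= 1 -> 1 <= bump x.
Proof. by move=> h; rewrite /bump le_max; apply/orP; right; lra. Qed.

Lemma bump0 x : 2 < `|x| -> bump x = 0.
Proof. by move=> h; rewrite /bump max_l // subr_le0 ltW. Qed.

Lemma ccont_bump : ccont (fun x => rc (bump x)).
Proof.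
move=> x e e0; have := @nbhsx_ballx R E x e e0; apply: filterS => y.
rewrite -ball_normE => xy; rewrite /ball_ /= in xy; rewrite -rmorphB nm_real; apply: le_trans (ltW xy).
apply: (@le_trans _ _ `| `|y| - `|x| |); last by rewrite distrC ler_dist_dist.
rewrite /bump; move: (`|y|) (`|x|) => a b.
have h1 := ler_norm (a - b); have h2 := ler_norm (b - a).
rewrite [`|b - a|]distrC in h2.
by rewrite ler_norml; case: (leP 0 (2 - a)) => ha; case: (leP 0 (2 - b)) => hb;
  apply/andP; split; lra.
Qed.

Lemma ccont_real (T : topologicalType) (u : T -> R) : continuous u ->
  ccont (fun x => rc (u x)).
Proof.
move=> cu x e e0; have /cvgrPdist_le /(_ e e0) := cu x.
by apply: filterS => y; rewrite -rmorphB nm_real distrC.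
Qed.

Lemma haar_compact_pos : exists B : set H, [/\ compact B,
  measurable (B : set (borel (zpt H))) & (0 < th B)%E].
Proof.
have [_ _ inner nz _] := haar; apply: contrapT => nB.
have : (th setT <= 0)%E.
  rewrite (inner setT openT); apply: ge_ereal_sup => _ [K [cK _ ->]].
  rewrite leNgt; apply/negP => K0; apply: nB; exists K; split=> //.
  apply: (@closed_borel (zpt H)); exact: (compact_closed hausH cK).
by rewrite measure_le0; exact/negP.
Qed.

(** The mean is the same for every internal shift [y], so it may be integrated over [y] in [B]; each
    lattice point then contributes the measure of a translate of [U], which is [th U]. The constant
    depends on [Q0] alone, not on [u] or [U]. *)
Lemma mean_le_haar (Q0 : set H) : compact Q0 -> exists2 c0 : R, 0 <= c0 &
  forall (u : H -> R) (U : set H), continuous u -> open U -> U `<=` Q0 ->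
  (forall z, 0 <= u z <= 1) -> (forall z, ~ U z -> u z = 0) ->
  complex.Re (mean (fun x => per L (fun x => rc (bump x)) (fun z => rc (u z)) x 0)) <=
    c0 * fine (th U).
Proof.
move=> cQ0; have [B [cB mB B0]] := haar_compact_pos.
have [fin _ _ _ inv] := haar.
have finB := fin B cB.
have Bpos : 0 < fine (th B) by rewrite fine_gt0 // B0 finB.
(* The differences of [Q0] and [B]: they contain every [l.2] with [y + l.2] in [Q0] for some [y] in
   [B]. *)
pose Q := [set z | exists a b, [/\ Q0 a, B b & z = a - b]].
have cQ : compact Q.
  have -> : Q = (fun p : H * H => p.1 - p.2) @` (Q0 `*` B).
    apply/seteqP; split=> [_ [a [b [Qa Bb ->]]]|_ [[a b] [/= Qa Bb] <-]].
      by exists (a, b).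
    by exists a, b.
  apply: (@continuous_compact _ _ (fun p : H * H => p.1 - p.2)).
    by apply: continuous_subspaceT; exact: tvs.sub_continuous.
  exact: compact_setX.
have [Bc hBc] := lattice_count cps 2 cQ.
exists (2 * Bc%:R / fine (th B)).
  by rewrite divr_ge0 ?mulr_ge0 // ltW.
move=> u U cu oU UQ0 u01 u0; set m := mean _.
rewrite mulrAC ler_pdivlMr //.
have finU : (th U < +oo)%E.
  apply: le_lt_trans (fin _ cQ0); apply: le_measure => //; rewrite inE.
    exact: (@open_borel (zpt H)).
  by apply: (@closed_borel (zpt H)); exact: (compact_closed hausH cQ0).
have cru := ccont_real cu.
have ru0 z : ~ Q0 z -> rc (u z) = 0.
  by move=> nz; rewrite u0 //; apply: contra_not nz => /UQ0.
have bf0 (x : E) : 2 < `|x| -> rc (bump x) = 0 by move=> /bump0 ->.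
have [e0|] := leP (fine (th B)) 0; first by lra.
move=> _; apply/ler_addgt0Pr => e e0.
have e1 : 0 < e / fine (th B) by exact: divr_gt0.
have [s s0 hs] := per_mean cps ccont_bump bf0 cru cQ0 ru0 e1.
have Sx (x : E) : exists S : seq (E * H), uniq S /\
    forall l, l \in S <-> [/\ L l, `|x + l.1| <= 2 & Q (0 + l.2)].
  by have [S uS hS] := lattice_list cps 2 x 0 cQ; exists S.
have [S hS] := choice Sx.
pose S' := undup (flatten [seq S i | i <- s]).
have uS' : uniq S' by exact: undup_uniq.
have S'P l : l \in S' -> L l /\ Q l.2.
  rewrite mem_undup => /flattenP[_ /mapP[i _ ->]] /(proj2 (hS i) l)[].
  by rewrite add0r.
pose c (l : E * H) : R := (size s)%:R^-1 * \sum_(i <- s) bump (i + l.1).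
have sz : 0 < (size s)%:R :> R by rewrite ltr0n; case: (s) s0.
have c_ge0 l : 0 <= c l.
  by rewrite mulr_ge0 ?invr_ge0 ?ler0n // sumr_ge0 // => i _; exact: bump_ge0.
(* Exchange the sums: at each position [i] at most [Bc] lattice points carry weight, and [bump] is
   at most 2. *)
have csum : \sum_(l <- S') c l <= 2 * Bc%:R.
  rewrite /c -mulr_sumr ler_pdivrMl // exchange_big /=.
  apply: (@le_trans _ _ (\sum_(i <- s) 2 * Bc%:R)); last first.
    by rewrite big_const_seq count_predT iter_addr addr0 -[X in X <= _]mulr_natl.
  apply: ler_sum => i _.
  pose Si := [seq l <- S' | `|i + l.1| <= 2].
  have sSi : (size Si <= Bc)%N.
    apply: (hBc i 0); first exact: filter_uniq.
    move=> l; rewrite mem_filter => /andP[il /S'P[Ll Ql]]; split=> //.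
    by rewrite add0r.
  apply: (@le_trans _ _ (\sum_(l <- Si) 2)); last first.
    by rewrite big_const_seq count_predT iter_addr addr0 -[X in X <= _]mulr_natr ler_pM2l // ler_nat.
  rewrite big_filter [leRHS]big_mkcond /=; apply: ler_sum => l _; case: ifPn => [_|].
    exact: bump_le2.
  by rewrite -ltNge => /bump0 ->.
pose V (l : E * H) : set (borel (zpt H)) := [set y : H | U (y + l.2)].
have mV l : measurable (V l).
  apply: (@open_borel (zpt H)); rewrite openE => y Uy.
  by apply: nbhs_addr; apply: open_nbhs_nbhs.
have thV l : (th (V l) <= (fine (th U))%:E)%E.
  rewrite fineK ?ge0_fin_numE //.
  have mU : measurable (U : set (borel (zpt H))) by exact: (@open_borel (zpt H)).
  rewrite -(inv (- l.2) U mU) le_eqVlt; apply/orP; left; apply/eqP; congr (th _).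
  apply/seteqP; split=> [y Uy|_ [y Uy ->]].
    by exists (y + l.2) => //; rewrite addrC addrK.
  by rewrite /V /= addrC addrA subrr add0r.
have hk y : B y -> complex.Re m - e / fine (th B) <= \sum_(l <- S') c l * \1_(V l) y.
  move=> By; have h1 := hs 0 y.
  have h2 : complex.Re m - e / fine (th B) <= complex.Re
      (avg s (fun x => per L (fun x => rc (bump x)) (fun z => rc (u z)) x y) 0).
    rewrite lerBlDr -lerBlDl -ReN -ReD; apply: le_trans (Re_le_nm _) _.
    by rewrite nm_distC.
  apply: le_trans h2 _; rewrite Re_avg.
  have perE i : i \in s -> complex.Re (per L (fun x => rc (bump x)) (fun z => rc (u z)) (0 + i) y) =
      \sum_(l <- S') bump (i + l.1) * u (y + l.2).
    move=> is_; rewrite (@per_list _ _ _ _ _ _ 2 Q0 bf0 ru0 _ _ S') //.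
    - rewrite Re_sum; apply: eq_bigr => l _; rewrite -rmorphM /= add0r.
      by [].
    - by move=> l /S'P[].
    - move=> l Ll; rewrite add0r => il Qyl; rewrite mem_undup.
      apply/flattenP; exists (S i); first exact: map_f.
      apply/(proj2 (hS i)); split=> //; rewrite add0r.
      by exists (y + l.2), y; split=> //; rewrite addrC addKr.
  rewrite big_seq (eq_bigr _ perE) -big_seq exchange_big /= mulr_sumr.
  apply: ler_sum => l _; rewrite /c -mulrA mulr_suml.
  rewrite ler_wpM2l ?invr_ge0 ?ler0n //; apply: ler_sum => i _.
  rewrite ler_wpM2l ?bump_ge0 //; rewrite indicE.
  have [Ul|nUl] := pselect (V l y); first by rewrite mem_set //; have /andP[] := u01 (y + l.2).
  by rewrite u0.
have := measure_weighted_cover mB finB mV thV c_ge0 hk.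
rewrite mulrBl divfK ?gt_eqF // lerBlDr => h; apply: le_trans h _.
by rewrite lerD2r; apply: le_trans (ler_wpM2r _ csum) _; rewrite ?fine_ge0 // mulrAC.
Qed.

Variable A : nat -> set E.
Hypotheses (avA : averaging_seq A) (vHA : van_Hove A).

(** Lattice points near [A n] are sorted into at most [2 vol (A n)] unit cubes, and the periodized
    bump at a cube's corner dominates its points. Averaging over shifts of the cubes replaces these
    values by the mean, which [mean_le_haar] bounds. *)
Lemma density_bound (Q0 : set H) (r : R) : compact Q0 -> 0 <= r ->
  exists2 c1 : R, 0 <= c1 &
  forall (u : H -> R) (U : set H), continuous u -> open U -> U `<=` Q0 ->
  (forall z, 0 <= u z <= 1) -> (forall z, ~ U z -> u z = 0) ->
  forall e : R, 0 < e -> exists n0, forall n, (n0 <= n)%N ->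
  forall s : seq (E * H), uniq s ->
  (forall l, l \in s -> L l /\ exists2 a, A n a & `|l.1 - a| <= r) ->
  \sum_(l <- s) u l.2 <= (c1 * fine (th U) + e) * vol (A n).
Proof.
move=> cQ0 r0; have [c0 c00 hc0] := mean_le_haar cQ0.
exists (2 * c0); first by rewrite mulr_ge0.
move=> u U cu oU UQ0 u01 u0 e e0; have e2 : 0 < e / 2 by lra.
have cru := ccont_real cu.
have ru0 z : ~ Q0 z -> rc (u z) = 0.
  by move=> nz; rewrite u0 //; apply: contra_not nz => /UQ0.
have bf0 (x : E) : 2 < `|x| -> rc (bump x) = 0 by move=> /bump0 ->.
set F := per L (fun x => rc (bump x)) (fun z => rc (u z)).
have [t t0 ht] := per_mean cps ccont_bump bf0 cru cQ0 ru0 e2.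
have hm := hc0 u U cu oU UQ0 u01 u0.
pose rho := \sum_(i <- t) `|i|.
have rho_ge i : i \in t -> `|i| <= rho.
  by move=> it; rewrite /rho (big_rem i) //= lerDl sumr_ge0.
have rr0 : 0 <= r + rho by rewrite addr_ge0 // sumr_ge0.
have [n0 hn0] := near_count avA vHA rr0.
exists n0 => n /hn0[v1 hZ] s us hs.
pose z i (l : E * H) := zfl (l.1 + i).
pose p (z : 'rV[int]_d) : E := \row_i (z 0 i)%:~R.
pose Z := undup [seq z i l | i <- t, l <- s].
have szZ : (size Z)%:R <= 2 * vol (A n).
  apply: hZ; first exact: undup_uniq.
  move=> w; rewrite mem_undup => /allpairsP[[i l] /= [it ls ->]].
  have [_ [a Aa la]] := hs l ls; exists (l.1 + i), a; split=> //.
    exact: cube_zfl.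
  rewrite addrAC; apply: le_trans (ler_normD _ _) _.
  by rewrite lerD // rho_ge.
have FE (x : E) : exists S : seq (E * H), [/\ uniq S, {subset s <= S} &
    complex.Re (F x 0) = \sum_(l <- S) bump (x + l.1) * u l.2].
  have [S uS hS] := lattice_list cps 2 x 0 cQ0.
  exists (undup (s ++ S)); split; first exact: undup_uniq.
    by move=> l ls; rewrite mem_undup mem_cat ls.
  rewrite /F (@per_list _ _ _ _ _ _ 2 Q0 bf0 ru0 _ _ (undup (s ++ S))).
  - rewrite Re_sum; apply: eq_bigr => l _; rewrite -rmorphM /= add0r.
    by [].
  - exact: undup_uniq.
  - by move=> l; rewrite mem_undup mem_cat => /orP[/hs[]|/hS[]].
  - by move=> l Ll l1 l2; rewrite mem_undup mem_cat; apply/orP; right; apply/hS.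
have u_ge0 w : 0 <= u w by have /andP[] := u01 w.
(* For each shift [i] the cubes still catch all points of [s], so the same left-hand side is bounded
   for every [i] and the average over [t] can be taken. *)
have term i : i \in t -> \sum_(l <- s) u l.2 <= \sum_(w <- Z) complex.Re (F (- p w + i) 0).
  move=> it.
  apply: (@le_trans _ _ (\sum_(l <- s) \sum_(w <- Z | z i l == w) u l.2)).
    rewrite big_seq [leRHS]big_seq; apply: ler_sum => l ls.
    rewrite big_const_seq iter_addr addr0 -[leLHS]mulr1n ler_wpMn2l //.
    rewrite -has_count; apply/hasP; exists (z i l) => //=.
    by rewrite mem_undup allpairs_f.
  rewrite (exchange_big_dep xpredT) //=; apply: ler_sum => w _.
  have [S [uS sS ->]] := FE (- p w + i).
  apply: (@le_trans _ _ (\sum_(l <- s) bump (- p w + i + l.1) * u l.2)).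
    rewrite big_mkcond /=; apply: ler_sum => l _; case: ifPn => [/eqP zl|_]; last first.
      by rewrite mulr_ge0 ?bump_ge0.
    rewrite ler_peMl // bump_ge1 // -addrA addrC [i + _]addrC.
    apply: (@cube_dist _ _ w); first by rewrite -zl; exact: cube_zfl.
    by move=> j; rewrite mxE lexx lerDl ler01.
  by apply: ler_sum_subset => // l; rewrite mulr_ge0 ?bump_ge0.
have tsz : 0 < (size t)%:R :> R by rewrite ltr0n; case: (t) t0.
have avgE w : complex.Re (avg t (fun x => F x 0) (- p w)) <= c0 * fine (th U) + e / 2.
  have h := ht (- p w) 0; have := le_trans (Re_le_nm _) h; rewrite ReD ReN => h'.
  by move: hm h'; rewrite -/F => h1 h2; rewrite addrC -lerBlDr (le_trans _ h2) // lerB.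
apply: (@le_trans _ _ (\sum_(w <- Z) complex.Re (avg t (fun x => F x 0) (- p w)))).
  under [leRHS]eq_bigr do rewrite Re_avg.
  rewrite -mulr_sumr ler_pdivlMl // exchange_big /=.
  apply: (@le_trans _ _ (\sum_(i <- t) \sum_(l <- s) u l.2)).
    by rewrite big_const_seq count_predT iter_addr addr0 -[leRHS]mulr_natl.
  by rewrite big_seq [leRHS]big_seq; apply: ler_sum => i it; exact: term.
apply: (@le_trans _ _ (\sum_(w <- Z) (c0 * fine (th U) + e / 2))).
  by apply: ler_sum => w _; exact: avgE.
rewrite big_const_seq count_predT iter_addr addr0 -[leLHS]mulr_natl.
have k0 : 0 <= c0 * fine (th U) + e / 2.
  by rewrite addr_ge0 ?mulr_ge0 ?fine_ge0 // ltW.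
apply: le_trans (ler_wpM2r k0 szZ) _.
rewrite le_eqVlt; apply/orP; left; apply/eqP.
by field.
Qed.

End density.

(** * The window and the conclusion *)

Section boundary_bump.
Variables (R : realType) (H : topologicalZmodType).
Variable th : {measure set (borel (zpt H)) -> \bar R}.
Hypotheses (lca : LCA H) (haar : haar_measure th).

Lemma compact_neighbourhood (W : set H) : compact W ->
  exists2 Q : set H, compact Q & W `<=` interior Q.
Proof.
move=> cW; have [hH lcH] := lca.
have hx (x : H) : exists K : set H, nbhs x K /\ compact K.
  have [K /= nK [cK _]] := lcH x I; exists K; split=> //.
  by move: nK; rewrite withinET.
have [K hK] := choice hx.
have [s [_ hs]] := @compact_nbhs_cover _ W (fun x => interior (K x)) cW
  (fun x _ => nbhs_interior (proj1 (hK x))).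
exists (\big[setU/set0]_(x <- s) K x).
  by apply: bigsetU_compact => x _; have [] := hK x.
move=> z /hs[x xs]; apply: interiorS; rewrite (big_rem x) //=.
Qed.

(** Complete regularity separates single points from the complement of [U]; finitely many separators
    exceed one half somewhere at each point of [D], so twice their sum, capped at 1, works. *)
Lemma compact_separation (D U : set H) : compact D -> open U -> D `<=` U ->
  exists u : H -> R, [/\ continuous u, forall z, 0 <= u z <= 1,
    forall z, D z -> u z = 1 & forall z, ~ U z -> u z = 0].
Proof.
move=> cD oU DU; have [hH lcH] := lca.
have cr := @locally_compact_completely_regular H R lcH hH.
have hx (a : H) : exists g : H -> R, [/\ continuous g, forall z, 0 <= g z <= 1,
    (U a -> g a = 1) & forall z, ~ U z -> g z = 0].
  have [Ua|nUa] := pselect (U a); last first.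
    exists (fun=> 0); split=> //; first by move=> x; exact: cvg_cst.
    by move=> _; rewrite lexx ler01.
  have /(@uniform_separatorP _ R)[f [cf f01 fa fU]] : uniform_separator [set a] (~` U).
    apply: cr; first exact: open_closedC.
    by apply.
  exists (fun z => 1 - f z); split.
  - by move=> z; apply: cvgB; [exact: cvg_cst|exact: cf].
  - move=> z; have : `[0, 1]%classic (f z) by apply: f01; exists z.
    by rewrite /= in_itv /= => /andP[h1 h2]; apply/andP; split; lra.
  - by move=> _; rewrite (fa (f a)) ?subr0 //; exists a.
  - by move=> z nUz; rewrite (fU (f z)) ?subrr //; exists z.
have [g hg] := choice hx.
have nb (a : H) : D a -> nbhs a [set z | 2^-1 < g a z].
  move=> Da; have [cg _ g1 _] := hg a.
  have h1 : nbhs (g a a) [set y | 2^-1 < y].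
    apply: open_nbhs_nbhs; split; first exact: open_gt.
    by rewrite /= g1; [rewrite invf_lt1 ?ltr1n|exact: DU].
  exact: (cg a _ h1).
have [s [_ hs]] := @compact_nbhs_cover _ D (fun a z => 2^-1 < g a z) cD nb.
pose S z := 2 * \sum_(a <- s) g a z.
have g0 a z : 0 <= g a z by have [_ h _ _] := hg a; have /andP[] := h z.
have S0 z : 0 <= S z by rewrite mulr_ge0 // sumr_ge0.
exists (fun z => Num.min 1 (S z)); split.
- move=> z; apply: (@continuous_min R); first exact: cvg_cst.
  apply: cvgM; first exact: cvg_cst.
  apply: cvg_big => [|a _]; first exact: add_continuous.
  by have [cg _ _ _] := hg a; exact: cg.
- by move=> z; rewrite le_min ler01 S0 ge_min lexx.
- move=> z /hs[a as_ ga]; rewrite min_l // /S (big_rem a) //= mulrDr.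
  have h : 0 <= 2 * \sum_(y <- rem a s) g y z by rewrite mulr_ge0 // sumr_ge0.
  lra.
- move=> z nUz; have Sz : S z = 0.
    rewrite /S big1 ?mulr0 // => a _.
    by have [_ _ _ h] := hg a; exact: h.
  by rewrite Sz min_r.
Qed.

(** The compact [Q] is fixed before [e], so constants derived from [Q] remain valid as [U] shrinks.
    Outer regularity provides [U] around the null boundary of [W]. *)
Lemma window_approximation (W : set H) : regular_window th W ->
  exists Q : set H, [/\ compact Q, W `<=` Q & forall e : R, 0 < e ->
  exists (U : set H) (u h : H -> R),
    [/\ [/\ open U, U `<=` Q & fine (th U) <= e],
        [/\ continuous u, forall z, 0 <= u z <= 1 & forall z, ~ U z -> u z = 0],
        [/\ continuous h, forall z, ~ Q z -> h z = 0 & forall z, 0 <= h z <= 1] &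
        forall z, `|(`[< W z >])%:R - h z| <= u z]].
Proof.
move=> [cW _ _ bd0]; have [hH _] := lca.
have clW : closed W by exact: (compact_closed hH cW).
have [Q cQ WQ] := compact_neighbourhood cW.
have WQ' : W `<=` Q by move=> z /WQ /interior_subset.
exists Q; split=> // e e0.
pose D := W `\` interior W.
have cD : compact D.
  apply: (@subclosed_compact _ _ W) => //; last by move=> z [].
  by apply: closedI => //; apply: open_closedC; exact: open_interior.
have mD : measurable (D : set (borel (zpt H))).
  by apply: (@closed_borel (zpt H)); exact: (compact_closed hH cD).
have [fin outer _ _ _] := haar.
have thD : th D = 0%E by move: bd0; rewrite -(closure_id W).1.
have : (ereal_inf [set v | exists U : set H, [/\ open U, D `<=` U & v = th U]] < e%:E)%E.
  by rewrite -outer // thD lte_fin.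
move=> /ereal_inf_lt[_ [U0 [oU0 DU0 ->]] thU0].
pose U := U0 `&` interior Q.
have oU : open U by apply: openI => //; exact: open_interior.
have UQ : U `<=` Q by move=> z [_ /interior_subset].
have DU : D `<=` U by move=> z Dz; split; [exact: DU0|apply: WQ; case: Dz].
have mU : measurable (U : set (borel (zpt H))) by exact: (@open_borel (zpt H)).
have mU0 : measurable (U0 : set (borel (zpt H))) by exact: (@open_borel (zpt H)).
have thU : (th U <= e%:E)%E.
  apply: le_trans (ltW thU0); apply: le_measure; rewrite ?inE //.
  exact: subIsetl.
have [u [cu u01 uD uU]] := compact_separation cD oU DU.
(* Continuous across the boundary of [W] because [u] equals 1 there; it differs from the indicator
   only off [W], by exactly [u]. *)
pose h z := if `[< W z >] then 1 else u z.
have u0 z : 0 <= u z by have /andP[] := u01 z.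
have u1 z : u z <= 1 by have /andP[] := u01 z.
exists U, u, h; split.
- split=> //; rewrite -lee_fin fineK // ge0_fin_numE //.
  exact: le_lt_trans thU (ltry _).
- by [].
- split.
  + move=> z; have [Wz|nWz] := pselect (W z); last first.
      have nbW : nbhs z (~` W) by apply: open_nbhs_nbhs; split; [exact: closed_openC|].
      apply/cvgrPdist_le => d d0; have /cvgrPdist_le /(_ d d0) hu := cu z.
      apply: filterS (filterI nbW hu) => y [nWy] /=.
      by rewrite /h (asboolF nWz) (asboolF nWy).
    have [iWz|niWz] := pselect (interior W z).
      apply/cvgrPdist_le => d d0; apply: filterS iWz => y Wy.
      by rewrite /h (asboolT Wz) (asboolT Wy) subrr normr0 ltW.
    apply/cvgrPdist_le => d d0; have /cvgrPdist_le /(_ d d0) := cu z.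
    have -> : u z = 1 by apply: uD.
    apply: filterS => y; rewrite /h (asboolT Wz); case: asboolP => // _ _.
    by rewrite subrr normr0 ltW.
  + move=> z nQz; rewrite /h asboolF; last by move=> /WQ'.
    by apply: uU => /UQ.
  + by move=> z; rewrite /h; case: asboolP => // _; rewrite ler01 lexx.
- move=> z; rewrite /h; case: asboolP => _; first by rewrite subrr normr0.
  by rewrite sub0r normrN ger0_norm.
Qed.

End boundary_bump.

(** * Sums over model sets and the final estimate *)

Section model_sets.
Variables (R : realType) (d : nat) (H : topologicalZmodType).
Local Notation E := 'rV[R]_d.
Local Notation C := R[i].
Local Notation nm := (@ComplexField.Normc.normc R).
Local Notation rc := (real_complex R).
Variables (A : nat -> set E) (mu : cradon R d) (L : set (E * H)).
Hypothesis cps : cut_project_scheme L.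

Lemma lattice_inj (l m : E * H) : L l -> L m -> l.1 = m.1 -> l = m.
Proof. by have [_ _ _ h _] := cps; exact: h. Qed.

(** Injectivity of the projection on [L] allows a sum over physical points to be taken over lattice
    points, where it can be compared with the periodization. *)
Lemma comb_sum (W : set H) (B : set E) (T : seq (E * H)) (F : E -> C) : uniq T ->
  (forall l, l \in T -> L l) -> (forall l, L l -> W l.2 -> B l.1 -> l \in T) ->
  (\sum_(y \in model_set L W `&` B) F y)%R =
  \sum_(l <- T) rc (`[< W l.2 /\ B l.1 >])%:R * F l.1.
Proof.
move=> uT TL hT.
pose T1 := [seq l <- T | `[< W l.2 /\ B l.1 >]].
have T1P l : l \in T1 -> [/\ L l, W l.2 & B l.1].
  by rewrite mem_filter => /andP[/asboolP[Wl Bl] /TL].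
have us : uniq [seq l.1 | l <- T1].
  rewrite map_inj_in_uniq ?filter_uniq // => l m /T1P[Ll _ _] /T1P[Lm _ _].
  exact: lattice_inj.
have sub y : y \in [seq l.1 | l <- T1] -> (model_set L W `&` B) y.
  by move=> /mapP[l /T1P[Ll Wl Bl] ->]; split=> //; exists l.
rewrite (fsbigE [seq l.1 | l <- T1]) //; last first.
  move=> y [[l [Ll Wl] ly] By]; rewrite -ly => /negP[]; apply: map_f.
  rewrite mem_filter; apply/andP; split; first by apply/asboolP; rewrite ly.
  by apply: hT => //; rewrite ly.
have -> : \sum_(y <- [seq l.1 | l <- T1] | y \in model_set L W `&` B) F y =
    \sum_(l <- T1) F l.1.
  rewrite -(big_map fst xpredT F) big_seq_cond [RHS]big_seq; apply: eq_bigl => y.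
  by case: (boolP (y \in _)) => //= /sub ys; rewrite mem_set.
rewrite big_filter big_mkcond; apply: eq_bigr => l _.
by case: asboolP => _; rewrite ?rmorph1 ?mul1r ?rmorph0 ?mul0r.
Qed.

(** Points in one cube are within distance 1 of its corner, so [lattice_count] bounds their number
    uniformly. *)
Lemma points_per_cube (W : set H) : compact W -> exists B : nat,
  forall s : seq (E * H), uniq s -> (forall l, l \in s -> L l /\ W l.2) ->
  (size s <= B * size (undup [seq zfl l.1 | l <- s]))%N.
Proof.
move=> cW; have [B hB] := lattice_count cps 1 cW; exists B => s us hs.
pose p (z : 'rV[int]_d) : E := \row_i (z 0 i)%:~R.
set Z := undup _.
have h : (size s <= \sum_(z <- Z) count (fun l => zfl l.1 == z) s)%N.
  apply: (size_count_cover (P := fun z l => zfl l.1 == z)) => l ls.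
  by exists (zfl l.1) => //; rewrite mem_undup; exact: map_f.
apply: leq_trans h _; apply: (@leq_trans (\sum_(z <- Z) B)%N).
  apply: leq_sum => z _; rewrite -size_filter; apply: (hB (- p z) 0).
    exact: filter_uniq.
  move=> l; rewrite mem_filter => /andP[/eqP zl /hs[Ll Wl]]; split=> //.
    rewrite addrC; apply: (@cube_dist _ _ z); first by rewrite -zl; exact: cube_zfl.
    by move=> i; rewrite mxE lexx lerDl ler01.
  by rewrite add0r.
by rewrite big_const_seq count_predT iter_addn_0.
Qed.

End model_sets.

Unset Implicit Arguments.
Set Strict Implicit.

Theorem theorem4p5 (R : realType) (d : nat) (A : nat -> set 'rV[R]_d)
  (mu : cradon R d)
  (H : topologicalZmodType) (th : {measure set (borel (zpt H)) -> \bar R})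
  (L : set ('rV[R]_d * H)) (W : set H) :
  averaging_seq A -> symmetric_seq A -> van_Hove A ->
  translation_bounded mu -> null_FB mu A ->
  LCA H -> compactly_generated H -> haar_measure th ->
  cut_project_scheme L -> regular_window th W ->
  eberlein_comb_zero mu (model_set L W) A.
Proof.
move=> avA symA vHA tb nullA lca _ haar cps regW f [cont_f [K [cK fK]]].
pose nm := @ComplexField.Normc.normc R; pose rc := real_complex R.
have cf := continuous_ccont cont_f.
have [r r0 hr] := compact_norm_le cK.
have f0 x : r < `|x| -> f x = 0.
  by move=> rx; apply: fK => /hr; rewrite leNgt rx.
have [hH _] := lca; have [cW _ _ _] := regW.
pose I n (l : 'rV[R]_d * H) := cint mu (A n) (fun x => f (x + l.1)).
have [c1 c10 hI] := cint_translate_bound tb avA cf f0.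
have [Q [cQ WQ approx]] := window_approximation lca haar regW.
have [c2 c20 dens] := density_bound cps haar hH avA vHA cQ r0.
have [B hB] := points_per_cube cps cW.
apply: cvg0_nm => e e0.
(* Four quarters of [e]: three errors of size [c1 * eta], namely the measure of [U], the density
   error and the points outside [A n], and one for the average of the periodization. *)
pose eta := e / 4 / (c1 + 1).
have c1p : 0 < c1 + 1 by rewrite ltr_wpDl.
have c2p : 0 < c2 + 1 by rewrite ltr_wpDl.
have Bp : 0 < B%:R + 1 :> R by rewrite ltr_wpDl.
have e4 : 0 < e / 4 by rewrite divr_gt0.
have eta0 : 0 < eta by rewrite divr_gt0.
have [U [u [h [[oU UQ thU] [cu u01 uU] [ch hQ h01] uh]]]] := approx _ (divr_gt0 eta0 c2p).
have crh := ccont_real ch.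
have rh0 z : ~ Q z -> rc (h z) = 0 by move=> /hQ ->.
have [n1 hn1] := dens u U cu oU UQ u01 uU eta eta0.
have [n2 hn2] := boundary_count avA vHA r0 (divr_gt0 eta0 Bp).
have [n3 hn3] := ap_null_mean tb avA vHA nullA (per_ap cps cf f0 crh cQ rh0)
  (per_ucont0 cps cf f0 crh cQ rh0) e4.
have [n4 hn4] := averaging_vol_ge1 avA.
exists (maxn (maxn n1 n2) (maxn n3 n4)) => n.
rewrite !geq_max => /andP[/andP[/hn1 {}hn1 /hn2 {}hn2] /andP[/hn3 {}hn3 /hn4 v1]].
have v0 : 0 < vol (A n) by apply: lt_le_trans v1.
have cA : compact (A n) by case: avA.
have bA : bborel (A n) by exact: compact_bborel.
have [rn rn0 hrn] := compact_norm_le cA.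
(* If [x] is in [A n] and [x + l.1] has norm at most [r], then [l.1] has norm at most [rn + r];
   hence one list [T] serves both sums. *)
have [T uT hT] := lattice_list cps (rn + r) 0 0 cQ.
have TL l : l \in T -> L l by move=> /hT[].
have TQ l : L l -> `|l.1| <= rn + r -> Q l.2 -> l \in T.
  by move=> Ll l1 l2; apply/hT; rewrite !add0r.
pose nearA (l : 'rV[R]_d * H) := `[< exists2 a, A n a & `|l.1 - a| <= r >].
(* Symmetry of [A n] is used here: a nonzero integrand at [x] puts [l.1] within [r] of [- x], a
   point of [A n]. *)
have I_far l : ~~ nearA l -> I n l = 0.
  move=> nl; rewrite /I -[RHS](cint0 mu bA); apply: eq_cint => x Ax.
  apply: f0; rewrite ltNge; apply: contra nl => xl; apply/asboolP.
  exists (- x); last by rewrite opprK addrC.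
  by rewrite -(symA n); exists x.
have combE : restr_conv_comb mu (model_set L W) (A n) f =
    \sum_(l <- T) rc (`[< W l.2 /\ A n l.1 >])%:R * I n l.
  rewrite /restr_conv_comb (comb_sum cps (fun y => cint mu (A n) (fun x => f (x + y))) uT TL (W := W) (B := A n)) //.
  move=> l Ll Wl Al; apply: TQ => //; last exact: WQ.
  by rewrite (le_trans (hrn _ Al)) // lerDl.
have perE : cint mu (A n) (fun x => per L f (fun z => rc (h z)) x 0) =
    \sum_(l <- T) rc (h l.2) * I n l.
  rewrite (@eq_cint _ _ _ _ _ (fun x => \sum_(l <- T) rc (h l.2) * f (x + l.1))); last first.
    move=> x Ax; rewrite (per_list f0 rh0 uT TL); last first.
      move=> l Ll xl; rewrite add0r => Ql; apply: TQ => //.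
      rewrite -(addKr x l.1); apply: le_trans (ler_normD _ _) _.
      by rewrite normrN lerD // hrn.
    by apply: eq_bigr => l _; rewrite add0r mulrC.
  rewrite cint_sum //; last by move=> l; apply: ccontZ; exact: ccont_shift.
  by apply: eq_bigr => l _; rewrite cintZ //; exact: ccont_shift.
have {}hn3 : nm (rc (vol (A n))^-1 * \sum_(l <- T) rc (h l.2) * I n l) <= e / 4.
  by rewrite -perE.
pose T' := [seq l <- T | nearA l].
have uT' : uniq T' by exact: filter_uniq.
have T'P l : l \in T' -> L l /\ exists2 a, A n a & `|l.1 - a| <= r.
  by rewrite mem_filter => /andP[/asboolP h1 /TL].
(* The window points missed by the restriction to [A n]: each lies in a boundary cube, with at most
   [B] per cube. *)
pose T'' := [seq l <- T' | `[< W l.2 /\ ~ A n l.1 >]].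
have sizeT'' : (size T'')%:R <= eta * vol (A n).
  have uT'' : uniq T'' by exact: filter_uniq.
  have h1 : (size T'' <= B * size (undup [seq zfl l.1 | l <- T'']))%N.
    apply: hB => // l; rewrite mem_filter => /andP[/asboolP[Wl _] /T'P[Ll _]].
    by split.
  have h2 : (size (undup [seq zfl l.1 | l <- T'']))%:R <= eta / (B%:R + 1) * vol (A n).
    apply: hn2; first exact: undup_uniq.
    move=> z; rewrite mem_undup => /mapP[l]; rewrite mem_filter.
    move=> /andP[/asboolP[_ nAl] /T'P[_ [a Aa la]]] ->.
    by exists l.1, a; split=> //; exact: cube_zfl.
  rewrite -(ler_nat R) natrM in h1; apply: le_trans h1 _.
  apply: le_trans (ler_wpM2l (ler0n _ B) h2) _.
  rewrite mulrA ler_wpM2r ?(ltW v0) // mulrCA ger_pMr //.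
  by rewrite ler_pdivrMr // mul1r lerDl.
have sumu : \sum_(l <- T') u l.2 <= (eta + eta) * vol (A n).
  apply: le_trans (hn1 T' uT' T'P) _; rewrite ler_wpM2r ?(ltW v0) // lerD2r.
  apply: le_trans (ler_wpM2l c20 thU) _.
  by rewrite mulrCA ger_pMr // ler_pdivrMr // mul1r lerDl.
(* In the window and in [A n] the weights differ by at most [u]; in the window but outside [A n], by
   at most 1; off the window [h] itself is at most [u]. *)
have term l : nm (rc (`[< W l.2 /\ A n l.1 >])%:R * I n l - rc (h l.2) * I n l) <=
    c1 * (u l.2 + (`[< W l.2 /\ ~ A n l.1 >])%:R).
  rewrite -mulrBl -rmorphB /nm nmM nm_real mulrC ler_pM ?nm_ge0 //; first exact: hI.
  have := uh l.2; have := u01 l.2 => /andP[ul0 _].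
  case: (asboolP (W l.2)) => Wl; case: (asboolP (A n l.1)) => Al hu.
  - rewrite (asboolT (conj Wl Al)) asboolF ?addr0 //; by case.
  - rewrite asboolF; last by case.
    rewrite asboolT // sub0r normrN ger0_norm; last by have /andP[] := h01 l.2.
    by have /andP[_ h1] := h01 l.2; rewrite (le_trans h1) // lerDr.
  - rewrite asboolF; last by case.
    by rewrite asboolF ?addr0 //; case.
  - rewrite asboolF; last by case.
    by rewrite asboolF ?addr0 //; case.
have diff : nm (\sum_(l <- T) rc (`[< W l.2 /\ A n l.1 >])%:R * I n l -
    \sum_(l <- T) rc (h l.2) * I n l) <= c1 * ((eta + eta) * vol (A n) + eta * vol (A n)).
  (* Far points drop out by [I_far], leaving [T'], to which the density and boundary counts
     apply. *)
  rewrite -sumrB (bigID nearA) /= [X in _ + X]big1 ?addr0; last first.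
    by move=> l /I_far ->; rewrite !mulr0 subrr.
  rewrite -big_filter -/T'; apply: le_trans (nm_sum _ _) _.
  apply: le_trans (ler_sum _ (fun l _ => term l)) _.
  rewrite -mulr_sumr ler_wpM2l // big_split lerD //.
  apply: le_trans sizeT''; rewrite le_eqVlt; apply/orP; left; apply/eqP.
  by rewrite size_filter -sum1_count natr_sum [RHS]big_mkcond; apply: eq_bigr => l _; case: asboolP.
rewrite combE -(subrK (\sum_(l <- T) rc (h l.2) * I n l) (\sum_(l <- T) _)).
rewrite mulrDr; apply: le_trans (nmD _ _) _.
have -> : e = e / 4 * 3 + e / 4 by lra.
apply: lerD => //.
rewrite nmM nm_real gtr0_norm ?invr_gt0 // mulrC ler_pdivrMr //.
apply: le_trans diff _.
have -> : (eta + eta) * vol (A n) + eta * vol (A n) = 3 * eta * vol (A n) by ring.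
rewrite mulrA ler_wpM2r ?(ltW v0) // /eta.
have -> : c1 * (3 * (e / 4 / (c1 + 1))) = e / 4 * 3 * (c1 / (c1 + 1)) by field; exact: lt0r_neq0.
by rewrite ger_pMr ?mulr_gt0 // ler_pdivrMr // mul1r lerDl.
Qed.
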